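(* Let $E$ and $F$ be Polish spaces with Borel $\sigma$-fields $\mathcal{B}(E)$, $\mathcal{B}(F)$. For each $x\in F$ let $P_x$ be a Markov kernel on $E$ such that for every $A\in\mathcal{B}(E)$ the map $(x,y)\mapsto P_x(y,A)$ is measurable on $F\times E$. Let $X=(X_t)_{t\in\mathbb{Z}}$ be an $F$-valued stochastic process on a probability space $(\Omega,\mathcal{A},\mathbb{P})$. Assume: (A1) $X$ is stationary. (A2) There exist a measurable $V:E\to(0,\infty)$ and two measurable maps $\lambda,b:F\to\mathbb{R}_+$ with $\mathbb{E}[\log^+\lambda(X_0)]<\infty$ and $\mathbb{E}[\log^+ b(X_0)]<\infty$, such that for all $x\in F$ and $y\in E$, $P_xV(y)\le \lambda(x)V(y)+b(x)$, and $$\limsup_{n\to\infty}\Big(\prod_{i=1}^n\lambda(X_{-i})\Big)^{1/n}<1\quad\text{a.s.}$$ (A3) There exists a measurable map $\eta:(0,\infty)\times F\to(0,1)$ such that for every $R>0$ there is a probability kernel $\nu_R$ from $F$ to $E$ with $$P_x(y,A)\ge \eta(R,x)\,\nu_R(x,A)\quad\text{for all } x\in F,\ y\in V^{-1}([0,R]),\ A\in\mathcal{B}(E).$$ Then there exists a stationary process $((Y_t,X_t))_{t\in\mathbb{Z}}$ (with $(X_t)_{t\in\mathbb{Z}}$ distributed as the given environment) satisfying $$\mathbb{P}\left(Y_t\in A\mid X,Y_{t-1},Y_{t-2},\ldots\right)=P_{X_{t-1}}(Y_{t-1},A),\qquad t\in\mathbb{Z},\ A\in\mathcal{B}(E),$$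 and the distribution of such a process is unique. If in addition $(X_t)_{t\in\mathbb{Z}}$ is ergodic, then $((Y_t,X_t))_{t\in\mathbb{Z}}$ is also ergodic.
   Context: $\log^+(u)=\log(\max(u,1))$ for $u\ge 0$. For a Markov kernel $P$ and a measurable $V\ge0$, $PV(y)=\int P(y,dy')V(y')$. A process $((Y_t,X_t))_{t\in\mathbb{Z}}$ satisfying the displayed conditional-distribution identity is called a Markov chain in the random environment $X$; in the identity, $X$ denotes the whole sequence $(X_s)_{s\in\mathbb{Z}}$. *)

(* Defs.v *)
From HB Require Import structures.
From mathcomp Require Import all_boot all_order all_algebra.
From mathcomp Require Import all_classical all_reals all_analysis.
Set Implicit Arguments. Unset Strict Implicit. Unset Printing Implicit Defensive.
Import Order.TTheory GRing.Theory Num.Theory.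
Local Open Scope classical_set_scope.
Local Open Scope ring_scope.

Definition metric_open (R : realType) (T : Type) (dist : T -> T -> R) : set (set T) :=
  [set U | forall x, U x -> exists2 e : R, 0 < e & forall y, dist x y < e -> U y].

Definition polish_borel (R : realType) (d : measure_display) (T : measurableType d) : Prop :=
  exists dist : T -> T -> R,
    (forall x y, dist x y = 0 <-> x = y) /\
        (forall x y, dist x y = dist y x) /\
        (forall x y z, dist x z <= dist x y + dist y z) /\
        (forall u : nat -> T,
           (forall e : R, 0 < e -> exists N, forall m n, (N <= m)%N -> (N <= n)%N ->
               dist (u m) (u n) < e) ->
           exists l, forall e : R, 0 < e -> exists N, forall n, (N <= n)%N -> dist (u n) l < e) /\
        (exists D : set T, countable D /\
           forall x (e : R), 0 < e -> exists2 z, D z & dist x z < e) /\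
        (@measurable d T = <<s metric_open dist >>).

Definition logp (R : realType) (u : R) : R := ln (Num.max u 1).

Definition same_law (R : realType) (dT : measure_display) (T : measurableType dT)
  (d1 : measure_display) (O1 : measurableType d1) (P1 : probability O1 R) (Z1 : int -> O1 -> T)
  (d2 : measure_display) (O2 : measurableType d2) (P2 : probability O2 R) (Z2 : int -> O2 -> T) : Prop :=
  forall (n : nat) (ts : 'I_n -> int) (As : 'I_n -> set T),
    (forall i, measurable (As i)) ->
    P1 [set w | forall i, As i (Z1 (ts i) w)] = P2 [set w | forall i, As i (Z2 (ts i) w)].

Definition measurable_process (dT : measure_display) (T : measurableType dT)
  (d : measure_display) (O : measurableType d) (Z : int -> O -> T) : Prop :=
  forall t, measurable_fun setT (Z t).

Definition stationary (R : realType) (dT : measure_display) (T : measurableType dT)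
  (d : measure_display) (O : measurableType d) (P : probability O R) (Z : int -> O -> T) : Prop :=
  forall s : int, same_law P (fun t => Z (t + s)) P Z.

Definition path_sigma (dT : measure_display) (T : measurableType dT) : set (set (int -> T)) :=
  <<s [set C | exists (t : int) (A : set T), measurable A /\ C = [set z | A (z t)]] >>.

Definition path_shift (T : Type) (z : int -> T) : int -> T := fun t => z (t + 1).

Definition ergodic (R : realType) (dT : measure_display) (T : measurableType dT)
  (d : measure_display) (O : measurableType d) (P : probability O R) (Z : int -> O -> T) : Prop :=
  forall C : set (int -> T), path_sigma C -> (@path_shift T) @^-1` C = C ->
    P [set w | C (fun t => Z t w)] = 0%E \/ P [set w | C (fun t => Z t w)] = 1%E.

(* (Y,X) is a Markov chain in the random environment X with kernels P_x(y,A) = K (x,y) A: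
   P(Y_t in A | X, Y_{t-1}, Y_{t-2}, ...) = P_{X_{t-1}}(Y_{t-1}, A), written via the
   defining property of conditional probability on the sigma-field
   sigma(X_s, s in Z; Y_s, s < t). *)
Definition cond_sigma (dE : measure_display) (E : measurableType dE)
  (dF : measure_display) (F : measurableType dF)
  (d : measure_display) (O : measurableType d) (Y : int -> O -> E) (X : int -> O -> F) (t : int)
  : set (set O) :=
  <<s [set B | (exists (s : int) (A : set F), measurable A /\ B = X s @^-1` A) \/
               (exists (s : int) (A : set E), (s < t)%R /\ measurable A /\ B = Y s @^-1` A)] >>.

Definition markov_in_env (R : realType) (dE : measure_display) (E : measurableType dE)
  (dF : measure_display) (F : measurableType dF) (K : R.-pker (F * E) ~> E)
  (d : measure_display) (O : measurableType d) (P : probability O R)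
  (Y : int -> O -> E) (X : int -> O -> F) : Prop :=
  forall (t : int) (A : set E), measurable A ->
    forall B, cond_sigma Y X t B ->
      P (B `&` [set w | A (Y t w)]) =
      (\int[P]_(w in B) K (X (t - 1)%R w, Y (t - 1)%R w) A)%E.

(* Main.v *)
(* The kernels contract along random good times of the past. Call s good if
   the sums of products of lambda started at s stay below M and eta(8M, X_s) is
   bounded below; good times recur infinitely often almost surely by Poincare
   recurrence, since the sums are finite by the root test and by the
   subexponential growth of b(X_{-n}) (Borel-Cantelli, from the log-moment).
   Between two distant good times, drift and minorization contract a V-weighted
   oscillation of test functions by a fixed factor, so the chain started at time
   -n forgets its starting point as n grows, for almost every environment.

   Uniqueness: V(Y_{-n}) is tight by stationarity, so the law of a stationary
   solution on a finite window is the limit obtained from a fixed starting point.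
   Ergodicity: an invariant event is approximated by a finite-window event and by
   its far shift into the past; conditionally on X the two are almost
   independent, so the event is almost surely an event of X.
   Existence: the limits form consistent laws given X. Coding points of the
   Polish space E by bits, a sequence of bits with prescribed finite-dimensional
   laws is read off from a uniform variable on [0, 1[ by repeated subdivision, so
   Omega x [0, 1[ carries the solution. *)

Require Import Defs.
From HB Require Import structures.
From mathcomp Require Import all_boot all_order all_algebra.
From mathcomp Require Import all_classical all_reals all_analysis.
From mathcomp Require Import measurable_realfun.
From mathcomp Require Import ring lra zify.
Set Implicit Arguments.
Unset Strict Implicit.
Unset Printing Implicit Defensive.
Import Order.TTheory GRing.Theory Num.Theory.
Import numFieldNormedType.Exports.
Local Open Scope classical_set_scope.
Local Open Scope ring_scope.

(** * Integration as a positive functional *)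

Section BoundedMeasurable.
Context {R : realType} d (T : measurableType d).
Implicit Types (f g : T -> R) (S : set T).

Definition bmf f := measurable_fun setT f /\ exists C, forall x, `|f x| <= C.

Definition ufun f := measurable_fun setT f /\ forall x, 0 <= f x <= 1.

Lemma ufun_bmf f : ufun f -> bmf f.
Proof.
move=> [mf f01]; split=> //; exists 1 => x.
by have /andP[f0 f1] := f01 x; rewrite ger0_norm.
Qed.

Lemma bmf_cst c : bmf (fun=> c).
Proof. by split=> //; exists `|c|. Qed.

Lemma bmfD f g : bmf f -> bmf g -> bmf (fun x => f x + g x).
Proof.
move=> [mf [C fC]] [mg [D gD]]; split; first exact: measurable_funD.
by exists (C + D) => x; rewrite (le_trans (ler_normD _ _))// lerD.
Qed.

Lemma bmfM f g : bmf f -> bmf g -> bmf (fun x => f x * g x).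
Proof.
move=> [mf [C fC]] [mg [D gD]]; split; first exact: measurable_funM.
by exists (C * D) => x; rewrite normrM ler_pM.
Qed.

Lemma bmfZ c f : bmf f -> bmf (fun x => c * f x).
Proof. by move=> ?; apply: bmfM => //; exact: bmf_cst. Qed.

Lemma bmfN f : bmf f -> bmf (fun x => - f x).
Proof.
move=> bf; have -> : (fun x => - f x) = (fun x => -1 * f x).
  by apply/funext => x; rewrite mulN1r.
exact: bmfZ.
Qed.

Lemma bmfB f g : bmf f -> bmf g -> bmf (fun x => f x - g x).
Proof. by move=> bf bg; apply: bmfD => //; exact: bmfN. Qed.

Lemma bmf_norm f : bmf f -> bmf (fun x => `|f x|).
Proof.
move=> [mf [C fC]]; split; first exact: measurableT_comp.
by exists C => x; rewrite normr_id.
Qed.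

Lemma bmf_sum I (r : seq I) (f_ : I -> T -> R) : (forall i, bmf (f_ i)) ->
  bmf (fun x => \sum_(i <- r) f_ i x).
Proof.
move=> bf; elim: r => [|i r IH].
  rewrite (_ : (fun x => _) = fun=> 0); first exact: bmf_cst.
  by apply/funext => x; rewrite big_nil.
rewrite (_ : (fun x => _) = fun x => f_ i x + \sum_(j <- r) f_ j x).
  exact: bmfD.
by apply/funext => x; rewrite big_cons.
Qed.

Lemma ufun_indic S : measurable S -> ufun (\1_S : T -> R).
Proof.
move=> mS; split; first exact: measurable_indic.
by move=> x; rewrite indicE; case: (_ \in _); rewrite /= ?lexx ?ler01.
Qed.

Lemma ufun_cst c : 0 <= c <= 1 -> ufun (fun=> c).
Proof. by []. Qed.

Lemma ufunM f g : ufun f -> ufun g -> ufun (fun x => f x * g x).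
Proof.
move=> [mf f01] [mg g01]; split; first exact: measurable_funM.
move=> x; have /andP[? ?] := f01 x; have /andP[? ?] := g01 x.
by rewrite mulr_ge0//= mulr_ile1.
Qed.

Definition stair (k : nat) f : T -> R :=
  fun x => \sum_(i < k) k%:R^-1 * \1_[set y | i.+1%:R * k%:R^-1 <= f y] x.

Lemma stairP k f x : (0 < k)%N -> 0 <= f x <= 1 ->
  stair k f x <= f x <= stair k f x + k%:R^-1.
Proof.
move=> k0 /andP[f0 f1]; have k0' : 0 < k%:R :> R by rewrite ltr0n.
pose m := Num.trunc (f x * k%:R).
have /andP[m1 m2] : m%:R <= f x * k%:R < m.+1%:R.
  by apply: truncn_itv; rewrite mulr_ge0// ltW.
have mk : (m <= k)%N.
  rewrite -(@ler_nat R) (le_trans m1)// -[leRHS]mul1r ler_wpM2r// ltW.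
have -> : stair k f x = m%:R * k%:R^-1.
  rewrite /stair -mulr_sumr mulrC; congr (_ * _).
  rewrite -(big_mkord xpredT (fun i => \1_[set y | i.+1%:R * k%:R^-1 <= f y] x)).
  rewrite (big_cat_nat (n := m))//= [X in _ + X]big_nat_cond [X in _ + X]big1 ?addr0; last first.
    move=> i; rewrite andbT => /andP[mi _]; rewrite indicE memNset//=.
    apply/negP; rewrite -ltNge ltr_pdivlMr//; apply: (lt_le_trans m2).
    by rewrite ler_nat.
  rewrite big_nat_cond (eq_bigr (fun=> 1)); last first.
    move=> i; rewrite andbT => /andP[_ im]; rewrite indicE mem_set//=.
    by rewrite ler_pdivrMr// (le_trans _ m1)// ler_nat.
  by rewrite -big_nat_cond sumr_const_nat subn0.
rewrite ler_pdivrMr// m1/= -[X in _ + X]mul1r -mulrDl ler_pdivlMr//.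
by rewrite -natr1 in m2; exact: ltW.
Qed.

Lemma measurable_ge (f : T -> R) c : measurable_fun setT f ->
  measurable [set y | c <= f y].
Proof.
move=> mf; have := mf measurableT `[c, +oo[%classic (measurable_itv _).
by congr measurable; apply/seteqP; split=> x /=; rewrite in_itv/= andbT; tauto.
Qed.

Lemma measurable_gt (f : T -> R) c : measurable_fun setT f ->
  measurable [set y | c < f y].
Proof.
move=> mf; have := mf measurableT `]c, +oo[%classic (measurable_itv _).
by congr measurable; apply/seteqP; split=> x /=; rewrite in_itv/= andbT; tauto.
Qed.

Lemma measurable_le (f : T -> R) c : measurable_fun setT f ->
  measurable [set y | f y <= c].
Proof.
move=> mf; have := mf measurableT `]-oo, c]%classic (measurable_itv _).
by congr measurable; apply/seteqP; split=> x /=; rewrite in_itv/=; tauto.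
Qed.

End BoundedMeasurable.

Section PositiveFunctional.
Context {R : realType} d (T : measurableType d).
Implicit Types (Phi Psi : (T -> R) -> R).

(* Integration against a finite measure, described by the algebraic and
   continuity properties that survive composition with Markov operators. *)
Definition pfunctional Phi := [/\
  forall f g, bmf f -> bmf g -> Phi (fun x => f x + g x) = Phi f + Phi g,
  forall c f, bmf f -> Phi (fun x => c * f x) = c * Phi f,
  forall f, bmf f -> (forall x, 0 <= f x) -> 0 <= Phi f &
  forall (f_ : nat -> T -> R) f, (forall n, ufun (f_ n)) -> ufun f ->
    (forall x, f_ n x @[n --> \oo] --> f x) ->
    Phi (f_ n) @[n --> \oo] --> Phi f].

Section theory.
Variable Phi : (T -> R) -> R.
Hypothesis PPhi : pfunctional Phi.

Lemma pfunD f g : bmf f -> bmf g -> Phi (fun x => f x + g x) = Phi f + Phi g.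
Proof. by case: PPhi => + _ _ _; exact. Qed.

Lemma pfunZ c f : bmf f -> Phi (fun x => c * f x) = c * Phi f.
Proof. by case: PPhi => _ + _ _; exact. Qed.

Lemma pfun_ge0 f : bmf f -> (forall x, 0 <= f x) -> 0 <= Phi f.
Proof. by case: PPhi => _ _ + _; exact. Qed.

Lemma pfun_cvg (f_ : nat -> T -> R) f : (forall n, ufun (f_ n)) -> ufun f ->
    (forall x, f_ n x @[n --> \oo] --> f x) ->
    Phi (f_ n) @[n --> \oo] --> Phi f.
Proof. by case: PPhi => _ _ _; exact. Qed.

Lemma pfunN f : bmf f -> Phi (fun x => - f x) = - Phi f.
Proof.
move=> bf; have -> : (fun x => - f x) = (fun x => -1 * f x).
  by apply/funext => x; rewrite mulN1r.
by rewrite pfunZ// mulN1r.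
Qed.

Lemma pfunB f g : bmf f -> bmf g -> Phi (fun x => f x - g x) = Phi f - Phi g.
Proof. by move=> bf bg; rewrite pfunD ?pfunN//; exact: bmfN. Qed.

Lemma pfun_le f g : bmf f -> bmf g -> (forall x, f x <= g x) -> Phi f <= Phi g.
Proof.
move=> bf bg fg; rewrite -subr_ge0 -pfunB//; apply: pfun_ge0; first exact: bmfB.
by move=> x; rewrite subr_ge0.
Qed.

Lemma pfun_cst c : Phi (fun=> c) = c * Phi (fun=> 1).
Proof.
by rewrite -pfunZ; [rewrite mulr1|exact: bmf_cst].
Qed.

Lemma pfun_norm f : bmf f -> `|Phi f| <= Phi (fun x => `|f x|).
Proof.
move=> bf; have bn := bmf_norm bf.
rewrite ler_norml -pfunN//; apply/andP; split; apply: pfun_le => //.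
- exact: bmfN.
- by move=> x; rewrite lerNl -normrN ler_norm.
- by move=> x; rewrite ler_norm.
Qed.

Lemma pfun_sum I (r : seq I) (f_ : I -> T -> R) : (forall i, bmf (f_ i)) ->
  Phi (fun x => \sum_(i <- r) f_ i x) = \sum_(i <- r) Phi (f_ i).
Proof.
move=> bf; elim: r => [|i r IH].
  rewrite big_nil -[RHS](mul0r (Phi (fun=> 1))) -pfun_cst.
  by congr Phi; apply/funext => x; rewrite big_nil.
rewrite big_cons -IH -pfunD//; last exact: bmf_sum.
by congr Phi; apply/funext => x; rewrite big_cons.
Qed.

End theory.

Lemma pfun_ext (G : set (set T)) Phi Psi : pfunctional Phi -> pfunctional Psi ->
  @measurable _ T = <<s G >> -> setI_closed G -> G setT ->
  (forall S, G S -> Phi (\1_S) = Psi (\1_S)) ->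
  forall f, bmf f -> Phi f = Psi f.
Proof.
move=> PPhi PPsi GE GI GT GPP.
have indicT : \1_setT = (fun=> 1) :> (T -> R).
  by apply/funext => x; rewrite indicE in_setT.
have mindic S : measurable S -> bmf (\1_S : T -> R).
  by move=> mS; apply/ufun_bmf/ufun_indic.
have PS S : measurable S -> Phi \1_S = Psi \1_S.
  rewrite GE.
  apply: (@dynkin_induction _ T G (fun S => Phi \1_S = Psi \1_S)) => //.
  - exact: GPP.
  - move=> A mA PA.
    have -> : \1_(~` A) = (fun x => \1_setT x - \1_A x) :> (T -> R).
      apply/funext => x; rewrite !indicE in_setT in_setC.
      by case: (x \in A); rewrite /= ?subrr ?subr0.
    by rewrite !pfunB ?PA ?GPP//; apply: mindic.
  - move=> A mA tA PA.
    pose f_ n x : R := \sum_(i < n) \1_(A i) x.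
    have fE n : f_ n = \1_(\big[setU/set0]_(i < n) A i).
      apply/funext => x; rewrite /f_; elim: n => [|n IH].
        by rewrite !big_ord0 indicE in_set0.
      rewrite !big_ord_recr/= IH !indicE in_setU.
      have [xn|//] := boolP (x \in A n); last by rewrite orbF addr0.
      suff -> : (x \in \big[setU/set0]_(i < n) A i) = false by rewrite add0r orbT.
      apply/negbTE; apply: contraTN (xn) => /set_mem; rewrite -bigcup_mkord.
      move=> [i /= ni Aix]; apply/negP => /set_mem Anx.
      have /trivIsetP/(_ i n I I) := tA; rewrite neq_ltn ni => /(_ isT).
      by move=> /seteqP[/(_ x)+ _]; apply.
    have cf x : f_ n x @[n --> \oo] --> (\1_(\bigcup_k A k) x : R).
      have [[i _ Aix]|nA] := pselect ((\bigcup_k A k) x).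
        apply: cvg_near_cst; exists i.+1 => // n /= ni; rewrite fE !indicE !mem_set//.
        - by exists i.
        - by rewrite -bigcup_mkord; exists i.
      apply: cvg_near_cst; exists 0%N => // n /= _; rewrite fE !indicE !memNset//.
      by rewrite -bigcup_mkord => -[i _ Aix]; apply: nA; exists i.
    have uf n : ufun (f_ n).
      by rewrite fE; apply: ufun_indic; apply: bigsetU_measurable => i _.
    have uU : ufun (\1_(\bigcup_k A k) : T -> R).
      by apply: ufun_indic; exact: bigcupT_measurable.
    have c1 := pfun_cvg PPhi uf uU cf; have c2 := pfun_cvg PPsi uf uU cf.
    have E n : Phi (f_ n) = Psi (f_ n).
      rewrite /f_ !pfun_sum//; first by apply: eq_bigr => i _; exact: PA.
      - by move=> i; exact: mindic.
      - by move=> i; exact: mindic.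
    rewrite -(funext E) in c2.
    exact: (cvg_unique _ c1 c2).
have E1 : Phi (fun=> 1) = Psi (fun=> 1) by rewrite -indicT PS.
have PU f : ufun f -> Phi f = Psi f.
  move=> uf; have [mf f01] := uf.
  have bs k : bmf (stair k f).
    split.
      apply: measurable_sum => i; apply: measurable_funM => //.
      by apply: measurable_indic; exact: measurable_ge.
    exists (\sum_(i < k) k%:R^-1) => x; apply: (le_trans (ler_norm_sum _ _ _)).
    apply: ler_sum => i _; rewrite normrM ger0_norm ?invr_ge0//.
    rewrite ler_piMr ?invr_ge0// indicE; case: (_ \in _); by rewrite ?normr1 ?normr0.
  have E k : Phi (stair k f) = Psi (stair k f).
    rewrite /stair !pfun_sum//.
    - apply: eq_bigr => i _; rewrite !pfunZ ?PS//; try exact: measurable_ge.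
      + by apply: mindic; exact: measurable_ge.
      + by apply: mindic; exact: measurable_ge.
    - by move=> i; apply/bmfZ/mindic; exact: measurable_ge.
    - by move=> i; apply/bmfZ/mindic; exact: measurable_ge.
  have bnd Xi k : pfunctional Xi -> (0 < k)%N ->
      Xi (stair k f) <= Xi f <= Xi (stair k f) + k%:R^-1 * Xi (fun=> 1).
    move=> PX k0; have bf := ufun_bmf uf.
    rewrite pfun_le//=; last by move=> x; have /andP[] := stairP k0 (f01 x).
    rewrite -pfunZ//; last exact: bmf_cst.
    rewrite -pfunD//; last by apply: bmfZ; exact: bmf_cst.
    apply: pfun_le => //; last first.
      by move=> x; rewrite mulr1; have /andP[] := stairP k0 (f01 x).
    by apply: bmfD => //; apply: bmfZ; exact: bmf_cst.
  have bd k : (0 < k)%N -> `|Phi f - Psi f| <= k%:R^-1 * Phi (fun=> 1).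
    move=> k0; have /andP[a1 a2] := bnd _ _ PPhi k0.
    have /andP[] := bnd _ _ PPsi k0; rewrite -E -E1 => b1 b2.
    by rewrite ler_norml; apply/andP; split; lra.
  apply/eqP; rewrite -subr_eq0 -normr_le0; apply/ler_addgt0Pl => e e0.
  rewrite addr0; set c := Phi (fun=> 1) in bd *.
  have c0 : 0 <= c by apply: (pfun_ge0 PPhi) => //; exact: bmf_cst.
  pose k := (Num.trunc (c / e)).+1.
  apply: (le_trans (bd k isT)); rewrite mulrC ler_pdivrMr ?ltr0n//.
  rewrite mulrC -ler_pdivrMr//; apply: ltW; exact: truncnS_gt.
move=> f [mf [C fC]].
have C0 : 0 <= C by apply: le_trans (fC point).
pose D := C + C + 1.
have D0 : 0 < D by rewrite /D; lra.
pose g x := D^-1 * (f x + C).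
have ug : ufun g.
  split; first by apply: measurable_funM => //; exact: measurable_funD.
  move=> x; rewrite /g mulrC; have := fC x; rewrite ler_norml => /andP[a b].
  by rewrite ler_pdivrMr// divr_ge0/=; rewrite /D; lra.
have -> : f = (fun x => D * g x + - C).
  by apply/funext => x; rewrite /g mulrA divff ?gt_eqF// mul1r addrK.
have bg : bmf g by exact: ufun_bmf.
rewrite !pfunD//; try exact: bmfZ; try exact: bmf_cst.
by rewrite (pfunZ PPhi)// (pfunZ PPsi)// PU// (pfun_cst PPhi) (pfun_cst PPsi) E1.
Qed.

End PositiveFunctional.

Section PositiveFunctionalOps.
Context {R : realType}.

Lemma pfunctional_comp d (T : measurableType d) d' (T' : measurableType d')
    (Phi : (T' -> R) -> R) (phi : T' -> T) :
  measurable_fun setT phi -> pfunctional Phi ->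
  pfunctional (fun f : T -> R => Phi (fun x => f (phi x))).
Proof.
move=> mphi PPhi.
have bc f : bmf f -> bmf (fun x => f (phi x)).
  by move=> [mf [C fC]]; split; [exact: measurableT_comp|exists C].
have uc f : ufun f -> ufun (fun x => f (phi x)).
  by move=> [mf f01]; split; first exact: measurableT_comp.
split.
- by move=> f g bf bg; rewrite -(pfunD PPhi)//; exact: bc.
- by move=> c f bf; rewrite -(pfunZ PPhi)//; exact: bc.
- by move=> f bf f0; apply: (pfun_ge0 PPhi) => //; exact: bc.
- by move=> f_ f uf_ uf ff; apply: (pfun_cvg PPhi) => // [n|]; exact: uc.
Qed.

Lemma pfunctional_weight d (T : measurableType d) (Phi : (T -> R) -> R) (h : T -> R) :
  ufun h -> pfunctional Phi -> pfunctional (fun f : T -> R => Phi (fun x => h x * f x)).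
Proof.
move=> uh PPhi; have bh := ufun_bmf uh; split.
- move=> f g bf bg; rewrite -(pfunD PPhi)//; try exact: bmfM.
  by congr Phi; apply/funext => x; rewrite mulrDr.
- move=> c f bf; rewrite -(pfunZ PPhi)//; last exact: bmfM.
  by congr Phi; apply/funext => x; rewrite mulrCA.
- move=> f bf f0; apply: (pfun_ge0 PPhi) => //; first exact: bmfM.
  by move=> x; rewrite mulr_ge0//; have [_ /(_ x)/andP[]] := uh.
- move=> f_ f uf_ uf ff; apply: (pfun_cvg PPhi) => // [n| |x]; try exact: ufunM.
  by apply: cvgM => //; exact: cvg_cst.
Qed.

Lemma pfunctional_unif_limit d (T : measurableType d) (Phi_ : nat -> (T -> R) -> R)
    (Phi : (T -> R) -> R) :
  (forall n, pfunctional (Phi_ n)) ->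
  (forall f, bmf f -> Phi_ n f @[n --> \oo] --> Phi f) ->
  (forall e : R, 0 < e -> exists N, forall n, (N <= n)%N -> forall f, ufun f ->
     `|Phi_ n f - Phi f| <= e) ->
  pfunctional Phi.
Proof.
move=> P_ cP unifP; split.
- move=> f g bf bg; have c1 := cvgD (FF := eventually_filter) (cP _ bf) (cP _ bg).
  have E : (fun n => Phi_ n (fun x => f x + g x)) = (fun n => Phi_ n f + Phi_ n g).
    by apply/funext => n; rewrite (pfunD (P_ n)).
  have c2 := cP _ (bmfD bf bg); rewrite E in c2.
  by rewrite -(cvg_lim _ c2)//; exact: cvg_lim.
- move=> c f bf; have c1 : (fun n => c * Phi_ n f) @ \oo --> c * Phi f.
    by apply: cvgM; [exact: cvg_cst|exact: cP].
  have E : (fun n => Phi_ n (fun x => c * f x)) = (fun n => c * Phi_ n f).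
    by apply/funext => n; rewrite (pfunZ (P_ n)).
  have c2 := cP _ (bmfZ c bf); rewrite E in c2.
  by rewrite -(cvg_lim _ c2)//; exact: cvg_lim.
- move=> f bf f0; rewrite -(cvg_lim _ (cP _ bf))//; apply: limr_ge.
    by apply/cvg_ex; exists (Phi f); exact: cP.
  by apply: nearW => n; apply: (pfun_ge0 (P_ n)).
- move=> f_ f uf_ uf ff; apply/cvgrPdist_le => e e0.
  have e3 : 0 < e / 3 by lra.
  have [N NP] := unifP _ e3.
  have /cvgrPdist_le/(_ _ e3) := pfun_cvg (P_ N) uf_ uf ff.
  move=> -[M _ MP]; exists M => // n /= Mn.
  have h1 := NP N (leqnn N) _ uf; have h2 := NP N (leqnn N) _ (uf_ n).
  have h3 := MP _ Mn.
  move: h1 h2 h3; rewrite !ler_norml => /andP[? ?] /andP[? ?] /andP[? ?].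
  by apply/andP; split; lra.
Qed.

End PositiveFunctionalOps.

Section Expectation.
Context {R : realType} d (T : measurableType d) (mu : {measure set T -> \bar R}).
Hypothesis mu1 : mu setT = 1%E.

Lemma bmf_integrable f : bmf f -> mu.-integrable setT (EFin \o f).
Proof.
move=> [mf [C fC]]; apply: measurable_bounded_integrable => //.
  by rewrite mu1 ltry.
exists C; split; first exact: num_real.
by move=> M CM x _ /=; rewrite (le_trans (fC x))// ltW.
Qed.

Lemma pfunctional_int : pfunctional (fun f : T -> R => \int[mu]_x f x).
Proof.
split.
- by move=> f g bf bg; rewrite RintegralD//; exact: bmf_integrable.
- by move=> c f bf; rewrite RintegralZl//; exact: bmf_integrable.
- by move=> f bf f0; apply: Rintegral_ge0.
- move=> f_ f uf_ uf ff.
  have i1 : mu.-integrable setT (EFin \o (fun=> 1 : R)) by apply/bmf_integrable/bmf_cst.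
  have [||intf _ cf] := @dominated_convergence _ _ _ mu setT measurableT
    (fun n => EFin \o f_ n) (EFin \o f) (EFin \o (fun=> 1))
    (fun n => (measurable_EFinP _ _).2 (uf_ n).1) ((measurable_EFinP _ _).2 uf.1)
    _ i1 _.
  + apply: aeW => x _; apply: cvg_EFin; [exact: nearW|exact: ff].
  + apply: aeW => x n _ /=.
    by have /andP[f0 f1] := (uf_ n).2 x; rewrite lee_fin ger0_norm.
  apply: fine_cvg; rewrite fineK//; exact: integrable_fin_num.
Qed.

Lemma Rintegral_indic S : measurable S -> \int[mu]_x \1_S x = fine (mu S).
Proof. by move=> mS; rewrite /Rintegral integral_indic// setIT. Qed.

Lemma measure_fin S : measurable S -> mu S \is a fin_num.
Proof.
move=> mS; rewrite ge0_fin_numE// (@le_lt_trans _ _ 1%E) ?ltry// -mu1.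
by apply: le_measure; rewrite ?inE.
Qed.

Lemma measure_Rintegral S : measurable S -> mu S = (\int[mu]_x \1_S x)%:E.
Proof. by move=> mS; rewrite Rintegral_indic// fineK// measure_fin. Qed.

Lemma Rintegral_one : \int[mu]_x (1 : R) = 1.
Proof. by rewrite Rintegral_cst// mul1r mu1. Qed.

Lemma Rintegral_ufun f : ufun f -> 0 <= \int[mu]_x f x <= 1.
Proof.
move=> uf; have bf := ufun_bmf uf; have [_ f01] := uf.
apply/andP; split.
  by apply: Rintegral_ge0 => x _; have /andP[] := f01 x.
rewrite -[leRHS]Rintegral_one; apply: (pfun_le pfunctional_int) => //.
  exact: bmf_cst.
by move=> x; have /andP[] := f01 x.
Qed.

Lemma Rintegral_ae_cvg (f_ : nat -> T -> R) f : (forall n, ufun (f_ n)) -> ufun f ->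
  {ae mu, forall x, f_ n x @[n --> \oo] --> f x} ->
  \int[mu]_x f_ n x @[n --> \oo] --> \int[mu]_x f x.
Proof.
move=> uf_ uf ff.
have i1 : mu.-integrable setT (EFin \o (fun=> 1 : R)) by apply/bmf_integrable/bmf_cst.
have [||intf _ cf] := @dominated_convergence _ _ _ mu setT measurableT
    (fun n => EFin \o f_ n) (EFin \o f) (EFin \o (fun=> 1))
    (fun n => (measurable_EFinP _ _).2 (uf_ n).1) ((measurable_EFinP _ _).2 uf.1)
    _ i1 _.
- apply: filterS ff => x ffx _; apply: cvg_EFin; [exact: nearW|exact: ffx].
- apply: aeW => x n _ /=.
  by have /andP[f0 f1] := (uf_ n).2 x; rewrite lee_fin ger0_norm.
apply: fine_cvg; rewrite /= fineK//; exact: integrable_fin_num.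
Qed.

Lemma ae_eq_Rintegral f g : bmf f -> bmf g -> {ae mu, forall x, f x = g x} ->
  \int[mu]_x f x = \int[mu]_x g x.
Proof.
move=> [mf _] [mg _] fg; rewrite /Rintegral; congr fine.
apply: ae_eq_integral => //; first exact/measurable_EFinP; first exact/measurable_EFinP.
by apply: filterS fg => x fgx _; rewrite fgx.
Qed.

End Expectation.

Definition path_gen (I : Type) d (T : measurableType d) : set (set (I -> T)) :=
  [set C | exists (t : I) (A : set T), measurable A /\ C = [set z | A (z t)]].

Definition pathT (I : Type) d (T : measurableType d) : Type :=
  g_sigma_algebraType (@path_gen I d T).

HB.instance Definition _ (I : Type) d (T : measurableType d) :=
  Measurable.on (@pathT I d T).

(** * Path space and Markov operators in a fixed environment *)

Section PathSpace.
Context (I : Type) d (T : measurableType d).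

Lemma measurable_coord (t : I) : measurable_fun setT (fun z : pathT I T => z t).
Proof.
move=> _ A mA; rewrite setTI; apply: sub_sigma_algebra.
by exists t, A.
Qed.

Lemma measurable_path d' (O : measurableType d') (f : O -> pathT I T) :
  (forall t, measurable_fun setT (fun o => f o t)) -> measurable_fun setT f.
Proof.
move=> mf; apply: (@measurability _ _ O (pathT I T) setT f (@path_gen I d T)) => //.
move=> _ [_ [t [A [mA ->]]] <-]; rewrite setTI.
by have := mf t measurableT A mA; rewrite setTI.
Qed.

End PathSpace.

Definition upd (E F : Type) (z : int -> E * F) (t : int) (e : E) : int -> E * F :=
  fun s => if s == t then (e, (z s).2) else z s.

(* The second components of a path form the environment; only first components
   are ever erased or updated. *)
Definition keep (E : pointedType) (F : Type) (D : pred int) (z : int -> E * F) :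
    int -> E * F :=
  fun s => if D s then z s else (point, (z s).2).

Definition dep (E F V : Type) (D : pred int) (H : (int -> E * F) -> V) := forall z z',
  (forall s, (z s).2 = (z' s).2) -> (forall s, D s -> (z s).1 = (z' s).1) -> H z = H z'.

Definition shiftz (T : Type) (k : int) (z : int -> T) : int -> T := fun t => z (t + k).

Section EnvPath.
Context dE (E : measurableType dE) dF (F : measurableType dF).
Notation W := (pathT int (E * F)%type).

Definition rect_cyl : set (set W) :=
  [set S | exists (l : seq int) (A : int -> set E) (B : int -> set F),
    [/\ forall t, measurable (A t), forall t, measurable (B t) &
     S = [set z | forall t, t \in l -> A t (z t).1 /\ B t (z t).2]]].

Lemma rect_cylT : rect_cyl setT.
Proof.
exists [::], (fun=> setT), (fun=> setT); split=> //.
by apply/seteqP; split=> z.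
Qed.

Lemma rect_cylI : setI_closed rect_cyl.
Proof.
move=> _ _ [l1 [A1 [B1 [mA1 mB1 ->]]]] [l2 [A2 [B2 [mA2 mB2 ->]]]].
exists (l1 ++ l2),
  (fun t => (if t \in l1 then A1 t else setT) `&` (if t \in l2 then A2 t else setT)),
  (fun t => (if t \in l1 then B1 t else setT) `&` (if t \in l2 then B2 t else setT)).
split.
- by move=> t; apply: measurableI; case: ifP.
- by move=> t; apply: measurableI; case: ifP.
- apply/seteqP; split=> z /=.
    move=> [h1 h2] t tl.
    have [t1|t1] := boolP (t \in l1); have [t2|t2] := boolP (t \in l2).
    + by have [? ?] := h1 _ t1; have [? ?] := h2 _ t2.
    + by have [? ?] := h1 _ t1.
    + by have [? ?] := h2 _ t2.
    + by [].
  move=> h; split=> t tl.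
    by have := h t; rewrite mem_cat tl => /(_ isT)[[? _] [? _]].
  by have := h t; rewrite mem_cat tl orbT => /(_ isT)[[_ ?] [_ ?]].
Qed.

Lemma rect_cyl_measurable S : rect_cyl S -> measurable S.
Proof.
move=> [l [A [B [mA mB ->]]]].
have -> : [set z : W | forall t, t \in l -> A t (z t).1 /\ B t (z t).2] =
   \big[setI/setT]_(t <- l) ((fun z : W => z t) @^-1` (A t `*` B t)).
  elim: l => [|t l IH]; first by rewrite big_nil; apply/seteqP; split.
  rewrite big_cons -IH; apply/seteqP; split=> z /=.
    move=> h; split; first by apply: h; rewrite mem_head.
    by move=> s sl; apply: h; rewrite in_cons sl orbT.
  by move=> [h1 h2] s; rewrite in_cons => /predU1P[->//|]; exact: h2.
apply: bigsetI_measurable => t _; rewrite -[X in measurable X]setTI.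
by apply: measurable_coord => //; exact: measurableX.
Qed.

Lemma rect_cyl_gen : @measurable _ W = <<s rect_cyl >>.
Proof.
apply/seteqP; split; last first.
  apply: smallest_sub; first exact: sigma_algebra_measurable.
  by move=> S /rect_cyl_measurable.
apply: smallest_sub; first exact: smallest_sigma_algebra.
move=> _ [t [A [mA ->]]].
pose H : set (set (E * F)) := [set A | <<s rect_cyl >> [set z : W | A (z t)]].
suff : @measurable _ (E * F)%type `<=` H by apply.
rewrite measurable_prod_measurableType; apply: smallest_sub.
  split; rewrite /H/=.
  - exact: sigma_algebra0.
  - move=> B HB; have := sigma_algebraC HB.
    by congr (<<s rect_cyl >>); apply/seteqP; split=> z //= [].
  - move=> B HB; have := sigma_algebra_bigcup HB.
    by congr (<<s rect_cyl >>); apply/seteqP; split=> z [n _ Bz]; exists n.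
move=> _ [A1 mA1 [A2 mA2 <-]]; apply: sub_sigma_algebra.
exists [:: t], (fun=> A1), (fun=> A2); split=> //.
apply/seteqP; split=> z /=; first by move=> ? s; rewrite inE => /eqP->.
by move=> /(_ t); rewrite mem_head; apply.
Qed.

Lemma measurable_upd t : measurable_fun setT (fun p : W * E => upd p.1 t p.2 : W).
Proof.
apply: measurable_path => s; rewrite /upd; case: eqVneq => [->|_].
  apply: measurable_fun_pair; first exact: measurable_snd.
  apply: (measurableT_comp measurable_snd).
  exact: (measurableT_comp (measurable_coord t) measurable_fst).
exact: (measurableT_comp (measurable_coord s) measurable_fst).
Qed.

Lemma measurable_keep D : measurable_fun setT (keep D : W -> W).
Proof.
apply: measurable_path => s; rewrite /keep; case: (D s); first exact: measurable_coord.
apply: measurable_fun_pair; first exact: measurable_cst.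
exact: (measurableT_comp measurable_snd (measurable_coord s)).
Qed.

Lemma keep_id D V (H : W -> V) z : dep D H -> H (keep D z) = H z.
Proof.
move=> dH; apply: dH => s; rewrite /keep; first by case: (D s).
by move=> ->.
Qed.

Lemma dep_keep (D D' : pred int) V (H : W -> V) :
  (forall s, D s -> D' s) -> dep D' (fun z => H (keep D z)).
Proof.
move=> DD' z z' e2 e1; congr H; apply/funext => s; rewrite /keep.
case: ifPn => [Ds|_]; last by rewrite e2.
move: (e2 s) (e1 s (DD' s Ds)).
by case: (z s) => a b; case: (z' s) => a' b' /= -> ->.
Qed.

Lemma sub_dep (D D' : pred int) V (H : W -> V) :
  (forall s, D s -> D' s) -> dep D H -> dep D' H.
Proof. by move=> DD' dH z z' e2 e1; apply: dH => // s /DD'; exact: e1. Qed.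

Lemma measurable_shiftz k : measurable_fun setT (shiftz k : W -> W).
Proof. by apply: measurable_path => s; exact: measurable_coord. Qed.

End EnvPath.

Section EnvKernel.
Context {R : realType} dE (E : measurableType dE) dF (F : measurableType dF)
  (K : R.-pker (F * E) ~> E).
Notation W := (pathT int (E * F)%type).
Implicit Types (H : W -> R) (z : W).

Definition kcoord (t : int) (z : W) : {measure set E -> \bar R} :=
  K ((z t).2, (z t).1).

Let measurable_kcoord t U : measurable U ->
  measurable_fun [set: W] (kcoord t ^~ U).
Proof.
move=> mU; apply: (measurableT_comp (measurable_kernel K U mU)).
apply: measurable_fun_pair.
  exact: (measurableT_comp measurable_snd (measurable_coord t)).
exact: (measurableT_comp measurable_fst (measurable_coord t)).
Qed.

HB.instance Definition _ t := isKernel.Build _ _ _ _ _ (kcoord t) (measurable_kcoord t).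

Let kcoord1 t z : kcoord t z setT = 1%E.
Proof. exact: prob_kernel. Qed.

HB.instance Definition _ t := Kernel_isProbability.Build _ _ _ _ _ (kcoord t) (kcoord1 t).

Definition Tstep (t : int) (H : W -> R) (z : W) : R :=
  \int[kcoord t z]_e H (upd z (t + 1) e).

Fixpoint Tback (t : int) (n : nat) (H : W -> R) : W -> R :=
  if n is m.+1 then Tstep (t - n%:Z) (Tback t m H) else H.

Lemma measurable_upd2 (t : int) (z : W) : measurable_fun setT (fun e : E => upd z t e : W).
Proof.
exact: (measurable_fun_pair2 z (@measurable_upd _ E _ F t)).
Qed.

Lemma bmf_upd t z H : bmf H -> bmf (fun e : E => H (upd z t e) : R).
Proof.
move=> [mH [C HC]]; split; last by exists C.
exact: (measurableT_comp mH (measurable_upd2 t z)).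
Qed.

Lemma Tstep_pfunctional t z : pfunctional (fun H => Tstep t H z).
Proof.
apply: (@pfunctional_comp _ _ _ _ _ (fun f => \int[kcoord t z]_e f e)).
  exact: measurable_upd2.
exact/pfunctional_int/prob_kernel.
Qed.

Lemma Tstep_bmf t H : bmf H -> bmf (Tstep t H).
Proof.
move=> bH; have [mH [C HC]] := bH.
have C0 : 0 <= C by apply: le_trans (HC point).
have nn z : 0 <= H z + C.
  by have := HC z; rewrite ler_norml => /andP[? _]; lra.
have PT z := Tstep_pfunctional t z.
have T1 z : Tstep t (fun=> 1) z = 1.
  by rewrite /Tstep Rintegral_one// prob_kernel.
have E1 : Tstep t H = (fun z => Tstep t (fun z => H z + C) z - C).
  apply/funext => z; rewrite (pfunD (PT z))//; last exact: bmf_cst.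
  by rewrite (pfun_cst (PT z)) T1 mulr1 addrK.
have mT : measurable_fun setT (Tstep t (fun z => H z + C)).
  have -> : Tstep t (fun z => H z + C) =
     fine \o (fun z => \int[kcoord t z]_e ((fun p : W * E => (H (upd p.1 (t+1) p.2) + C)%:E)
        (z, e)))%E.
    by [].
  apply: measurableT_comp => //.
  apply: (measurable_fun_integral_finite_kernel
    (fun p : W * E => (H (upd p.1 (t+1) p.2) + C)%:E) (kcoord t)).
    by move=> p; rewrite lee_fin.
  apply/measurable_EFinP; apply: measurable_funD => //.
  exact: (measurableT_comp mH (measurable_upd _)).
split.
  by rewrite E1; apply: measurable_funB.
exists C => z; rewrite ler_norml; apply/andP; split.
  rewrite -[- C]mulr1 -(T1 z) -(pfun_cst (PT z)); apply: (pfun_le (PT z)) => //.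
    exact: bmf_cst.
  by move=> w; have := HC w; rewrite ler_norml => /andP[].
rewrite -[C]mulr1 -(T1 z) -(pfun_cst (PT z)); apply: (pfun_le (PT z)) => //.
  exact: bmf_cst.
by move=> w; have := HC w; rewrite ler_norml => /andP[].
Qed.

Lemma Tstep_ufun t H : ufun H -> ufun (Tstep t H).
Proof.
move=> uH; split; first by have [] := Tstep_bmf t (ufun_bmf uH).
move=> z; apply: Rintegral_ufun; first exact: prob_kernel.
split; last by move=> e; have [_] := uH.
by have [] := bmf_upd (t + 1) z (ufun_bmf uH).
Qed.

Lemma Tback_bmf t n H : bmf H -> bmf (Tback t n H).
Proof. by elim: n => //= n IH bH; apply/Tstep_bmf/IH. Qed.

Lemma Tback_ufun t n H : ufun H -> ufun (Tback t n H).
Proof. by elim: n => //= n IH bH; apply/Tstep_ufun/IH. Qed.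

Lemma pfunctional_Tstep t Phi : pfunctional Phi -> pfunctional (fun H => Phi (Tstep t H)).
Proof.
move=> PP; split.
- move=> f g bf bg; rewrite -(pfunD PP); try exact: Tstep_bmf.
  by congr Phi; apply/funext => z; rewrite (pfunD (Tstep_pfunctional t z)).
- move=> c f bf; rewrite -(pfunZ PP); last exact: Tstep_bmf.
  by congr Phi; apply/funext => z; rewrite (pfunZ (Tstep_pfunctional t z)).
- move=> f bf f0; apply: (pfun_ge0 PP); first exact: Tstep_bmf.
  by move=> z; apply: (pfun_ge0 (Tstep_pfunctional t z)).
- move=> f_ f uf_ uf ff; apply: (pfun_cvg PP).
  + by move=> n; exact: Tstep_ufun.
  + exact: Tstep_ufun.
  + by move=> z; apply: (pfun_cvg (Tstep_pfunctional t z)).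
Qed.

Lemma pfunctional_Tback t n Phi : pfunctional Phi -> pfunctional (fun H => Phi (Tback t n H)).
Proof.
elim: n Phi => //= n IH Phi PP.
exact: (IH (fun H => Phi (Tstep (t - n.+1%:Z) H)) (pfunctional_Tstep _ PP)).
Qed.

Lemma Tstep_dep (D D' : pred int) t H : D' t -> (forall s, D s -> s != t + 1 -> D' s) ->
  dep D H -> dep D' (Tstep t H).
Proof.
move=> D't DD' dH z z' e2 e1; rewrite /Tstep /kcoord e2 (e1 _ D't).
congr Rintegral; apply/funext => e; apply: dH => s; rewrite /upd.
  by case: (s == t + 1); rewrite /= e2.
move=> Ds; case: eqVneq => //= st; apply: e1; exact: DD'.
Qed.

Lemma Tstep_id t H : (forall z e, H (upd z (t + 1) e) = H z) -> Tstep t H = H.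
Proof.
move=> dH; apply/funext => z; rewrite /Tstep.
rewrite (_ : (fun e => _) = fun=> H z); last by apply/funext => e.
by rewrite Rintegral_cst// prob_kernel mulr1.
Qed.

Lemma upd_dep (D : pred int) V (H : W -> V) t z e : dep D H -> ~~ D t -> H (upd z t e) = H z.
Proof.
move=> dH Dt; apply: dH => s; rewrite /upd; case: eqVneq => //.
by move=> -> Ds; rewrite Ds in Dt.
Qed.

Lemma Tback_dep t a n H : dep (fun s => a <= s <= t) H ->
  dep (fun s => Order.min a (t - n%:Z) <= s <= t - n%:Z) (Tback t n H).
Proof.
move=> dH; elim: n => [|n IH] /=.
  by apply: sub_dep dH => s; lia.
apply: Tstep_dep IH; first by lia.
by move=> s; lia.
Qed.

Lemma Tback_add t n m H : Tback t (m + n) H = Tback (t - n%:Z) m (Tback t n H).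
Proof.
elim: m => //= m ->.
by have -> : t - (m + n).+1%:Z = t - n%:Z - m.+1%:Z by lia.
Qed.

Lemma Tback_id t n H : (forall z s e, t - n%:Z < s -> H (upd z s e) = H z) -> Tback t n H = H.
Proof.
elim: n => //= n IH dH; rewrite IH; last by move=> z s e ?; apply: dH; lia.
by apply: Tstep_id => z e; apply: dH; lia.
Qed.

Lemma Tback_env t n H H' z : (forall z', (forall s, (z' s).2 = (z s).2) -> H z' = H' z') ->
  Tback t n H z = Tback t n H' z.
Proof.
elim: n z => [|n IH] z HH' /=; first exact: HH'.
rewrite /Tstep; congr Rintegral; apply/funext => e; apply: IH => z' zz'.
by apply: HH' => s; rewrite zz' /upd; case: eqP.
Qed.

Lemma Tback_mul t n a H : (forall z s e, t - n%:Z < s -> a (upd z s e) = a z) -> bmf H ->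
  Tback t n (fun z => a z * H z) = (fun z => a z * Tback t n H z).
Proof.
elim: n => //= n IH da bH; rewrite IH//; last by move=> z s e ?; apply: da; lia.
apply/funext => z; rewrite /Tstep.
have k1 : kcoord (t - n.+1%:Z) z setT = 1%E by exact: prob_kernel.
rewrite -(pfunZ (pfunctional_int k1))//; last first.
  by apply: bmf_upd; exact: Tback_bmf.
congr Rintegral; apply/funext => e; rewrite da//; lia.
Qed.

Lemma Tback_shift t n k H z :
  Tback t n (fun z => H (shiftz k z)) z = Tback (t - k) n H (shiftz k z).
Proof.
elim: n z => //= n IH z; rewrite /Tstep.
have E1 : t - k - n.+1%:Z + k = t - n.+1%:Z by lia.
rewrite /kcoord [(shiftz k z) _]/shiftz E1; congr Rintegral; apply/funext => e; rewrite IH; congr Tback.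
apply/funext => s; rewrite /shiftz /upd.
by have -> : (s + k == t - n.+1%:Z + 1) = (s == t - k - n.+1%:Z + 1) by lia.
Qed.

Definition kop (x : F) (g : E -> R) (y : E) : R := \int[K (x, y)]_e g e.

Fixpoint back (x : int -> F) (t : int) (n : nat) (g : E -> R) : E -> R :=
  if n is m.+1 then kop (x (t - n%:Z)) (back x t m g) else g.

Lemma Tback_back t n H z : dep (fun s => s == t) H ->
  Tback t n H z = back (fun s => (z s).2) t n (fun y => H (upd z t y)) (z (t - n%:Z)).1.
Proof.
move=> dH; elim: n z => [|n IH] z /=.
  rewrite subr0; apply: dH => s; rewrite /upd; first by case: eqP.
  by move=> /eqP ->; rewrite eqxx.
rewrite /Tstep /kop /kcoord; congr Rintegral; apply/funext => e.
rewrite IH; have -> : t - n.+1%:Z + 1 = t - n%:Z by lia.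
rewrite {4}/upd eqxx /=.
have -> : (fun s => (upd z (t - n%:Z) e s).2) = (fun s => (z s).2).
  by apply/funext => s; rewrite /upd; case: eqP.
congr back; apply/funext => y; apply: dH => s; rewrite /upd; first by do 2 case: eqP.
by move=> /eqP ->; rewrite eqxx.
Qed.

End EnvKernel.

(** * Contraction along good times *)

Section HarrisContraction.
Context {R : realType} dE (E : measurableType dE) dF (F : measurableType dF)
  (K : R.-pker (F * E) ~> E) (V : E -> R) (lam b : F -> R) (eta : R -> F -> R).
Hypotheses (HVm : measurable_fun setT V) (HVpos : forall y, 0 < V y)
  (Hlam0 : forall x, 0 <= lam x) (Hb0 : forall x, 0 <= b x)
  (Hdrift : forall x y, (\int[K (x, y)]_z (V z)%:E <= (lam x * V y + b x)%:E)%E)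
  (Hminor : forall r : R, 0 < r -> exists nu : R.-pker F ~> E,
     forall x y A, V y <= r -> measurable A ->
       ((eta r x)%:E * nu x A <= K (x, y) A)%E).

Let kop1 x y : K (x, y) setT = 1%E. Proof. exact: prob_kernel. Qed.

Lemma kop_ufun x (g : E -> R) : ufun g -> ufun (kop K x g).
Proof.
move=> [mg g01]; split; last first.
  by move=> y; apply: (Rintegral_ufun (kop1 x y)).
rewrite /kop /Rintegral; apply: (measurableT_comp (@fine_measurable R setT measurableT)).
apply: (measurable_fun_pair2 x (f := fun p : F * E => (\int[K p]_e (g e)%:E)%E)).
apply: (measurable_fun_integral_finite_kernel
    (fun p : (F * E) * E => (g p.2)%:E) K).
  by move=> p; rewrite lee_fin; have /andP[] := g01 p.2.
by apply/measurable_EFinP; exact: (measurableT_comp mg measurable_snd).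
Qed.

Lemma back_ufun x t n (g : E -> R) : ufun g -> ufun (back K x t n g).
Proof. by move=> ug; elim: n => //= n; exact: kop_ufun. Qed.

Lemma back_add x t n m (g : E -> R) :
  back K x t (m + n) g = back K x (t - n%:Z) m (back K x t n g).
Proof.
elim: m => //= m ->.
by have -> : t - (m + n).+1%:Z = t - n%:Z - m.+1%:Z by lia.
Qed.

Lemma V_integrable x y : (K (x, y)).-integrable setT (EFin \o V).
Proof.
apply/integrableP; split; first exact/measurable_EFinP.
under eq_integral do rewrite /= ger0_norm ?(ltW (HVpos _))//.
by rewrite (le_lt_trans (Hdrift x y))// ltry.
Qed.

Lemma V_moment x y : \int[K (x, y)]_z V z <= lam x * V y + b x.
Proof.
rewrite -lee_fin (le_trans _ (Hdrift x y))// /Rintegral fineK//.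
exact: (integrable_fin_num measurableT (V_integrable x y)).
Qed.

Let affine_integrable x y (al ka : R) :
  (K (x, y)).-integrable setT (EFin \o (fun z => al + ka * V z)).
Proof.
apply: (integrableD measurableT (f := fun=> al%:E) (g := fun z => (ka * V z)%:E)).
  by apply: (bmf_integrable (kop1 x y)); exact: bmf_cst.
exact: (integrableZl measurableT ka (V_integrable x y)).
Qed.

Lemma affine_moment x y (al ka : R) : 0 <= ka ->
  \int[K (x, y)]_z (al + ka * V z) <= al + ka * (lam x * V y + b x).
Proof.
move=> ka0; rewrite RintegralD//; last 2 first.
- by apply: (bmf_integrable (kop1 x y)); exact: bmf_cst.
- exact: (integrableZl measurableT ka (V_integrable x y)).
rewrite Rintegral_cst// kop1 mulr1 lerD2l RintegralZl//; last exact: V_integrable.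
by rewrite ler_wpM2l// V_moment.
Qed.

Lemma kop_affine x (g : E -> R) (c al ka : R) : ufun g -> 0 <= ka ->
  (forall y, `|g y - c| <= al + ka * V y) ->
  forall y, `|kop K x g y - c| <= al + ka * (lam x * V y + b x).
Proof.
move=> ug ka0 gc y; apply: le_trans (affine_moment x y al ka0).
have bgc : bmf (fun z => g z - c).
  by apply: bmfD; [exact: ufun_bmf|exact: bmf_cst].
have -> : kop K x g y - c = \int[K (x, y)]_z (g z - c).
  rewrite (pfunB (pfunctional_int (kop1 x y))); [|exact: ufun_bmf|exact: bmf_cst].
  by rewrite Rintegral_cst// kop1 mulr1.
apply: (le_trans (pfun_norm (pfunctional_int (kop1 x y)) bgc)).
apply: le_Rintegral => //; first by apply: (bmf_integrable (kop1 x y)); exact: bmf_norm.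
Qed.

Lemma kop_minor r x (g : E -> R) (c al ka : R) y y' : ufun g -> 0 <= al -> 0 <= ka -> 0 < r ->
  0 <= eta r x ->
  (forall y, `|g y - c| <= al + ka * V y) -> V y <= r -> V y' <= r ->
  kop K x g y - kop K x g y' <=
    2 * (al + ka * b x) + ka * lam x * (V y + V y') - 2 * eta r x * al.
Proof.
move=> ug al0 ka0 r0 e0 gc Vy Vy'.
have [nu nuP] := Hminor r0.
pose ep : {nonneg R} := NngNum e0.
have bgc : bmf (fun z => g z - c).
  by apply: bmfD; [exact: ufun_bmf|exact: bmf_cst].
have [mgc _] := bgc.
have mh : measurable_fun setT (fun z => al + ka * V z).
  by apply: measurable_funD => //; exact: measurable_funM.
pose f1 z := (al + ka * V z) - (g z - c).
pose f2 z := (al + ka * V z) + (g z - c).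
have f10 z : 0 <= f1 z by have := gc z; rewrite ler_norml => /andP[? ?]; rewrite subr_ge0.
have f20 z : 0 <= f2 z by have := gc z; rewrite ler_norml => /andP[? ?]; rewrite /f2; lra.
have mf1 : measurable_fun setT f1 by exact: measurable_funB.
have mf2 : measurable_fun setT f2 by exact: measurable_funD.
have dom (f : E -> R) y0 : (forall z, 0 <= f z) -> measurable_fun setT f -> V y0 <= r ->
    ((eta r x)%:E * \int[nu x]_z (f z)%:E <= \int[K (x, y0)]_z (f z)%:E)%E.
  move=> f0 mf Vy0; rewrite -[X in (X%:E * _)%E]/(ep%:num).
  rewrite -ge0_integral_mscale//; last 2 first.
  - exact/measurable_EFinP.
  - by move=> z _; rewrite lee_fin.
  apply: ge0_le_measure_integral => //.
  - by move=> S mS; rewrite /mscale/=; exact: nuP.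
  - exact/measurable_EFinP.
have iK y0 : (K (x, y0)).-integrable setT (EFin \o (fun z => g z - c)).
  exact: (bmf_integrable (kop1 x y0)).
have I1 : (\int[K (x, y)]_z (f1 z)%:E =
   (\int[K (x, y)]_z (al + ka * V z) - \int[K (x, y)]_z (g z - c))%:E)%E.
  rewrite -RintegralB// /Rintegral fineK//.
  exact: (integrable_fin_num measurableT
    (integrableB measurableT (affine_integrable x y al ka) (iK y))).
have I2 : (\int[K (x, y')]_z (f2 z)%:E =
   (\int[K (x, y')]_z (al + ka * V z) + \int[K (x, y')]_z (g z - c))%:E)%E.
  rewrite -RintegralD// /Rintegral fineK//.
  exact: (integrable_fin_num measurableT
    (integrableD measurableT (affine_integrable x y' al ka) (iK y'))).
have D1 := dom f1 y f10 mf1 Vy; have D2 := dom f2 y' f20 mf2 Vy'.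
have nu1 : nu x setT = 1%E by exact: prob_kernel.
have low : ((2 * al)%:E <= \int[nu x]_z (f1 z)%:E + \int[nu x]_z (f2 z)%:E)%E.
  rewrite -ge0_integralD//; try (by move=> z _; rewrite lee_fin);
    try exact/measurable_EFinP.
  rewrite -[leLHS]mule1 -nu1 -integral_cst//; apply: ge0_le_integral => //.
  - by move=> z _; rewrite lee_fin mulr_ge0.
  - by apply/measurable_EFinP; exact: measurable_funD.
  - move=> z _; rewrite -EFinD lee_fin /f1 /f2.
    by have := mulr_ge0 ka0 (ltW (HVpos z)); lra.
have := leeD D1 D2; rewrite -ge0_muleDr; try by apply: integral_ge0 => z _; rewrite lee_fin.
rewrite I1 I2 -EFinD => DD.
have e0' : (0 <= (eta r x)%:E)%E by rewrite lee_fin.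
have := le_trans (lee_wpmul2l e0' low) DD.
rewrite -EFinM lee_fin.
have -> : kop K x g y - kop K x g y' = \int[K (x, y)]_z (g z - c) - \int[K (x, y')]_z (g z - c).
  rewrite !(pfunB (pfunctional_int (kop1 x _)));
    [|exact: ufun_bmf|exact: bmf_cst|exact: ufun_bmf|exact: bmf_cst].
  by rewrite !Rintegral_cst// !kop1 /kop; lra.
have A1 := affine_moment x y al ka0; have A2 := affine_moment x y' al ka0.
lra.
Qed.

Lemma center_of_diff (f h : E -> R) : (forall y y', f y - f y' <= h y + h y') ->
  exists c, forall y, `|f y - c| <= h y.
Proof.
move=> fh; pose A := [set f y - h y | y in [set: E]].
have ubA y : ubound A (f y + h y).
  by move=> _ [y' _ <-]; have := fh y' y; lra.
have A0 : A !=set0 by exists (f point - h point), point.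
exists (sup A) => y; rewrite ler_distlC; apply/andP; split.
  apply: (@ub_le_sup _ A); first by exists (f y + h y).
  by exists y.
by apply: ge_sup.
Qed.

Fixpoint prodl (x : int -> F) (s : int) (n : nat) : R :=
  if n is m.+1 then prodl x s m * lam (x (s - n%:Z)) else 1.

Fixpoint sumb (x : int -> F) (s : int) (n : nat) : R :=
  if n is m.+1 then sumb x s m + prodl x s m * b (x (s - n%:Z)) else 0.

Lemma prodl_ge0 x s n : 0 <= prodl x s n.
Proof. by elim: n => //= n IH; rewrite mulr_ge0. Qed.

Lemma sumb_ge0 x s n : 0 <= sumb x s n.
Proof. by elim: n => //= n IH; rewrite addr_ge0// mulr_ge0// prodl_ge0. Qed.

Lemma back_affine x s n (g : E -> R) (c al ka : R) : ufun g -> 0 <= ka ->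
  (forall y, `|g y - c| <= al + ka * V y) ->
  forall y, `|back K x s n g y - c| <= al + ka * (prodl x s n * V y + sumb x s n).
Proof.
move=> ug ka0 gc; elim: n => [|n IH] y /=; first by rewrite mul1r addr0.
have IH' y0 : `|back K x s n g y0 - c| <= (al + ka * sumb x s n) + (ka * prodl x s n) * V y0.
  by apply: (le_trans (IH y0)); lra.
apply: (le_trans (kop_affine (x (s - n.+1%:Z)) (back_ufun x s n ug) _ IH' y)).
  by rewrite mulr_ge0// prodl_ge0.
by lra.
Qed.

Variables (M delta : R).
Hypotheses (M0 : 0 < M) (delta0 : 0 < delta) (delta1 : delta <= 1).

Definition goodtime (x : int -> F) (s : int) :=
  (forall n, sumb x s n <= M) /\ delta <= eta (8 * M) (x s).

Let beta : R := delta / (2 * M).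
Let alpha : R := 1 - delta / 3.

Let beta0 : 0 < beta. Proof. by rewrite /beta divr_gt0// mulr_gt0. Qed.
Let alpha_ge0 : 0 <= alpha.
Proof. by have := delta0; have := delta1; rewrite /alpha; lra. Qed.

Let betaM : 2 * beta * M = delta.
Proof. by rewrite /beta; field; rewrite gt_eqF. Qed.

(* The dual form of Hairer and Mattingly's proof of Harris' theorem. *)
Lemma back_contract x s n (g : E -> R) (c a : R) : ufun g -> 0 <= a ->
  (0 < n)%N -> prodl x s n <= 4^-1 ->
  goodtime x s -> goodtime x (s - n%:Z) ->
  (forall y, `|g y - c| <= a * (1 + beta * V y)) ->
  exists c', forall y, `|back K x s n g y - c'| <= alpha * a * (1 + beta * V y).
Proof.
have bM := betaM.
case: n => // m ug a0 _ P4 [S1 _] [_ de] gc.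
apply: center_of_diff => y y'.
have gc' y0 : `|g y0 - c| <= a + a * beta * V y0 by apply: (le_trans (gc y0)); lra.
have ab0 : 0 <= a * beta by rewrite mulr_ge0// ltW.
have B := back_affine x s m ug ab0 gc'.
have al0 := alpha_ge0; have d0 := delta0; have d1 := delta1.
have Sm := S1 m.+1; have Pm := prodl_ge0 x s m; have Pm1 := prodl_ge0 x s m.+1.
have Sm0 := sumb_ge0 x s m.
set P := prodl x s m.+1 in P4 Pm1; set S := sumb x s m.+1 in Sm.
have V0 := HVpos y; have V0' := HVpos y'.
set w := beta * (V y + V y').
have b0 := beta0; have M00 := M0.
have w0 : 0 <= w by rewrite mulr_ge0 ?addr_ge0// ltW.
have dw : delta * w <= w by rewrite ler_piMl.
have aw0 : 0 <= a * w by rewrite mulr_ge0.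
have key : back K x s m.+1 g y - back K x s m.+1 g y' <= a * (alpha * (2 + w)); last first.
  by apply: (le_trans key); rewrite /w; lra.
have PS : a * beta * (P * (V y + V y')) + 2 * (a * beta * S) <= a * (w / 4 + delta).
  have -> : a * beta * (P * (V y + V y')) + 2 * (a * beta * S) =
    a * (P * w + beta * 2 * S) by rewrite /w; lra.
  rewrite ler_wpM2l// lerD//; first by rewrite mulrC ler_wpM2l.
  by rewrite -bM; have := ler_wpM2l (ltW b0) Sm; lra.
have [Vbig|Vsmall] := leP (8 * M) (V y + V y').
  have C1 := back_affine x s m.+1 ug ab0 gc' y.
  have C2 := back_affine x s m.+1 ug ab0 gc' y'.
  move: C1 C2; rewrite !ler_norml -/P -/S => /andP[_ C1] /andP[C2 _].
  have w4 : 4 * delta <= w by rewrite /w -bM; have := ler_wpM2l (ltW b0) Vbig; lra.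
  have : 2 + delta + w / 4 <= alpha * (2 + w) by rewrite /alpha; lra.
  move=> /(ler_wpM2l a0); lra.
have IH' y0 : `|back K x s m g y0 - c| <=
    (a + a * beta * sumb x s m) + (a * beta * prodl x s m) * V y0.
  by apply: (le_trans (B y0)); lra.
have al'0 : 0 <= a + a * beta * sumb x s m by rewrite addr_ge0// mulr_ge0.
have ka'0 : 0 <= a * beta * prodl x s m by rewrite mulr_ge0.
have r0 : 0 < 8 * M by rewrite mulr_gt0.
have e0 : 0 <= eta (8 * M) (x (s - m.+1%:Z)) by rewrite (le_trans _ de)// ltW.
have := kop_minor (y := y) (y' := y') (back_ufun x s m ug) al'0 ka'0 r0 e0 IH' _ _.
move=> /(_ _ _)/le_trans -> //; try lra.
have ea : delta * a <= eta (8 * M) (x (s - m.+1%:Z)) * (a + a * beta * sumb x s m).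
  apply: ler_pM => //; first exact: ltW.
  by rewrite lerDl mulr_ge0.
have : 2 - delta + w / 4 <= alpha * (2 + w) by rewrite /alpha; lra.
move=> /(ler_wpM2l a0).
rewrite /S /P /= in PS.
lra.
Qed.

Variable x : int -> F.
Hypotheses (Hprod : forall s, prodl x s n @[n --> \oo] --> (0 : R))
  (Hgood : forall N, exists2 n, (N <= n)%N & goodtime x (- n%:Z)).

Let prodl_small s (e : R) : 0 < e -> exists N, forall n, (N <= n)%N -> prodl x s n <= e.
Proof.
move=> e0; have /cvgrPdist_le/(_ _ e0) := Hprod s.
move=> [N _ NP]; exists N => n Nn; have := NP _ Nn.
by rewrite sub0r normrN ger0_norm// prodl_ge0.
Qed.

Lemma back_osc t k : exists2 n, goodtime x (t - n%:Z) & forall g, ufun g ->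
  exists c, forall y, `|back K x t n g y - c| <= alpha ^+ k * (1 + beta * V y).
Proof.
have al0 := alpha_ge0; have d0 := delta0; have d1 := delta1.
elim: k => [|k [n ng nP]].
  have [n Nn gn] := Hgood `|t|%N.
  exists `|(t + n%:Z)%R|%N.
    by have -> : t - `|(t + n%:Z)%R|%N%:Z = - n%:Z by lia.
  move=> g ug; exists 0 => y; rewrite subr0 mul1r.
  have [_ /(_ y)/andP[g0 g1]] := back_ufun x t `|(t + n%:Z)%R|%N ug.
  rewrite ger0_norm// (le_trans g1)// lerDl mulr_ge0// ltW//.
have e4 : 0 < 4^-1 :> R by rewrite invr_gt0.
have [N1 N1P] := prodl_small (t - n%:Z) e4.
have [m Nm gm] := Hgood (N1 + `|(t - n%:Z)%R|).+1%N.
pose j := `|(t - n%:Z + m%:Z)%R|%N.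
have jE : t - n%:Z - j%:Z = - m%:Z by rewrite /j; lia.
exists (j + n)%N.
  by have -> : t - (j + n)%N%:Z = - m%:Z by lia.
move=> g ug; have [c cP] := nP g ug.
rewrite back_add exprS.
apply: (back_contract (c := c) (back_ufun x t n ug)) => //.
- exact: exprn_ge0.
- by rewrite /j; lia.
- by apply: N1P; rewrite /j; lia.
- by rewrite jE.
Qed.

Lemma back_forgets t (C e : R) : 0 < e -> exists N, forall n n', (N <= n)%N -> (N <= n')%N ->
  forall g, ufun g -> forall y y', V y <= C -> V y' <= C ->
  `|back K x t n g y - back K x t n' g y'| <= e.
Proof.
move=> e0.
have al0 := alpha_ge0; have d0 := delta0; have d1 := delta1.
pose D := 1 + beta * (`|C| + M).
have D0 : 0 < D by rewrite /D ltr_wpDr// mulr_ge0 ?addr_ge0// ltW.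
have [k kP] : exists k, 2 * (alpha ^+ k * D) <= e.
  have a1 : `|alpha| < 1 by rewrite ger0_norm// /alpha; lra.
  have e'0 : 0 < e / (2 * D) by rewrite divr_gt0// mulr_gt0.
  have /cvgrPdist_le/(_ _ e'0)[N _ NP] := cvg_expr a1.
  exists N; have := NP _ (leqnn N).
  rewrite sub0r normrN ger0_norm ?exprn_ge0// ler_pdivlMr ?mulr_gt0//; lra.
have [n0 g0 n0P] := back_osc t k.
have [N1 N1P] := prodl_small (t - n0%:Z) ltr01.
exists (N1 + n0)%N => n n' Nn Nn' g ug y y' yC yC'.
have [c cP] := n0P g ug.
have H m y0 : (N1 + n0 <= m)%N -> V y0 <= C -> `|back K x t m g y0 - c| <= alpha ^+ k * D.
  move=> Nm y0C; have mE : m = ((m - n0) + n0)%N by clear -Nm; lia.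
  have N1m : (N1 <= m - n0)%N by clear -Nm; lia.
  rewrite mE back_add; set a := alpha ^+ k.
  have a0 : 0 <= a by exact: exprn_ge0.
  have cP' y1 : `|back K x t n0 g y1 - c| <= a + a * beta * V y1.
    by apply: (le_trans (cP y1)); rewrite mulrDr mulr1 mulrA.
  have ab0 : 0 <= a * beta by rewrite mulr_ge0// ltW.
  apply: (le_trans (back_affine _ _ _ (back_ufun x t n0 ug) ab0 cP' y0)).
  have P1 : prodl x (t - n0%:Z) (m - n0) * V y0 <= `|C|.
    apply: (@le_trans _ _ (1 * V y0)).
      by rewrite ler_wpM2r ?N1P// ltW.
    by rewrite mul1r (le_trans y0C)// ler_norm.
  have S1 := g0.1 (m - n0)%N.
  rewrite /D [leRHS]mulrDr mulr1 lerD2l [leRHS]mulrA.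
  by apply: ler_wpM2l => //; exact: lerD.
have H1 := H n y Nn yC; have H2 := H n' y' Nn' yC'.
move: H1 H2; rewrite !ler_norml => /andP[? ?] /andP[? ?].
by apply/andP; split; lra.
Qed.

End HarrisContraction.

Section CountableQuantifiers.
Context d (T : measurableType d).

Lemma measurable_exists (I : countType) (P : I -> T -> Prop) :
  (forall i, measurable [set x | P i x]) -> measurable [set x | exists i, P i x].
Proof.
move=> mP.
have -> : [set x | exists i, P i x] =
    \bigcup_n (if unpickle n is Some i then [set x | P i x] else set0).
  apply/seteqP; split=> x /=.
    by move=> [i Pix]; exists (pickle i) => //=; rewrite pickleK.
  by move=> [n _]; case: unpickle => // i Pix; exists i.
by apply: bigcupT_measurable => n; case: unpickle.
Qed.

Lemma measurable_forall (I : countType) (P : I -> T -> Prop) :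
  (forall i, measurable [set x | P i x]) -> measurable [set x | forall i, P i x].
Proof.
move=> mP.
have -> : [set x | forall i, P i x] = ~` [set x | exists i, ~ P i x].
  apply/seteqP; split=> x /=; first by move=> Px [i]; apply.
  by move=> /forallNP Px i; have /contrapT := Px i.
by apply/measurableC/measurable_exists => i; have := measurableC (mP i).
Qed.

Lemma measurable_imply (b : bool) (P : T -> Prop) :
  measurable [set x | P x] -> measurable [set x | b -> P x].
Proof.
case: b => mP.
  by rewrite (_ : [set x | _] = [set x | P x])//; apply/seteqP; split=> x /= => [/(_ isT)|Px _].
by rewrite (_ : [set x | _] = setT)//; apply/seteqP; split.
Qed.

End CountableQuantifiers.

Section Laws.
Context {R : realType} dT (T : measurableType dT).

Definition proc_path (I : Type) (O : Type) (Z : I -> O -> T) (w : O) : pathT I T :=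
  fun t => Z t w.

Lemma measurable_proc_path d (O : measurableType d) (Z : int -> O -> T) :
  measurable_process Z -> measurable_fun setT (proc_path Z).
Proof. by move=> mZ; apply: measurable_path => t; exact: mZ. Qed.

Definition fin_cyl : set (set (pathT int T)) :=
  [set S | exists (n : nat) (ts : 'I_n -> int) (As : 'I_n -> set T),
    (forall i, measurable (As i)) /\ S = [set z | forall i, As i (z (ts i))]].

Lemma fin_cylT : fin_cyl setT.
Proof.
exists 0%N, (fun=> 0), (fun=> setT); split=> //.
by apply/seteqP; split.
Qed.

Lemma fin_cylI : setI_closed fin_cyl.
Proof.
move=> _ _ [n [ts [As [mA ->]]]] [m [us [Bs [mB ->]]]].
exists (n + m)%N, (fun i => match fintype.split i with inl j => ts j | inr j => us j end),
  (fun i => match fintype.split i with inl j => As j | inr j => Bs j end); split.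
  by move=> i; case: fintype.split.
apply/seteqP; split=> z /=.
  by move=> [zA zB] i; case: fintype.split.
move=> zAB; split=> i.
  by have := zAB (lshift m i); rewrite (unsplitK (inl i : 'I_n + 'I_m)).
by have := zAB (rshift n i); rewrite (unsplitK (inr i : 'I_n + 'I_m)).
Qed.

Lemma fin_cyl_gen : @measurable _ (pathT int T) = <<s fin_cyl >>.
Proof.
apply/seteqP; split.
  apply: smallest_sub; first exact: smallest_sigma_algebra.
  move=> _ [t [A [mA ->]]]; apply: sub_sigma_algebra.
  exists 1%N, (fun=> t), (fun=> A); split=> //.
  by apply/seteqP; split=> z //= /(_ ord0).
apply: smallest_sub; first exact: sigma_algebra_measurable.
move=> _ [n [ts [As [mA ->]]]].
apply: (@measurable_forall _ (pathT int T) 'I_n) => i.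
by have := measurable_coord (ts i) measurableT (mA i); rewrite setTI.
Qed.

Lemma same_law_int d1 (O1 : measurableType d1) (P1 : probability O1 R) (Z1 : int -> O1 -> T)
    d2 (O2 : measurableType d2) (P2 : probability O2 R) (Z2 : int -> O2 -> T) :
  measurable_process Z1 -> measurable_process Z2 -> same_law P1 Z1 P2 Z2 ->
  forall H : pathT int T -> R, bmf H ->
  \int[P1]_w H (proc_path Z1 w) = \int[P2]_w H (proc_path Z2 w).
Proof.
move=> mZ1 mZ2 Z12.
have m1 := measurable_proc_path mZ1; have m2 := measurable_proc_path mZ2.
apply: (pfun_ext (G := fin_cyl)
  (pfunctional_comp m1 (pfunctional_int (probability_setT P1)))
  (pfunctional_comp m2 (pfunctional_int (probability_setT P2)))).
- exact: fin_cyl_gen.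
- exact: fin_cylI.
- exact: fin_cylT.
- move=> S fS; have mS : measurable S by rewrite fin_cyl_gen; exact: sub_sigma_algebra.
  have E d (O : measurableType d) (P : probability O R) (Z : int -> O -> T) :
      measurable_fun setT (proc_path Z) ->
      \int[P]_w \1_S (proc_path Z w) = fine (P [set w | S (proc_path Z w)]).
    move=> mZ; rewrite -Rintegral_indic//.
    by have := mZ measurableT _ mS; rewrite setTI.
  rewrite !E//; move: fS => [n [ts [As [mA ->]]]].
  by congr fine; exact: Z12.
Qed.

Lemma same_law_path d1 (O1 : measurableType d1) (P1 : probability O1 R) (Z1 : int -> O1 -> T)
    d2 (O2 : measurableType d2) (P2 : probability O2 R) (Z2 : int -> O2 -> T) :
  measurable_process Z1 -> measurable_process Z2 -> same_law P1 Z1 P2 Z2 ->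
  forall S : set (pathT int T), measurable S ->
  P1 [set w | S (proc_path Z1 w)] = P2 [set w | S (proc_path Z2 w)].
Proof.
move=> mZ1 mZ2 Z12 S mS.
have m1 := measurable_proc_path mZ1; have m2 := measurable_proc_path mZ2.
have mS1 : measurable [set w | S (proc_path Z1 w)].
  by have := m1 measurableT _ mS; rewrite setTI.
have mS2 : measurable [set w | S (proc_path Z2 w)].
  by have := m2 measurableT _ mS; rewrite setTI.
rewrite (measure_Rintegral (probability_setT P1))//.
rewrite (measure_Rintegral (probability_setT P2))//; congr EFin.
exact: (same_law_int mZ1 mZ2 Z12 (ufun_bmf (ufun_indic mS))).
Qed.

End Laws.

(** * Recurrence of good times *)

Section Recurrence.
Context {R : realType}.

Lemma summable_tails d (T : measurableType d) (mu : probability T R) (f : T -> R) (c : R) :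
  measurable_fun setT f -> (forall x, 0 <= f x) -> (\int[mu]_x (f x)%:E < +oo)%E ->
  0 < c -> (\sum_(n <oo) mu [set x | (n%:R * c < f x)%R] < +oo)%E.
Proof.
move=> mf f0 intf c0.
pose F n := [set x | n%:R * c < f x].
have mF n : measurable (F n) by apply: measurable_gt.
have -> : (\sum_(n <oo) mu (F n) = \sum_(n <oo) \int[mu]_x (\1_(F n) x)%:E)%E.
  by apply: eq_eseriesr => n _; rewrite integral_indic// setIT.
rewrite -integral_nneseries//; last first.
  by move=> n; apply/measurable_EFinP; exact: measurable_indic.
pose g x := c^-1 * f x + 1.
apply: (@le_lt_trans _ _ (\int[mu]_x (g x)%:E)%E).
  apply: ge0_le_integral => //.
  - by move=> x _; apply: nneseries_ge0 => n _ _; rewrite lee_fin.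
  - apply: ge0_emeasurable_sum => //.
      by move=> n _; apply/measurable_EFinP; exact: measurable_indic.
  - by apply/measurable_EFinP; apply: measurable_funD => //; exact: measurable_funM.
  move=> x _; have gx0 : 0 <= g x by rewrite addr_ge0// mulr_ge0// invr_ge0 ltW.
  suff H n : \sum_(0 <= i < n) (\1_(F i) x : R) <= g x.
    apply: lime_le; first exact: is_cvg_nneseries.
    by apply: nearW => n; rewrite sumEFin lee_fin.
  elim: n => [|n IH]; first by rewrite big_nil.
  have [Fx|nFx] := pselect (F n x); last first.
    by rewrite big_nat_recr//= [\1_(F n) x]indicE memNset// addr0.
  apply: (@le_trans _ _ (\sum_(0 <= i < n.+1) 1)).
    by apply: ler_sum => i _; rewrite indicE; case: (_ \in _).
  rewrite sumr_const_nat subn0 -natr1 lerD2r mulrC ler_pdivlMr//.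
  exact: ltW.
have c1 : 0 <= c^-1 by rewrite invr_ge0 ltW.
have mEf : measurable_fun setT (fun x => (f x)%:E) by exact/measurable_EFinP.
have Ef0 x : setT x -> (0 <= (f x)%:E)%E by rewrite lee_fin.
rewrite /g; under eq_integral do rewrite EFinD EFinM.
rewrite ge0_integralD//.
- rewrite (ge0_integralZl mu measurableT mEf Ef0)//.
  have -> : (\int[mu]_x 1 = 1)%E.
    by rewrite integral_cst// mul1e; exact: probability_setT.
  rewrite lte_add_pinfty ?ltry//.
  by rewrite lte_mul_pinfty.
- by move=> x _; rewrite -EFinM lee_fin mulr_ge0.
- by apply/measurable_EFinP; exact: measurable_funM.
Qed.

Lemma limn_esup_lt1 (u : nat -> R) : (forall n, 0 <= u n) ->
  (limn_esup (fun n => (u n)%:E) < 1)%E ->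
  exists k N : nat, forall n, (N <= n)%N -> u n <= 1 - k.+2%:R^-1.
Proof.
move=> u0 /ereal_inf_lt[_ [A [N _ NA] <-]].
set s := ereal_sup _ => s1.
have us n : (N <= n)%N -> ((u n)%:E <= s)%E.
  by move=> Nn; apply: ereal_sup_ubound; exists n => //; exact: NA.
have [r rs] : exists r, s = r%:E.
  have := us N (leqnn N); case: s s1 {us} => [r| |] //; first by exists r.
rewrite {}rs in s1 us; rewrite lte_fin in s1.
pose k := Num.trunc ((1 - r)^-1).
exists k, N => n /us; rewrite lee_fin => /le_trans; apply.
have r1 : 0 < 1 - r by rewrite subr_gt0.
have : (1 - r)^-1 < k.+1%:R by exact: truncnS_gt.
rewrite -[X in _ < X]invrK ltf_pV2 ?posrE ?invr_gt0// => h.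
have : k.+2%:R^-1 <= k.+1%:R^-1 :> R by rewrite lef_pV2 ?posrE// ler_nat.
by move=> h'; rewrite lerBrDl -lerBrDr (le_trans h')// ltW.
Qed.

Definition recurrent_past (T : Type) (S : set (int -> T)) (x : int -> T) :=
  S x -> forall N : nat, exists2 n, (N <= n)%N & S (shiftz (- n%:Z) x).

Lemma measurable_shift_path dT (T : measurableType dT) k :
  measurable_fun setT (shiftz k : pathT int T -> pathT int T).
Proof. by apply: measurable_path => s; exact: measurable_coord. Qed.

Lemma measurable_shift_set dT (T : measurableType dT) k (S : set (pathT int T)) :
  measurable S -> measurable [set x : pathT int T | S (shiftz k x)].
Proof. by move=> mS; have := @measurable_shift_path _ T k measurableT S mS; rewrite setTI. Qed.

Context dT (T : measurableType dT) d (O : measurableType d) (P : probability O R)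
  (X : int -> O -> T).
Hypotheses (mX : measurable_process X) (sX : stationary P X).

Lemma measurable_proc_set (S : set (pathT int T)) : measurable S ->
  measurable [set w | S (proc_path X w)].
Proof. by move=> mS; have := measurable_proc_path mX measurableT mS; rewrite setTI. Qed.

Lemma stationary_shift k (S : set (pathT int T)) : measurable S ->
  P [set w | S (shiftz k (proc_path X w))] = P [set w | S (proc_path X w)].
Proof.
move=> mS; have mXk : measurable_process (fun t => X (t + k)) by move=> t; exact: mX.
exact: (same_law_path mXk mX (sX k) mS).
Qed.

Lemma poincare (S : set (pathT int T)) : measurable S ->
  {ae P, forall w, recurrent_past S (proc_path X w)}.
Proof.
move=> mS.
pose N j := [set x : pathT int T | S (shiftz (- j%:Z) x) /\
   forall n, (j < n)%N -> ~ S (shiftz (- n%:Z) x)].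
have mN j : measurable (N j).
  apply: (measurableI _ _ (measurable_shift_set (- j%:Z) mS)).
  apply: (@measurable_forall _ (pathT int T) nat
    (fun n x => (j < n)%N -> ~ S (shiftz (- n%:Z) x))) => n.
  apply: measurable_imply; have := measurableC (measurable_shift_set (- n%:Z) mS).
  by congr measurable.
have mNX j := measurable_proc_set (mN j).
have NE j : P [set w | N j (proc_path X w)] = P [set w | N 0%N (proc_path X w)].
  rewrite -(stationary_shift (- j%:Z) (mN 0%N)); congr (P _).
  apply/seteqP; split=> w /=.
    move=> [Sj Sn]; split; first by rewrite /shiftz/=; under eq_fun do rewrite oppr0 addr0.
    move=> n n0; have := Sn (n + j)%N; rewrite -[X in (X < _)%N]add0n ltn_add2r => /(_ n0).
    congr (~ S _); apply/funext => t; rewrite /shiftz; congr (proc_path X w _); lia.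
  move=> [Sj Sn]; split.
    by move: Sj; congr S; apply/funext => t; rewrite /shiftz; congr (proc_path X w _); lia.
  move=> n jn; have := Sn (n - j)%N; rewrite subn_gt0 => /(_ jn).
  congr (~ S _); apply/funext => t; rewrite /shiftz; congr (proc_path X w _); lia.
have P0 : P [set w | N 0%N (proc_path X w)] = 0%E.
  have tN : trivIset setT (fun j => [set w | N j (proc_path X w)]).
    apply/trivIsetP => i j _ _; rewrite neq_ltn => ij; apply/seteqP; split=> w //= [].
    move=> [Si Ni] [Sj Nj]; case/orP: ij => ij; [exact: (Ni j)|exact: (Nj i)].
  have : (\sum_(j <oo) P [set w | N j (proc_path X w)] <= 1)%E.
    rewrite -measure_semi_bigcup//; first by apply: probability_le1; exact: bigcupT_measurable.
    exact: bigcupT_measurable.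
  under eq_eseriesr do rewrite NE.
  rewrite (measure_Rintegral (probability_setT P) (mNX 0%N)).
  set p := (X in X%:E) => sump.
  have p0 : 0 <= p by apply: Rintegral_ge0 => w _; rewrite indicE.
  have np n : n%:R * p <= 1.
    rewrite -lee_fin (le_trans _ sump)// (le_trans _ (@nneseries_lim_ge _ _ xpredT 0%N n _))//.
    by rewrite sumEFin lee_fin sumr_const_nat subn0 mulr_natl.
  have [->//|pn0] := eqVneq p 0; have pp : 0 < p by rewrite lt_neqAle eq_sym pn0.
  have := np (Num.trunc p^-1).+1; rewrite -ler_pdivlMr// mul1r leNgt.
  by rewrite truncnS_gt.
have nN : P.-negligible (\bigcup_j [set w | N j (proc_path X w)]).
  by apply: negligible_bigcup => j; apply/negligibleP => //; exact: etrans (NE j) P0.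
apply: negligibleS nN => w /=; apply: contra_notP => nN Sw M.
  apply: contrapT => /forall2NP nS.
  have [j jP jmin] : exists2 j, (forall n, (j <= n)%N -> ~ S (shiftz (- n%:Z) (proc_path X w))) &
     forall i, (forall n, (i <= n)%N -> ~ S (shiftz (- n%:Z) (proc_path X w))) -> (j <= i)%N.
    have ex : exists j, `[< forall n, (j <= n)%N -> ~ S (shiftz (- n%:Z) (proc_path X w)) >].
      exists M; apply/asboolP => n Mn; have [|//] := nS n.
      by move=> h; exfalso; apply: h.
    exists (ex_minn ex); first by case: ex_minnP => m /asboolP.
    by move=> i /asboolP ih; case: ex_minnP => m _; exact.
  case: j jP jmin => [jP _|j jP jmin].
    by apply: (jP 0%N) => //; move: Sw; congr S; apply/funext => t; rewrite /shiftz oppr0 addr0.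
  apply: nN; exists j => //; split=> [|n jn]; last exact: jP.
  apply: contrapT => nSj; suff : (j < j)%N by rewrite ltnn.
  by apply: jmin => n; rewrite leq_eqVlt => /orP[/eqP <-//|]; exact: jP.
Qed.

End Recurrence.

Section GoodEnvironments.
Context {R : realType} dF (F : measurableType dF)
  (lam b : F -> R) (eta : R -> F -> R).
Hypotheses (Hlamm : measurable_fun setT lam) (Hlam0 : forall x, 0 <= lam x)
  (Hbm : measurable_fun setT b) (Hb0 : forall x, 0 <= b x)
  (Hetam : measurable_fun ([set r : R | 0 < r] `*` [set: F]) (fun p : R * F => eta p.1 p.2))
  (Heta01 : forall (r : R) x, 0 < r -> 0 < eta r x < 1).
Implicit Types x : pathT int F.

Definition contr_at x (s : int) := exists k N : nat, forall n, (N <= n)%N ->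
  prodl lam x s n <= (1 - k.+2%:R^-1) ^+ n.

Definition growth_at x (s : int) := forall k : nat, exists N : nat, forall n, (N <= n)%N ->
  b (x (s - n%:Z)) <= (1 + k.+2%:R^-1) ^+ n.

Definition good_env : set (pathT int F) := [set x |
  (forall s, contr_at x s) /\
  exists M k : nat, forall N : nat, exists n : nat, (N <= n)%N /\
    goodtime lam b eta M.+1%:R k.+1%:R^-1 x (- n%:Z)].

Let inv2 (k : nat) : 0 < (k.+2%:R^-1 : R) < 1.
Proof. by rewrite invr_gt0 ltr0n /= invf_lt1// ltr1n. Qed.

Lemma contr_cvg x s : contr_at x s -> prodl lam x s n @[n --> \oo] --> (0 : R).
Proof.
move=> [k [N kN]]; have /andP[k0 k1] := inv2 k.
have c : (1 - k.+2%:R^-1) ^+ n @[n --> \oo] --> (0 : R).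
  by apply: cvg_expr; rewrite ger0_norm ?subr_ge0 ?(ltW k1)// gtrBl.
apply: (@squeeze_cvgr _ _ _ _ (fun=> 0) (fun n => (1 - k.+2%:R^-1) ^+ n)) => //; last exact: cvg_cst.
by exists N => // n /= /kN ->; rewrite prodl_ge0.
Qed.

Lemma sumb_bounded x s : contr_at x s -> growth_at x s ->
  exists M : nat, forall n, sumb lam b x s n <= M.+1%:R.
Proof.
move=> [k [N1 N1P]] /(_ k)[N2 N2P]; have /andP[] := inv2 k.
set q := k.+2%:R^-1 in N1P N2P *; move=> q0 q1.
pose N := maxn N1 N2; pose rho := 1 - q ^+ 2; pose C := (1 + q) / q ^+ 2.
have q2 : 0 < q ^+ 2 by rewrite exprn_gt0.
have q21 : q ^+ 2 <= 1 by rewrite exprn_ile1// ltW.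
have rho0 : 0 <= rho by rewrite subr_ge0.
have C0 : 0 <= C by rewrite divr_ge0// ?ltW// addr_gt0.
have H n : sumb lam b x s (N + n) + C * rho ^+ (N + n) <= sumb lam b x s N + C * rho ^+ N.
  elim: n => [|n IH]; first by rewrite addn0.
  apply: le_trans IH; rewrite addnS /= -addrA lerD2l.
  have : prodl lam x s (N + n) * b (x (s - (N + n).+1%:Z)) <= (1 + q) * rho ^+ (N + n).
    have -> : (1 + q) * rho ^+ (N + n) = (1 - q) ^+ (N + n) * (1 + q) ^+ (N + n).+1.
      rewrite exprS mulrCA -exprMn; congr (_ * _ ^+ _); rewrite /rho; ring.
    apply: ler_pM => //; first exact: prodl_ge0.
    - by apply: N1P; rewrite /N; lia.
    - by apply: N2P; rewrite /N; lia.
  move=> h; apply: (le_trans (lerD h (lexx _))).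
  have -> : C * rho ^+ (N + n).+1 = C * rho ^+ (N + n) - (1 + q) * rho ^+ (N + n).
    by rewrite exprS; move: (rho ^+ (N + n)) => z; rewrite /C /rho; field; rewrite gt_eqF.
  by rewrite addrC subrK.
pose D := sumb lam b x s N + C * rho ^+ N.
have mono n m : sumb lam b x s n <= sumb lam b x s (n + m).
  elim: m => [|m IH]; first by rewrite addn0.
  by rewrite addnS /= (le_trans IH)// lerDl mulr_ge0// prodl_ge0.
exists (Num.trunc D) => n; apply: (le_trans (mono n N)); rewrite addnC.
apply: (@le_trans _ _ D); last by rewrite ltW// truncnS_gt.
by apply: le_trans (H n); rewrite lerDl mulr_ge0// exprn_ge0.
Qed.

Lemma measurable_prodl s n : measurable_fun setT (fun x => prodl lam x s n).
Proof.
elim: n => //= n IH; apply: measurable_funM => //.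
exact: (measurableT_comp Hlamm (measurable_coord _)).
Qed.

Lemma measurable_sumb s n : measurable_fun setT (fun x => sumb lam b x s n).
Proof.
elim: n => //= n IH; apply: measurable_funD => //.
apply: measurable_funM; first exact: measurable_prodl.
exact: (measurableT_comp Hbm (measurable_coord _)).
Qed.

Lemma measurable_eta r : 0 < r -> measurable_fun setT (eta r).
Proof.
move=> r0.
have mD : measurable ([set r : R | 0 < r] `*` [set: F]).
  by apply: measurableX => //; exact: (@measurable_gt R _ R id 0).
have mg : measurable_fun setT (fun x : F => (r, x)) by exact: measurable_fun_pair.
by apply: (measurable_comp mD _ Hetam mg) => _ [x _ <-].
Qed.

Lemma measurable_contr s : measurable [set x : pathT int F | contr_at x s].
Proof.
apply: (@measurable_exists _ (pathT int F)) => k.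
apply: (@measurable_exists _ (pathT int F)) => N.
apply: (@measurable_forall _ (pathT int F)) => n.
by apply: measurable_imply; apply: measurable_le; exact: measurable_prodl.
Qed.

Lemma measurable_goodtime M k s :
  measurable [set x : pathT int F | goodtime lam b eta M.+1%:R k.+1%:R^-1 x s].
Proof.
apply: measurableI.
  apply: (@measurable_forall _ (pathT int F)) => n.
  by apply: measurable_le; exact: measurable_sumb.
apply: measurable_ge; apply: (measurableT_comp _ (measurable_coord s)).
by apply: measurable_eta; rewrite mulr_gt0.
Qed.

Lemma measurable_good_env : measurable good_env.
Proof.
apply: measurableI.
  by apply: (@measurable_forall _ (pathT int F)) => s; exact: measurable_contr.
apply: (@measurable_exists _ (pathT int F)) => M.
apply: (@measurable_exists _ (pathT int F)) => k.
apply: (@measurable_forall _ (pathT int F)) => N.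
apply: (@measurable_exists _ (pathT int F)) => n.
have [Nn|Nn] := boolP (N <= n)%N.
  have := measurable_goodtime M k (- n%:Z); congr measurable.
  by apply/seteqP; split=> x // [].
by rewrite (_ : [set x | _] = set0)//; apply/seteqP; split=> x // [].
Qed.

Lemma prodl_shift x s n : prodl lam x s n = prodl lam (shiftz s x) 0 n.
Proof.
elim: n => //= n ->; congr (_ * lam _).
by rewrite /shiftz; congr (x _); lia.
Qed.

Lemma sumb_shift x s n : sumb lam b x s n = sumb lam b (shiftz s x) 0 n.
Proof.
elim: n => //= n ->; rewrite prodl_shift; congr (_ + _ * b _).
by rewrite /shiftz; congr (x _); lia.
Qed.

Context d (O : measurableType d) (P : probability O R) (X : int -> O -> F).
Hypotheses (mX : measurable_process X) (sX : stationary P X)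
  (Hbint : (\int[P]_w (logp (b (X 0 w)))%:E < +oo)%E)
  (Hcontr : {ae P, forall w,
     (limn_esup (fun n : nat =>
        (powR (\prod_(1 <= i < n.+1) lam (X (- (i%:Z)) w)) (n%:R^-1))%:E) < 1%:E)%E}).

Lemma ae_shift k (S : set (pathT int F)) : measurable S ->
  {ae P, forall w, S (proc_path X w)} -> {ae P, forall w, S (shiftz k (proc_path X w))}.
Proof.
move=> mS aS; have mS' := measurable_proc_set mX (measurableC mS).
have mSk := measurable_proc_set mX (measurable_shift_set k (measurableC mS)).
apply/negligibleP => //.
have := stationary_shift mX sX k (measurableC mS).
by move=> E; apply: (etrans E); apply/negligibleP.
Qed.

Lemma contr0_ae : {ae P, forall w, contr_at (proc_path X w) 0}.
Proof.
apply: filterS Hcontr => w /limn_esup_lt1[].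
  by move=> n; exact: powR_ge0.
move=> k [N kN]; exists k, N.+1 => n Nn.
have E m : prodl lam (proc_path X w) 0 m = \prod_(1 <= i < m.+1) lam (X (- i%:Z) w).
  elim: m => [|m IH]; first by rewrite big_nil.
  by rewrite big_nat_recr//= IH /proc_path sub0r.
have p0 : 0 <= prodl lam (proc_path X w) 0 n by exact: prodl_ge0.
have n0 : (n%:R : R) != 0 by rewrite pnatr_eq0; lia.
have := kN n (ltnW Nn); rewrite -E => h.
have -> : prodl lam (proc_path X w) 0 n = (prodl lam (proc_path X w) 0 n `^ n%:R^-1) ^+ n.
  by rewrite -powR_mulrn ?powR_ge0// -powRrM mulVf// powRr1.
by apply: lerXn2r; rewrite ?nnegrE ?powR_ge0// (le_trans _ h)// powR_ge0.
Qed.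

Lemma growth0_ae : {ae P, forall w, growth_at (proc_path X w) 0}.
Proof.
suff H k : {ae P, forall w, exists N : nat, forall n, (N <= n)%N ->
   b (X (0 - n%:Z) w) <= (1 + k.+2%:R^-1) ^+ n}.
  by apply: ae_foralln.
have /andP[] := inv2 k; set q := k.+2%:R^-1; move=> q0 q1.
have c0 : 0 < ln (1 + q) by rewrite ln_gt0// ltrDl.
pose f w := logp (b (X 0 w)).
have mbX t : measurable_fun setT (fun w => b (X t w)).
  by apply: (measurableT_comp Hbm); exact: mX.
have mf : measurable_fun setT f.
  apply: (measurableT_comp (@measurable_ln R)).
  by apply: measurable_maxr => //; exact: mbX.
have f0 w : 0 <= f w by apply: ln_ge0; rewrite le_max lexx orbT.
have sf := summable_tails mf f0 Hbint c0.
pose G n := [set w | (1 + q) ^+ n < b (X (0 - n%:Z) w)].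
have mG n : measurable (G n) by apply: measurable_gt; exact: mbX.
have GE n : (P (G n) <= P [set w | (n%:R * ln (1 + q) < f w)%R])%E.
  pose S := [set x : pathT int F | (1 + q) ^+ n < b (x 0)].
  have mS : measurable S.
    by apply: measurable_gt; exact: (measurableT_comp Hbm (measurable_coord _)).
  have := stationary_shift mX sX (0 - n%:Z) mS.
  rewrite /S /shiftz /proc_path /= add0r => E; rewrite /G sub0r in E *.
  apply: (@le_trans _ _ (P [set w | (1 + q) ^+ n < b (X 0 w)])); first by rewrite E.
  apply: le_measure; rewrite ?inE.
  - exact: (measurable_proc_set mX mS).
  - exact: measurable_gt.
  - move=> w /= h; have q1n : 1 <= (1 + q) ^+ n by rewrite exprn_ege1// lerDl ltW.
    rewrite /f /logp (max_idPl _) ?(le_trans q1n)// ?ltW//.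
    rewrite mulr_natl -lnXn ?ltr_ln ?posrE ?addr_gt0// ?exprn_gt0 ?addr_gt0//.
    exact: lt_trans (lt_le_trans ltr01 q1n) h.
have sG : (\sum_(n <oo) P (G n) < +oo)%E.
  by apply: le_lt_trans sf; apply: lee_nneseries => // n _ _; exact: GE.
have mL : measurable (lim_sup_set G).
  by apply: bigcapT_measurable => n; apply: bigcup_measurable => j _; exact: mG.
have nL : P.-negligible (lim_sup_set G).
  by apply/negligibleP => //; exact: lim_sup_set_cvg0 sG.
apply: negligibleS nL => w /= /forallNP nN n _.
have /existsNP[m /not_implyP[nm /negP]] := nN n; rewrite -ltNge => h.
by exists m.
Qed.

Lemma good_env_ae : {ae P, forall w, good_env (proc_path X w)}.
Proof.
have c0 : {ae P, forall w, forall s, contr_at (proc_path X w) s}.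
  have H n : {ae P, forall w, contr_at (proc_path X w) n%:Z /\
     contr_at (proc_path X w) (- n%:Z)}.
    have C s : {ae P, forall w, contr_at (proc_path X w) s}.
      apply: filterS (ae_shift s (measurable_contr 0) contr0_ae) => w.
      move=> [k [N kN]]; exists k, N => m Nm; rewrite prodl_shift; exact: kN.
    by apply: filterS2 (C n%:Z) (C (- n%:Z)) => w.
  apply: filterS (ae_foralln H) => w h s.
  have [h1 h2] := h `|s|%N; have [s0|s0] := leP 0 s.
    by move: h1; have -> : `|s|%N%:Z = s by lia.
  by move: h2; have -> : - `|s|%N%:Z = s by lia.
have rec : {ae P, forall w, forall M k, recurrent_past
    [set x | goodtime lam b eta M.+1%:R k.+1%:R^-1 x 0] (proc_path X w)}.
  apply: ae_foralln => M; apply: ae_foralln => k.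
  exact: (poincare mX sX (measurable_goodtime M k 0)).
apply: filterS3 c0 growth0_ae rec => w cw gw rw; split=> //.
have [M MP] := sumb_bounded (cw 0) gw; exists M.
have r0 : 0 < 8 * M.+1%:R :> R by rewrite mulr_gt0.
have /andP[e0 _] := Heta01 (proc_path X w 0) r0.
pose k := Num.trunc (eta (8 * M.+1%:R) (proc_path X w 0))^-1; exists k.
have ke : k.+1%:R^-1 <= eta (8 * M.+1%:R) (proc_path X w 0).
  rewrite -[leRHS]invrK lef_pV2 ?posrE ?invr_gt0//.
  by rewrite ltW// truncnS_gt.
move=> N; have [n Nn [S1 S2]] := rw M k (conj MP ke) N; exists n; split=> //.
split; last by move: S2; rewrite /shiftz/= add0r.
by move=> m; rewrite sumb_shift.
Qed.

End GoodEnvironments.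

(** * Uniqueness *)

Section Solutions.
Context {R : realType} dE (E : measurableType dE) dF (F : measurableType dF)
  (K : R.-pker (F * E) ~> E).
Notation W := (pathT int (E * F)%type).
Notation upto t := (fun s : int => s <= t).

Lemma Tback_upto t n (H : W -> R) : dep (upto t) H -> dep (upto (t - n%:Z)) (Tback K t n H).
Proof.
move=> dH; elim: n => [|n IH] /=; first by rewrite subr0.
by apply: Tstep_dep IH => [|s]; lia.
Qed.

Context d (O : measurableType d) (P : probability O R)
  (Y : int -> O -> E) (X : int -> O -> F).
Hypotheses (mY : measurable_process Y) (mX : measurable_process X).

Definition joint (w : O) : W := fun t => (Y t w, X t w).

Lemma measurable_joint : measurable_fun setT joint.
Proof. by apply: measurable_path => t; apply: measurable_fun_pair; [exact: mY|exact: mX]. Qed.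

Lemma measurable_joint_set (S : set W) : measurable S -> measurable [set w | S (joint w)].
Proof. by move=> mS; have := measurable_joint measurableT mS; rewrite setTI. Qed.

Lemma measurable_keep_joint (D : pred int) (S : set W) : measurable S ->
  measurable [set w | S (keep D (joint w))].
Proof.
move=> mS; have mk := @measurable_keep _ E _ F D.
by have := measurableT_comp mk measurable_joint measurableT mS; rewrite setTI.
Qed.

Lemma keep_cond_sigma t (S : set W) : measurable S ->
  cond_sigma Y X (t + 1) [set w | S (keep (upto t) (joint w))].
Proof.
move=> mS; rewrite /cond_sigma; set G := (X in <<s X >>).
have mk : @measurable_fun _ _ (g_sigma_algebraType G) W setT
    (fun w => keep (upto t) (joint w)).
  apply: measurable_path => s; rewrite /keep /joint.
  have mXs : @measurable_fun _ _ (g_sigma_algebraType G) F setT (X s).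
    move=> _ A mA; rewrite setTI; apply: sub_sigma_algebra.
    by left; exists s, A.
  case: (boolP (s <= t)) => st; apply: measurable_fun_pair => //.
  move=> _ A mA; rewrite setTI; apply: sub_sigma_algebra.
  by right; exists s, A; split=> //; lia.
by have := mk measurableT S mS; rewrite setTI.
Qed.

Lemma cond_sigma_keep t (B : set O) : cond_sigma Y X (t + 1) B ->
  exists2 S : set W, measurable S & B = [set w | S (keep (upto t) (joint w))].
Proof.
pose H : set (set O) := [set B | exists2 S : set W, measurable S &
  B = [set w | S (keep (upto t) (joint w))]].
suff : cond_sigma Y X (t + 1) `<=` H by apply.
apply: smallest_sub.
  split.
  - by exists set0 => //; apply/seteqP; split.
  - move=> A [S mS ->]; exists (~` S); first exact: measurableC.
    by apply/seteqP; split=> w //= [].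
  - move=> A HA; have [S SP] := choice (fun n => (exists2P _ _).1 (HA n)).
    exists (\bigcup_n S n); first by apply: bigcupT_measurable => n; have [] := SP n.
    apply/seteqP; split=> w /= [n _].
      by have [_ ->] := SP n => /= h; exists n.
    by move=> h; exists n => //; have [_ ->] := SP n.
move=> C [[s [A [mA ->]]]|[s [A [st [mA ->]]]]].
- exists [set z : W | A (z s).2].
    have := measurableT_comp measurable_snd (measurable_coord (T := (E * F)%type) s).
    by move=> /(_ measurableT _ mA); rewrite setTI.
  by apply/seteqP; split=> w; rewrite /keep /joint /=; case: ifP.
- exists [set z : W | A (z s).1].
    have := measurableT_comp measurable_fst (measurable_coord (T := (E * F)%type) s).
    by move=> /(_ measurableT _ mA); rewrite setTI.
  have -> : Y s @^-1` A = [set w | A (Y s w)] by [].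
  by apply/seteqP; split=> w; rewrite /keep /joint /=; have -> : s <= t by lia.
Qed.

Let k1 t w : K (X t w, Y t w) setT = 1%E. Proof. exact: prob_kernel. Qed.

Lemma measurable_K_joint t A : measurable A ->
  ufun (fun w => fine (K (X t w, Y t w) A)).
Proof.
move=> mA; split.
  apply: measurableT_comp => //; apply: (measurableT_comp (measurable_kernel K A mA)).
  by apply: measurable_fun_pair; [exact: mX|exact: mY].
move=> w; rewrite -lee_fin -[(_ <= 1)]lee_fin.
have h : K (X t w, Y t w) A \is a fin_num.
  exact: (measure_fin (k1 t w) mA).
rewrite fineK// measure_ge0/= -(k1 t w).
by apply: le_measure; rewrite ?inE.
Qed.

Lemma integral_setK t (B : set O) A : measurable B -> measurable A ->
  (\int[P]_(w in B) K (X t w, Y t w) A =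
   (\int[P]_w (\1_B w * fine (K (X t w, Y t w) A)))%:E)%E.
Proof.
move=> mB mA; have uK := measurable_K_joint t mA.
have bK : bmf (fun w => \1_B w * fine (K (X t w, Y t w) A) : R).
  by apply: bmfM; [exact/ufun_bmf/ufun_indic|exact: ufun_bmf].
rewrite /Rintegral fineK; last first.
  apply: (integrable_fin_num measurableT).
  exact: (bmf_integrable (probability_setT P) bK).
rewrite [LHS]integral_mkcond; apply: eq_integral => w _.
rewrite /patch indicE; case: (w \in B); rewrite ?mul0r// mul1r fineK//.
exact: (measure_fin (k1 t w) mA).
Qed.

Lemma markov_rect : markov_in_env K P Y X ->
  forall (t : int) (S : set W) (A : set E), measurable S -> measurable A ->
  \int[P]_w (\1_S (keep (upto t) (joint w)) * \1_A (Y (t + 1) w)) =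
  \int[P]_w (\1_S (keep (upto t) (joint w)) * fine (K (X t w, Y t w) A)).
Proof.
move=> mk t S A mS mA.
have mB := measurable_keep_joint (upto t) mS.
have mYA : measurable [set w | A (Y (t + 1) w)].
  by have := mY (t + 1) measurableT mA; rewrite setTI.
have := mk (t + 1) A mA _ (keep_cond_sigma mS).
rewrite addrK integral_setK// (measure_Rintegral (probability_setT P)) => [[]|].
  move=> h; apply: etrans h; congr Rintegral; apply/funext => w.
  by rewrite !indicE in_setI -natrM mulnb.
exact: measurableI.
Qed.

Definition solves := forall t (H : W -> R), bmf H -> dep (upto (t + 1)) H ->
  \int[P]_w H (joint w) = \int[P]_w Tstep K t H (joint w).

Lemma markov_solves : markov_in_env K P Y X -> solves.
Proof.
move=> mk t H bH dH.
have HE : H = (fun z => H (keep (upto (t + 1)) z)).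
  by apply/funext => z; rewrite keep_id.
rewrite HE; have mkp := @measurable_keep _ E _ F (upto (t + 1)).
have PZ := pfunctional_comp measurable_joint (pfunctional_int (probability_setT P)).
apply: (pfun_ext (G := @rect_cyl _ E _ F) (pfunctional_comp mkp PZ)
  (pfunctional_comp mkp (pfunctional_Tstep K t PZ))) bH.
- exact: rect_cyl_gen.
- exact: rect_cylI.
- exact: rect_cylT.
move=> _ [l [A [B [mA mB ->]]]].
set S := [set z : W | _].
pose S' : set W := [set z : W | forall r, r \in l ->
  (if r == t + 1 then setT else A r) (z r).1 /\ B r (z r).2].
have mS' : measurable S'.
  apply: rect_cyl_measurable; exists l, (fun r => if r == t + 1 then setT else A r), B.
  by split=> // r; case: ifP.
pose A' := if t + 1 \in l then A (t + 1) else setT.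
have mA' : measurable A' by rewrite /A'; case: ifP.
have E1 z : \1_S (keep (upto (t + 1)) z) = \1_S' (keep (upto t) z) * \1_A' (z (t + 1)).1 :> R.
  rewrite !indicE -natrM mulnb; congr (_%:R); congr nat_of_bool; apply/idP/andP.
    move=> /set_mem h; split; first apply/mem_set => r rl.
      have := h r rl; rewrite /keep; case: eqVneq => [->|rt] /=.
        by rewrite lexx; case: ifP => // _ [].
      by have -> : (r <= t + 1) = (r <= t) by lia.
    by apply/mem_set; rewrite /A'; case: ifPn => // /h; rewrite /keep lexx => -[].
  move=> [/set_mem h1 /set_mem h2]; apply/mem_set => r rl; have := h1 r rl; rewrite /keep.
  case: eqVneq => [rt|rt] /=.
    move: h2; rewrite /A' -rt rl => h2 [_]; rewrite lexx; case: ifP => //=.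
  by have -> : (r <= t + 1) = (r <= t) by lia.
have E2 z : Tstep K t (fun z => \1_S (keep (upto (t + 1)) z)) z =
    \1_S' (keep (upto t) z) * fine (K ((z t).2, (z t).1) A').
  rewrite /Tstep; have kz : kcoord K t z setT = 1%E by exact: prob_kernel.
  rewrite -(Rintegral_indic (kcoord K t z) mA').
  rewrite -(pfunZ (pfunctional_int kz)); last exact/ufun_bmf/ufun_indic.
  congr Rintegral; apply/funext => e; rewrite E1; congr (_ * _); last first.
    by rewrite /upd eqxx.
  congr (\1_S' _); apply/funext => s; rewrite /keep /upd; case: eqVneq => [->|//].
  by have -> : (t + 1 <= t) = false by lia.
transitivity (\int[P]_w (\1_S' (keep (upto t) (joint w)) * \1_A' (Y (t + 1) w))).
  by congr Rintegral; apply/funext => w; rewrite E1.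
rewrite (markov_rect mk)//; congr Rintegral; apply/funext => w.
by rewrite E2.
Qed.

Lemma solves_Tback t n (H : W -> R) : solves -> bmf H -> dep (upto t) H ->
  \int[P]_w H (joint w) = \int[P]_w Tback K t n H (joint w).
Proof.
move=> sol bH dH; elim: n => // n IH; rewrite IH /=.
apply: sol; first exact: Tback_bmf.
by apply: sub_dep (@Tback_upto _ n _ dH) => s; lia.
Qed.

End Solutions.

Section Forgetting.
Context {R : realType} dE (E : measurableType dE) dF (F : measurableType dF)
  (K : R.-pker (F * E) ~> E) (V : E -> R) (lam b : F -> R) (eta : R -> F -> R).
Notation W := (pathT int (E * F)%type).
Notation within m := (fun s : int => (- (m%:Z) <= s) && (s <= m%:Z)).
Notation erase := (keep (fun=> false)).

Definition env (z : W) : pathT int F := fun t => (z t).2.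

Hypotheses (HVm : measurable_fun setT V) (HVpos : forall y, 0 < V y)
  (Hlam0 : forall x, 0 <= lam x) (Hb0 : forall x, 0 <= b x)
  (Hdrift : forall x y, (\int[K (x, y)]_z (V z)%:E <= (lam x * V y + b x)%:E)%E)
  (Hminor : forall r : R, 0 < r -> exists nu : R.-pker F ~> E,
     forall x y A, V y <= r -> measurable A ->
       ((eta r x)%:E * nu x A <= K (x, y) A)%E).

Lemma ufun_upd t (z : W) (H : W -> R) : ufun H -> ufun (fun e : E => H (upd z t e)).
Proof.
move=> [mH H01]; split; last by move=> e; exact: H01.
exact: (measurableT_comp mH (measurable_upd2 t z)).
Qed.

Lemma Tback_within m n (H : W -> R) : dep (within m) H ->
  dep (fun s => s == m%:Z - (n + m.*2)%N%:Z) (Tback K m (n + m.*2) H).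
Proof.
move=> dH; apply: sub_dep (@Tback_dep _ _ _ _ _ K m (- m%:Z) (n + m.*2) H dH).
by move=> s; rewrite -addnn; lia.
Qed.

Lemma Tback_forgets m (z : W) (C e : R) : good_env lam b eta (env z) -> 0 < e ->
  exists N, forall n n', (N <= n)%N -> (N <= n')%N ->
  forall H : W -> R, ufun H -> dep (within m) H -> forall z' : W, env z' = env z ->
  V (z (m%:Z - n%:Z)).1 <= C -> V (z' (m%:Z - n'%:Z)).1 <= C ->
  `|Tback K m n H z - Tback K m n' H z'| <= e.
Proof.
move=> [gc [M [k gM]]] e0.
have M0 : 0 < M.+1%:R :> R by [].
have k0 : 0 < k.+1%:R^-1 :> R by rewrite invr_gt0.
have k1 : k.+1%:R^-1 <= 1 :> R by rewrite invf_le1// ler1n.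
have Hprod s := contr_cvg Hlam0 (gc s).
have Hgood N : exists2 n, (N <= n)%N & goodtime lam b eta M.+1%:R k.+1%:R^-1 (env z) (- n%:Z).
  by have [n [? ?]] := gM N; exists n.
have [N NP] := back_forgets HVm HVpos Hlam0 Hb0 Hdrift Hminor M0 k0 k1 Hprod Hgood
  (- m%:Z) C e0.
exists (N + m.*2)%N => n n' Nn Nn' H uH dH z' zz' Vz Vz'.
have nE : n = ((n - m.*2) + m.*2)%N by clear -Nn; lia.
have nE' : n' = ((n' - m.*2) + m.*2)%N by clear -Nn'; lia.
have Nn2 : (N <= n - m.*2)%N by clear -Nn; lia.
have Nn2' : (N <= n' - m.*2)%N by clear -Nn'; lia.
have mm : m%:Z - m.*2%:Z = - m%:Z by rewrite -addnn; clear; lia.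
have dT : dep (fun s => s == - m%:Z) (Tback K m m.*2 H).
  have := @Tback_within m 0 H dH; rewrite add0n.
  by apply: sub_dep => s; rewrite mm.
have e2 s : (z' s).2 = (z s).2 by have /(congr1 (fun f => f s)) := zz'.
rewrite nE nE' !Tback_add !mm !Tback_back//.
have -> : (fun s => (z' s).2) = env z by rewrite -zz'.
have -> : (fun y => Tback K m m.*2 H (upd z' (- m%:Z) y)) =
    (fun y => Tback K m m.*2 H (upd z (- m%:Z) y)).
  apply/funext => y; apply: dT => s; rewrite /upd; first by case: eqP => _ /=.
  by move=> ->.
have E1 n0 : (m.*2 <= n0)%N -> - m%:Z - (n0 - m.*2)%N%:Z = m%:Z - n0%:Z.
  by clear => h; rewrite -addnn in h *; lia.
apply: NP => //.
- by apply: ufun_upd; exact: Tback_ufun.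
- by rewrite E1//; clear -Nn; lia.
- by rewrite E1//; clear -Nn'; lia.
Qed.

Context d (O : measurableType d) (P : probability O R)
  (Y : int -> O -> E) (X : int -> O -> F).
Hypotheses (mY : measurable_process Y) (mX : measurable_process X)
  (sZ : stationary P (fun t w => (Y t w, X t w)))
  (gX : {ae P, forall w, good_env lam b eta (proc_path X w)}).

Notation Z := (joint Y X).

Lemma erase_L1 m (H : W -> R) (e : R) : ufun H -> dep (within m) H -> 0 < e ->
  exists N, forall n, (N <= n)%N ->
  \int[P]_w `|Tback K m n H (Z w) - Tback K m n H (erase (Z w))| <= e.
Proof.
move=> uH dH e0; have mZ := measurable_joint mY mX.
pose A C : set O := [set w | C < V (Y 0 w)].
have mVY t : measurable_fun setT (fun w => V (Y t w)).
  by apply: (measurableT_comp HVm); exact: mY.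
have e2 : 0 < e / 2 by lra.
have [C CV CA] : exists2 C : R, V point <= C & fine (P (A C)) <= e / 2.
  pose f_ (n : nat) : O -> R := \1_(A n%:R).
  have uf n : ufun (f_ n) by apply: ufun_indic; exact: measurable_gt.
  have cf w : f_ n w @[n --> \oo] --> (0 : R).
    apply: cvg_near_cst; exists (Num.trunc (V (Y 0 w))).+1 => // n /= h.
    rewrite /f_ indicE memNset// /A/= => VC.
    have := truncnS_gt (V (Y 0 w)); apply/negP; rewrite -leNgt (le_trans _ (ltW VC))//.
    by rewrite ler_nat.
  have u0 : ufun (fun=> 0 : R) by split=> [//|w]; rewrite lexx ler01.
  have := pfun_cvg (pfunctional_int (probability_setT P)) uf (u0 _ O) cf.
  rewrite Rintegral_cst// mul0r => /cvgrPdist_le/(_ _ e2)[N _ NP].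
  pose n := maxn N (Num.trunc (V point)).+1.
  exists n%:R.
    rewrite ltW// (lt_le_trans (truncnS_gt _))// ler_nat; exact: leq_maxr.
  have := NP n (leq_maxl _ _); rewrite /f_ Rintegral_indic; last exact: measurable_gt.
  by rewrite sub0r normrN ger0_norm// fine_ge0.
pose B n : set O := [set w | V (Y (m%:Z - n%:Z) w) <= C].
have mB n : measurable (B n) by apply: measurable_le.
pose D n w := `|Tback K m n H (Z w) - Tback K m n H (erase (Z w))|.
have mT n : measurable_fun setT (fun w => Tback K m n H (Z w)).
  by apply: measurableT_comp mZ; have [] := Tback_ufun K m n uH.
have mTe n : measurable_fun setT (fun w => Tback K m n H (erase (Z w))).
  apply: (measurableT_comp (Tback_ufun K m n uH).1).
  exact: (measurableT_comp (@measurable_keep _ E _ F (fun=> false)) mZ).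
have D1 n w : 0 <= D n w <= 1.
  rewrite normr_ge0/=; have [_ T01] := Tback_ufun K m n uH.
  have /andP[? ?] := T01 (Z w); have /andP[? ?] := T01 (erase (Z w)).
  by rewrite ler_norml; apply/andP; split; lra.
have uD n : ufun (D n).
  split; last exact: D1.
  by apply: measurableT_comp => //; exact: measurable_funB.
have uDB n : ufun (fun w => \1_(B n) w * D n w).
  by apply: ufunM => //; exact: ufun_indic.
have cD : (fun n => \int[P]_w (\1_(B n) w * D n w)) @ \oo --> \int[P]_w (0 : R).
  apply: Rintegral_ae_cvg => //.
  - exact: probability_setT.
  - by apply: ufun_cst; rewrite lexx ler01.
  apply: filterS gX => w gw; apply/cvgrPdist_le => e' e'0.
  have [N NP] := @Tback_forgets m (Z w) C e' gw e'0.
  exists N => // n /= Nn; rewrite sub0r normrN indicE.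
  have [/set_mem Bw|_] := boolP (w \in B n); last by rewrite mul0r normr0 ltW.
  rewrite mul1r /D normr_id; apply: NP => //.
move: cD; rewrite Rintegral_cst// mul0r => /cvgrPdist_le/(_ _ e2)[N _ NP].
exists N => n Nn; have := NP n Nn; rewrite sub0r normrN ger0_norm; last first.
  by apply: Rintegral_ge0 => w _; have [_ /(_ w)/andP[]] := uDB n.
move=> h1; pose Bc : set O := [set w | C < V (Y (m%:Z - n%:Z) w)].
have mBc : measurable Bc by exact: measurable_gt.
have PBc : P Bc = P (A C).
  have := stationary_shift (X := fun t w => (Y t w, X t w)) _ sZ (m%:Z - n%:Z)
    (S := [set z : pathT int (E * F)%type | C < V (z 0).1]).
  rewrite /shiftz /proc_path /=; under [X in P X]eq_set do rewrite add0r.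
  apply.
    by move=> t; apply: measurable_fun_pair.
  apply: measurable_gt; apply: (measurableT_comp HVm).
  exact: (measurableT_comp measurable_fst (measurable_coord _)).
have PI := pfunctional_int (probability_setT P).
apply: (@le_trans _ _ (\int[P]_w (\1_(B n) w * D n w + \1_Bc w))).
  apply: (pfun_le PI).
  - exact: (ufun_bmf (uD n)).
  - by apply: bmfD; [exact/ufun_bmf/uDB|exact/ufun_bmf/ufun_indic].
  move=> w; rewrite !indicE; have [Vw|Vw] := leP (V (Y (m%:Z - n%:Z) w)) C.
    by rewrite mem_set// mul1r lerDl.
  rewrite [_ \in Bc]mem_set// [_ \in B n]memNset ?mul0r ?add0r.
    by have /andP[] := D1 n w.
  by rewrite /B/= leNgt Vw.
rewrite (pfunD PI); [|exact/ufun_bmf/uDB|exact/ufun_bmf/ufun_indic].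
rewrite (splitr e); apply: lerD => //.
by apply: le_trans CA; rewrite -PBc Rintegral_indic.
Qed.

Lemma joint_limit (sol : solves K P Y X) m (H : W -> R) : ufun H -> dep (within m) H ->
  \int[P]_w Tback K m n H (erase (Z w)) @[n --> \oo] --> \int[P]_w H (Z w).
Proof.
move=> uH dH; apply/cvgrPdist_le => e e0.
have [N NP] := erase_L1 uH dH e0; exists N => // n /= Nn.
apply: le_trans (NP n Nn).
have mZ := measurable_joint mY mX.
have bT : bmf (fun w => Tback K m n H (Z w)).
  have [mT [C TC]] := Tback_bmf K m n (ufun_bmf uH).
  by split; [exact: measurableT_comp mT mZ|exists C].
have bTe : bmf (fun w => Tback K m n H (erase (Z w))).
  have [mT [C TC]] := Tback_bmf K m n (ufun_bmf uH).
  split; last by exists C.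
  exact: (measurableT_comp mT (measurableT_comp (@measurable_keep _ E _ F (fun=> false)) mZ)).
have dH' : dep (fun s : int => s <= m%:Z) H by apply: sub_dep dH => s /andP[].
rewrite (solves_Tback n sol (ufun_bmf uH) dH').
have PI := pfunctional_int (probability_setT P).
rewrite -(pfunB PI)//; apply: (pfun_norm PI); exact: bmfB.
Qed.

End Forgetting.

Section Uniqueness.
Context {R : realType} dE (E : measurableType dE) dF (F : measurableType dF)
  (K : R.-pker (F * E) ~> E) (V : E -> R) (lam b : F -> R) (eta : R -> F -> R).
Notation W := (pathT int (E * F)%type).
Notation within m := (fun s : int => (- (m%:Z) <= s) && (s <= m%:Z)).
Notation erase := (keep (fun=> false)).

Definition ienv (x : pathT int F) : W := fun t => (point, x t).

Lemma measurable_ienv : measurable_fun setT ienv.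
Proof.
apply: measurable_path => t; apply: measurable_fun_pair => //.
exact: measurable_coord.
Qed.

Hypotheses (HVm : measurable_fun setT V) (HVpos : forall y, 0 < V y)
  (Hlam0 : forall x, 0 <= lam x) (Hb0 : forall x, 0 <= b x)
  (Hdrift : forall x y, (\int[K (x, y)]_z (V z)%:E <= (lam x * V y + b x)%:E)%E)
  (Hminor : forall r : R, 0 < r -> exists nu : R.-pker F ~> E,
     forall x y A, V y <= r -> measurable A ->
       ((eta r x)%:E * nu x A <= K (x, y) A)%E).

Lemma same_law_ae d1 (O1 : measurableType d1) (P1 : probability O1 R) (X1 : int -> O1 -> F)
    d2 (O2 : measurableType d2) (P2 : probability O2 R) (X2 : int -> O2 -> F)
    (S : set (pathT int F)) :
  measurable_process X1 -> measurable_process X2 -> same_law P1 X1 P2 X2 -> measurable S ->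
  {ae P2, forall w, S (proc_path X2 w)} -> {ae P1, forall w, S (proc_path X1 w)}.
Proof.
move=> mX1 mX2 X12 mS aS.
have m1 := measurable_proc_set mX1 (measurableC mS).
have m2 := measurable_proc_set mX2 (measurableC mS).
apply/negligibleP => //; apply: etrans (same_law_path mX1 mX2 X12 (measurableC mS)) _.
exact/negligibleP.
Qed.

Lemma markov_unique
    d1 (O1 : measurableType d1) (P1 : probability O1 R)
    (Y1 : int -> O1 -> E) (X1 : int -> O1 -> F)
    d2 (O2 : measurableType d2) (P2 : probability O2 R)
    (Y2 : int -> O2 -> E) (X2 : int -> O2 -> F) :
  measurable_process Y1 -> measurable_process X1 ->
  stationary P1 (fun t w => (Y1 t w, X1 t w)) -> markov_in_env K P1 Y1 X1 ->
  {ae P1, forall w, good_env lam b eta (proc_path X1 w)} ->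
  measurable_process Y2 -> measurable_process X2 ->
  stationary P2 (fun t w => (Y2 t w, X2 t w)) -> markov_in_env K P2 Y2 X2 ->
  {ae P2, forall w, good_env lam b eta (proc_path X2 w)} ->
  same_law P1 X1 P2 X2 ->
  same_law P1 (fun t w => (Y1 t w, X1 t w)) P2 (fun t w => (Y2 t w, X2 t w)).
Proof.
move=> mY1 mX1 sZ1 K1 g1 mY2 mX2 sZ2 K2 g2 X12 n ts As mAs.
pose S : set W := [set z | forall i, As i (z (ts i))].
have mS : measurable S.
  apply: (@measurable_forall _ W 'I_n) => i.
  by have := measurable_coord (ts i) measurableT (mAs i); rewrite setTI.
pose m := (\max_(i < n) `|ts i|)%N.
have dS : dep (within m) (\1_S : W -> R).
  move=> z z' e2 e1; rewrite !indicE; congr ((nat_of_bool _)%:R).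
  have zz' i : z (ts i) = z' (ts i).
    have /e1 : within m (ts i).
      have := leq_bigmax (F := fun i => `|ts i|%N) i; rewrite -/m; lia.
    by have := e2 (ts i); case: (z (ts i)) => a1 a2; case: (z' (ts i)) => b1 b2 /= -> ->.
  by apply/idP/idP => /set_mem h; apply/mem_set => i; [rewrite -zz'|rewrite zz'].
have uS := ufun_indic (R := R) mS.
have mZ1 := measurable_joint_set mY1 mX1 mS; have mZ2 := measurable_joint_set mY2 mX2 mS.
have L1 := joint_limit HVm HVpos Hlam0 Hb0 Hdrift Hminor mY1 mX1 sZ1 g1
  (markov_solves mY1 mX1 K1) uS dS.
have L2 := joint_limit HVm HVpos Hlam0 Hb0 Hdrift Hminor mY2 mX2 sZ2 g2
  (markov_solves mY2 mX2 K2) uS dS.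
have EL : (fun n => \int[P1]_w Tback K m n \1_S (erase (joint Y1 X1 w))) =
    (fun n => \int[P2]_w Tback K m n \1_S (erase (joint Y2 X2 w))).
  apply/funext => j.
  have [mT [C TC]] := Tback_bmf K m j (ufun_bmf uS).
  apply: (same_law_int mX1 mX2 X12 (H := fun x => Tback K m j \1_S (ienv x))).
  by split; [exact: measurableT_comp mT measurable_ienv|exists C].
rewrite EL in L1; have EE := cvg_unique (@Rhausdorff R) L1 L2.
change (P1 [set w | S (joint Y1 X1 w)] = P2 [set w | S (joint Y2 X2 w)]).
rewrite (measure_Rintegral (probability_setT P1))// (measure_Rintegral (probability_setT P2))//.
by congr EFin; exact: EE.
Qed.

End Uniqueness.

(** * Ergodicity *)

Section Ergodicity.
Context {R : realType} dE (E : measurableType dE) dF (F : measurableType dF)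
  (K : R.-pker (F * E) ~> E) (V : E -> R) (lam b : F -> R) (eta : R -> F -> R).
Notation W := (pathT int (E * F)%type).
Notation within m := (fun s : int => (- (m%:Z) <= s) && (s <= m%:Z)).
Notation erase := (keep (fun=> false)).

Hypotheses (HVm : measurable_fun setT V) (HVpos : forall y, 0 < V y)
  (Hlam0 : forall x, 0 <= lam x) (Hb0 : forall x, 0 <= b x)
  (Hdrift : forall x y, (\int[K (x, y)]_z (V z)%:E <= (lam x * V y + b x)%:E)%E)
  (Hminor : forall r : R, 0 < r -> exists nu : R.-pker F ~> E,
     forall x y A, V y <= r -> measurable A ->
       ((eta r x)%:E * nu x A <= K (x, y) A)%E).

Context d (O : measurableType d) (P : probability O R)
  (Y : int -> O -> E) (X : int -> O -> F).
Hypotheses (mY : measurable_process Y) (mX : measurable_process X)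
  (sZ : stationary P (fun t w => (Y t w, X t w)))
  (gX : {ae P, forall w, good_env lam b eta (proc_path X w)})
  (sol : solves K P Y X).
Notation Z := (joint Y X).

Let PI := pfunctional_int (probability_setT P).

Let mZ := measurable_joint mY mX.

Lemma ufun_joint (f : W -> R) : ufun f -> ufun (fun w => f (Z w)).
Proof. by move=> [mf f01]; split; [exact: measurableT_comp mf mZ|move=> w; exact: f01]. Qed.

Definition L1dist (f g : O -> R) := \int[P]_w `|f w - g w|.

Lemma L1dist_triangle f g h : bmf f -> bmf g -> bmf h -> L1dist f h <= L1dist f g + L1dist g h.
Proof.
move=> bf bg bh; rewrite /L1dist -(pfunD PI); try exact/bmf_norm/bmfB.
apply: (pfun_le PI); first exact/bmf_norm/bmfB.
  by apply: bmfD; exact/bmf_norm/bmfB.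
move=> w; apply: le_trans (ler_normD _ _).
by rewrite addrA subrK.
Qed.

Lemma L1dist_int f g : bmf f -> bmf g -> `|\int[P]_w f w - \int[P]_w g w| <= L1dist f g.
Proof. by move=> bf bg; rewrite -(pfunB PI)//; apply: (pfun_norm PI); exact: bmfB. Qed.

Lemma L1dist_shift k (f g : W -> R) : bmf f -> bmf g ->
  L1dist (fun w => f (shiftz k (Z w))) (fun w => g (shiftz k (Z w))) =
  L1dist (fun w => f (Z w)) (fun w => g (Z w)).
Proof.
move=> bf bg; pose ZZ (t : int) (w : O) := (Y t w, X t w).
have mZZ : measurable_process ZZ by move=> t; apply: measurable_fun_pair.
have mZk : measurable_process (fun t => ZZ (t + k)) by move=> t; exact: mZZ.
apply: (same_law_int mZk mZZ (sZ k) (H := fun z => `|f z - g z|)).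
exact/bmf_norm/bmfB.
Qed.

Definition approximable (f : W -> R) := ufun f /\ forall e : R, 0 < e ->
  exists m (G : W -> R), [/\ ufun G, dep (within m) G &
    L1dist (fun w => f (Z w)) (fun w => G (Z w)) <= e].


Lemma L1dist_sym f g : L1dist f g = L1dist g f.
Proof. by congr Rintegral; apply/funext => w; rewrite distrC. Qed.

Lemma ufun_compl (f : W -> R) : ufun f -> ufun (fun z => 1 - f z).
Proof.
move=> [mf f01]; split; first exact: measurable_funB.
by move=> z; have /andP[? ?] := f01 z; apply/andP; split; lra.
Qed.

Lemma approximable_compl f : approximable f -> approximable (fun z => 1 - f z).
Proof.
move=> [uf af]; split; first exact: ufun_compl.
move=> e e0; have [m [G [uG dG fG]]] := af e e0.
exists m, (fun z => 1 - G z); split; first exact: ufun_compl.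
- by move=> z z' e2 e1; rewrite (dG z z').
- apply: le_trans fG; rewrite le_eqVlt; apply/orP; left; apply/eqP.
  by congr Rintegral; apply/funext => w; rewrite distrC; congr `|_|; lra.
Qed.

Lemma approximable_mul f g : approximable f -> approximable g ->
  approximable (fun z => f z * g z).
Proof.
move=> [uf af] [ug ag]; split; first exact: ufunM.
move=> e e0; have e2 : 0 < e / 2 by lra.
have [m [G [uG dG fG]]] := af _ e2; have [m' [G' [uG' dG' gG']]] := ag _ e2.
exists (maxn m m'), (fun z => G z * G' z); split; first exact: ufunM.
- move=> z z' h2 h1; rewrite (dG z z')// ?(dG' z z')// => s hs; apply: h1; lia.
- rewrite (splitr e); apply: le_trans (lerD fG gG').
  have := ufun_joint uf; have := ufun_joint ug; have := ufun_joint uG; have := ufun_joint uG'.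
  move=> uG1' uG1 ug1 uf1; rewrite /L1dist -(pfunD PI);
    try (by apply/bmf_norm/bmfB; exact: ufun_bmf).
  apply: (pfun_le PI).
  + by apply/bmf_norm/bmfB; apply/bmfM; exact: ufun_bmf.
  + by apply: bmfD; apply/bmf_norm/bmfB; exact: ufun_bmf.
  move=> w; have /andP[f0 f1] := uf1.2 w; have /andP[G0 G1] := uG1'.2 w.
  have -> : f (Z w) * g (Z w) - G (Z w) * G' (Z w) =
    f (Z w) * (g (Z w) - G' (Z w)) + (f (Z w) - G (Z w)) * G' (Z w) by ring.
  apply: (le_trans (ler_normD _ _)); rewrite addrC !normrM; apply: lerD.
    by rewrite ler_piMr// ger0_norm.
  by rewrite ler_piMl// ger0_norm.
Qed.

Lemma approximable_lim (f_ : nat -> W -> R) f : (forall n, approximable (f_ n)) -> ufun f ->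
  (forall z, f_ n z @[n --> \oo] --> f z) -> approximable f.
Proof.
move=> af_ uf ff; split=> // e e0; have e2 : 0 < e / 2 by lra.
have uf_ n : ufun (f_ n) by have [] := af_ n.
have bf_ n := ufun_bmf (ufun_joint (uf_ n)); have bf := ufun_bmf (ufun_joint uf).
have c : (fun n => L1dist (fun w => f (Z w)) (fun w => f_ n (Z w))) @ \oo --> \int[P]_w (0 : R).
  apply: (pfun_cvg PI).
  - move=> n; split; first by have [] := bmf_norm (bmfB bf (bf_ n)).
    move=> w; rewrite normr_ge0/=; have /andP[? ?] := (uf_ n).2 (Z w).
    by have /andP[? ?] := uf.2 (Z w); rewrite ler_norml; apply/andP; split; lra.
  - by split=> // w; rewrite lexx ler01.
  - move=> w; have -> : 0 = `|f (Z w) - f (Z w)| by rewrite subrr normr0.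
    apply: cvg_norm.
    by apply: cvgB; [exact: cvg_cst|exact: ff].
move: c; rewrite Rintegral_cst// mul0r => /cvgrPdist_le/(_ _ e2)[N _ NP].
have [_ /(_ _ e2)[m [G [uG dG GP]]]] := af_ N.
exists m, G; split=> //.
apply: (le_trans (L1dist_triangle bf (bf_ N) (ufun_bmf (ufun_joint uG)))).
rewrite (splitr e); apply: lerD => //; have := NP N (leqnn N).
by rewrite sub0r normrN; apply: le_trans; exact: ler_norm.
Qed.

Lemma approximable_set (S : set W) : measurable S -> approximable (\1_S).
Proof.
pose H : set (set W) := [set S | measurable S /\ approximable (\1_S)].
suff : @measurable _ W `<=` H by move=> h /h[].
have indC (S' : set W) : \1_(~` S') = (fun z => 1 - \1_S' z) :> (W -> R).
  by apply/funext => z; rewrite !indicE in_setC; case: (_ \in _); rewrite /= ?subrr ?subr0.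
rewrite rect_cyl_gen; apply: smallest_sub.
  split.
  - split=> //; split; first exact: ufun_indic.
    move=> e e0; exists 0%N, (\1_set0); split; first exact: ufun_indic.
      by move=> z z' _ _; rewrite !indicE !in_set0.
    by rewrite /L1dist; under eq_Rintegral do rewrite subrr normr0;
      rewrite Rintegral_cst// mul0r ltW.
  - move=> A [mA aA]; rewrite setTD; split; first exact: measurableC.
    by rewrite indC; exact: approximable_compl.
  - move=> A HA; have mA n : measurable (A n) by have [] := HA n.
    split; first exact: bigcupT_measurable.
    apply: (@approximable_lim (fun n => \1_(\big[setU/set0]_(i < n) A i))).
    + elim=> [|n IH].
        rewrite big_ord0 -setCT indC; apply: approximable_compl.
        split; first exact: ufun_indic.
        move=> e e0; exists 0%N, (\1_setT); split; first exact: ufun_indic.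
          by move=> z z' _ _; rewrite !indicE !in_setT.
        by rewrite /L1dist; under eq_Rintegral do rewrite subrr normr0;
          rewrite Rintegral_cst// mul0r ltW.
      rewrite big_ord_recr/=; set B := \big[setU/set0]_(i < n) A i in IH *.
      have -> : \1_(B `|` A n) = (fun z => 1 - (1 - \1_B z) * (1 - \1_(A n) z)) :> (W -> R).
        apply/funext => z; rewrite !indicE in_setU.
        by case: (z \in B); case: (z \in A n); rewrite /=; lra.
      apply: approximable_compl; apply: approximable_mul; apply: approximable_compl => //.
      by have [] := HA n.
    + by apply: ufun_indic; exact: bigcupT_measurable.
    + move=> z; have [[i _ Aiz]|nA] := pselect ((\bigcup_n A n) z).
        apply: cvg_near_cst; exists i.+1 => // n /= ni; rewrite !indicE !mem_set//.
        - by exists i.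
        - by rewrite -bigcup_mkord; exists i.
      apply: cvg_near_cst; exists 0%N => // n /= _; rewrite !indicE !memNset//.
      by rewrite -bigcup_mkord => -[i _ Aiz]; apply: nA; exists i.
move=> S' rS; have mS := rect_cyl_measurable rS; split=> //.
split; first exact: ufun_indic.
move=> e e0; case: rS mS => l [A [B [mA mB ->]]] mS.
pose m := (\max_(t <- l) `|t|)%N.
exists m, (\1_[set z : W | forall t, t \in l -> A t (z t).1 /\ B t (z t).2]).
split; first exact: ufun_indic.
- move=> z z' e2 e1; rewrite !indicE; congr ((nat_of_bool _)%:R).
  have zz' t : t \in l -> z t = z' t.
    move=> tl; have /e1 : within m t.
      have := leq_bigmax_seq (P := xpredT) (F := fun t : int => `|t|%N) t tl isT; rewrite -/m; lia.
    by have := e2 t; case: (z t) => a1 a2; case: (z' t) => b1 b2 /= -> ->.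
  by apply/idP/idP => /set_mem h; apply/mem_set => t tl; [rewrite -zz'//|rewrite zz'//]; exact: h.
- by rewrite /L1dist; under eq_Rintegral do rewrite subrr normr0;
    rewrite Rintegral_cst// mul0r ltW.
Qed.

(* An invariant event is both in the remote past and determined by a finite
   window, and conditionally on the environment those are nearly independent:
   so it is close to an event of the environment alone. *)
Lemma invariant_env (C : set W) (e : R) : measurable C ->
  (forall k z, C (shiftz k z) <-> C z) -> 0 < e ->
  exists2 l : pathT int F -> R, ufun l &
    L1dist (fun w => \1_C (Z w)) (fun w => l (proc_path X w)) <= 10 * e.
Proof.
move=> mC iC e0.
have uC := ufun_indic (R := R) mC.
have [_ /(_ e e0)[m [G [uG dG fG]]]] := approximable_set mC.
have [N NP] := erase_L1 HVm HVpos Hlam0 Hb0 Hdrift Hminor mY mX sZ gX uG dG e0.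
pose n := (N + m.*2)%N; pose k : int := - n%:Z.
pose U := Tback K m n G.
have uU : ufun U by exact: Tback_ufun.
pose l x := U (ienv E x).
have ul : ufun l.
  split; last by move=> x; exact: uU.2.
  exact: (measurableT_comp uU.1 (@measurable_ienv _ E _ F)).
exists l => //.
pose A (z : W) := G (shiftz k z).
have uA : ufun A.
  split; last by move=> z; exact: uG.2.
  exact: (measurableT_comp uG.1 (@measurable_shiftz _ E _ F k)).
have uf := ufun_joint uC; have uGj := ufun_joint uG; have uAj := ufun_joint uA.
have uUj := ufun_joint uU.
have ulj : ufun (fun w => l (proc_path X w)).
  split; last by move=> w; exact: ul.2.
  exact: (measurableT_comp ul.1 (measurable_proc_path mX)).
have UL : L1dist (fun w => U (Z w)) (fun w => l (proc_path X w)) <= e.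
  by apply: NP; rewrite /n; lia.
have fA : L1dist (fun w => \1_C (Z w)) (fun w => A (Z w)) <= e.
  have := L1dist_shift k (ufun_bmf uC) (ufun_bmf uG); rewrite -/A => h.
  apply: le_trans fG; rewrite -h le_eqVlt; apply/orP; left; apply/eqP.
  congr Rintegral; apply/funext => w; congr `|_ - _|; rewrite !indicE.
  by congr ((nat_of_bool _)%:R); apply/idP/idP => /set_mem h'; apply/mem_set;
    [exact: (iC k _).2 h'|exact: (iC k _).1 h'].
have AGU : \int[P]_w (A (Z w) * G (Z w)) = \int[P]_w (A (Z w) * U (Z w)).
  have bAG : bmf (fun z => A z * G z) by apply: bmfM; exact: ufun_bmf.
  have dAG : dep (fun s : int => s <= m%:Z) (fun z => A z * G z).
    move=> z z' e2 e1; rewrite (dG z z')//; last by move=> s /andP[_]; exact: e1.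
    congr (_ * _); apply: dG => s; rewrite /shiftz ?e2//.
    by move=> h; apply: e1; move: h; rewrite /k /n; lia.
  rewrite (solves_Tback n sol bAG dAG); congr Rintegral; apply/funext => w.
  rewrite Tback_mul//; last exact: ufun_bmf.
  move=> z s y sn; apply: dG => r; rewrite /shiftz /upd; first by case: eqP => [->|].
  case: eqVneq => // rs; move: sn; rewrite -rs /k /n -addnn; lia.
have b_ (f : O -> R) : ufun f -> bmf f by exact: ufun_bmf.
have bD (f g : O -> R) : ufun f -> ufun g -> bmf (fun w => `|f w - g w|).
  by move=> uf' ug'; apply/bmf_norm/bmfB; exact: ufun_bmf.
pose f w := \1_C (Z w) : R; pose L w := l (proc_path X w).
have ff w : f w * f w = f w by rewrite /f indicE; case: (_ \in _); rewrite ?mulr1 ?mulr0.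
(* E|f - L| = E f + E L - 2 E (f L) *)
have E0 : L1dist f L = \int[P]_w f w + \int[P]_w L w - 2 * \int[P]_w (f w * L w).
  have bfL : bmf (fun w => f w * L w) by apply: bmfM; exact: ufun_bmf.
  have EZ : 2 * \int[P]_w (f w * L w) = \int[P]_w (2 * (f w * L w)).
    exact/esym/(pfunZ PI 2 bfL).
  have ED : \int[P]_w f w + \int[P]_w L w = \int[P]_w (f w + L w).
    exact/esym/(pfunD PI (b_ _ uf) (b_ _ ulj)).
  rewrite EZ ED -(pfunB PI (bmfD (b_ _ uf) (b_ _ ulj)) (bmfZ 2 bfL)).
  congr Rintegral; apply/funext => w; have /andP[L0 L1] := ulj.2 w.
  rewrite /f indicE; case: (_ \in _) => /=.
    by rewrite ger0_norm ?subr_ge0// /L; lra.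
  by rewrite sub0r normrN ger0_norm// /L; lra.
have E1 : \int[P]_w L w <= \int[P]_w f w + 2 * e.
  have := L1dist_int (b_ _ uUj) (b_ _ ulj); have := L1dist_int (b_ _ uf) (b_ _ uGj).
  have dG' : dep (fun s : int => s <= m%:Z) G by apply: sub_dep dG => s /andP[].
  have := solves_Tback n sol (ufun_bmf uG) dG'.
  rewrite -/U !ler_norml => -> /andP[? ?] /andP[? ?]; rewrite /f /L; lra.
have prod_dist (h g g' : O -> R) : ufun h -> ufun g -> ufun g' ->
    \int[P]_w (h w * g' w) <= \int[P]_w (h w * g w) + L1dist g g'.
  move=> uh ug ug'; rewrite /L1dist -(pfunD PI); last 2 first.
  - by apply: bmfM; exact: ufun_bmf.
  - exact: bD.
  apply: (pfun_le PI); first by apply: bmfM; exact: ufun_bmf.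
    by apply: bmfD; [apply: bmfM; exact: ufun_bmf|exact: bD].
  move=> w; have /andP[h0 h1] := uh.2 w.
  have : h w * (g' w - g w) <= `|g w - g' w|.
    rewrite distrC; apply: le_trans (ler_norm _) _.
    by rewrite normrM ger0_norm// ler_piMl.
  by lra.
have C1 : \int[P]_w f w <= \int[P]_w (f w * G (Z w)) + e.
  have -> : \int[P]_w f w = \int[P]_w (f w * f w) by congr Rintegral; apply/funext.
  by apply: le_trans (prod_dist _ _ _ uf uGj uf) _; rewrite lerD2l L1dist_sym.
have swap (g h : O -> R) : \int[P]_w (g w * h w) = \int[P]_w (h w * g w).
  by congr Rintegral; apply/funext => w; rewrite mulrC.
have C2 : \int[P]_w (f w * G (Z w)) <= \int[P]_w (A (Z w) * G (Z w)) + e.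
  rewrite swap [X in _ <= X + _]swap.
  by apply: le_trans (prod_dist _ _ _ uGj uAj uf) _; rewrite lerD2l L1dist_sym.
have C3 : \int[P]_w (A (Z w) * U (Z w)) <= \int[P]_w (A (Z w) * L w) + e.
  by apply: le_trans (prod_dist _ _ _ uAj ulj uUj) _; rewrite lerD2l L1dist_sym.
have C4 : \int[P]_w (A (Z w) * L w) <= \int[P]_w (f w * L w) + e.
  rewrite swap [X in _ <= X + _]swap.
  by apply: le_trans (prod_dist _ _ _ ulj uf uAj) _; rewrite lerD2l.
change (L1dist f L <= 10 * e); rewrite E0; lra.
Qed.

End Ergodicity.

Section ErgodicityTransfer.
Context {R : realType} dE (E : measurableType dE) dF (F : measurableType dF)
  (K : R.-pker (F * E) ~> E) (V : E -> R) (lam b : F -> R) (eta : R -> F -> R).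
Notation W := (pathT int (E * F)%type).

Hypotheses (HVm : measurable_fun setT V) (HVpos : forall y, 0 < V y)
  (Hlam0 : forall x, 0 <= lam x) (Hb0 : forall x, 0 <= b x)
  (Hdrift : forall x y, (\int[K (x, y)]_z (V z)%:E <= (lam x * V y + b x)%:E)%E)
  (Hminor : forall r : R, 0 < r -> exists nu : R.-pker F ~> E,
     forall x y A, V y <= r -> measurable A ->
       ((eta r x)%:E * nu x A <= K (x, y) A)%E).

Context d (O : measurableType d) (P : probability O R)
  (Y : int -> O -> E) (X : int -> O -> F).
Hypotheses (mY : measurable_process Y) (mX : measurable_process X)
  (sZ : stationary P (fun t w => (Y t w, X t w)))
  (gX : {ae P, forall w, good_env lam b eta (proc_path X w)})
  (sol : solves K P Y X).
Notation Z := (joint Y X).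

Let PI := pfunctional_int (probability_setT P).

Let Delta (C : set W) (D : set (pathT int F)) : set W := [set z | ~ (C z <-> D (env z))].

Let measurable_Delta C D : measurable C -> measurable D -> measurable (Delta C D).
Proof.
move=> mC mD.
have menv : measurable_fun setT (fun z : W => env z : pathT int F).
  apply: measurable_path => t.
  exact: (measurableT_comp measurable_snd (measurable_coord (T := (E * F)%type) t)).
have mD' : measurable [set z : W | D (env z)] by have := menv measurableT D mD; rewrite setTI.
have -> : Delta C D = (C `&` ~` [set z : W | D (env z)]) `|` (~` C `&` [set z : W | D (env z)]).
  apply/seteqP; split=> z /=; rewrite /Delta /=; last by tauto.
  by have [] := pselect (C z); have [] := pselect (D (env z)); tauto.
by apply: measurableU; apply: measurableI => //; exact: measurableC.
Qed.

Lemma invariant_env_set (C : set W) (e : R) : measurable C ->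
  (forall k z, C (shiftz k z) <-> C z) -> 0 < e ->
  exists2 D : set (pathT int F), measurable D &
    (P [set w | Delta C D (Z w)] <= e%:E)%E.
Proof.
move=> mC iC e0; have e20 : 0 < e / 20 by lra.
have [l ul lP] := invariant_env HVm HVpos Hlam0 Hb0 Hdrift Hminor mY mX sZ gX sol mC iC e20.
pose D : set (pathT int F) := [set x | 2^-1 < l x].
have mD : measurable D by apply: measurable_gt; have [] := ul.
exists D => //; have mDe := measurable_joint_set mY mX (measurable_Delta mC mD).
rewrite (measure_Rintegral (probability_setT P))// lee_fin.
have uC := ufun_joint mY mX (ufun_indic (R := R) mC).
have ulX : ufun (fun w => l (proc_path X w)).
  split; last by move=> w; exact: ul.2.
  exact: (measurableT_comp ul.1 (measurable_proc_path mX)).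
have bf : bmf (fun w => `|\1_C (Z w) - l (proc_path X w)|).
  by apply/bmf_norm/bmfB; exact: ufun_bmf.
apply: (@le_trans _ _
  (2 * L1dist P (fun w => \1_C (Z w)) (fun w => l (proc_path X w)))); last by lra.
rewrite /L1dist.
have -> : 2 * \int[P]_w `|\1_C (Z w) - l (proc_path X w)| =
  \int[P]_w (2 * `|\1_C (Z w) - l (proc_path X w)|) by exact/esym/(pfunZ PI 2 bf).
apply: (pfun_le PI).
- by apply/ufun_bmf/ufun_indic.
- exact: bmfZ.
move=> w; have /andP[l0 l1] := ulX.2 w; rewrite !indicE.
have [/set_mem h|_] := boolP (w \in _); last by rewrite mulr_ge0.
move: h; rewrite /Delta /D /= => h.
have lE : l (env (Z w)) = l (proc_path X w) by [].
have [Cw|Cw] := boolP (Z w \in C) => /=.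
  rewrite ger0_norm ?subr_ge0//.
  have [lw|lw] := leP (l (proc_path X w)) 2^-1; first by lra.
  by exfalso; apply: h; rewrite lE; split=> _ //; exact/set_mem.
rewrite sub0r normrN ger0_norm//.
have [lw|lw] := leP (l (proc_path X w)) 2^-1; last by lra.
exfalso; apply: h; rewrite lE; split=> [h|]; last by rewrite ltNge lw.
by move/negP: Cw; case; exact/mem_set.
Qed.

Lemma invariant_env_ae (C : set W) : measurable C ->
  (forall k z, C (shiftz k z) <-> C z) ->
  exists2 D : set (pathT int F), measurable D & {ae P, forall w, C (Z w) <-> D (env (Z w))}.
Proof.
move=> mC iC.
have H n : exists D : set (pathT int F), measurable D /\
    (P [set w | Delta C D (Z w)] <= (1 / (2 ^ n.+1)%:R)%:E)%E.
  have e0 : 0 < 1 / (2 ^ n.+1)%:R :> R by rewrite divr_gt0// ltr0n expn_gt0.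
  by have [D mD DP] := invariant_env_set mC iC e0; exists D.
have [D DP] := choice H.
have mD n : measurable (D n) by have [] := DP n.
have mDel n := measurable_joint_set mY mX (measurable_Delta mC (mD n)).
exists (lim_sup_set D).
  by apply: bigcapT_measurable => n; apply: bigcup_measurable => j _; exact: mD.
have mL : measurable (lim_sup_set (fun n => [set w | Delta C (D n) (Z w)])).
  by apply: bigcapT_measurable => n; apply: bigcup_measurable => j _; exact: mDel.
have nL : P.-negligible (lim_sup_set (fun n => [set w | Delta C (D n) (Z w)])).
  apply/negligibleP => //; apply: lim_sup_set_cvg0 => //.
  apply: (@le_lt_trans _ _ 1%:E); last by rewrite ltry.
  apply: le_trans (epsilon_trick0 xpredT ler01).
  by apply: lee_nneseries => [n _ _|n _]; [exact: measure_ge0|exact: (DP n).2].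
apply: negligibleS nL => w /= nCD N _.
apply: contrapT => /forall2NP nj; apply: nCD.
have CD n : (N <= n)%N -> (C (Z w) <-> D n (env (Z w))).
  by move=> Nn; apply: contrapT => h; have [] := nj n.
split=> [Cw M _|/(_ N I)[n Nn Dn]]; last by apply/(CD n).
by exists (maxn M N); [exact: leq_maxl|apply/(CD _ (leq_maxr M N))].
Qed.

Lemma markov_ergodic d0 (O0 : measurableType d0) (P0 : probability O0 R) (X0 : int -> O0 -> F) :
  measurable_process X0 -> same_law P X P0 X0 -> ergodic P0 X0 ->
  ergodic P (fun t w => (Y t w, X t w)).
Proof.
move=> mX0 X00 erg C mC iC.
have iC1 z : C (shiftz 1 z) <-> C z.
  by rewrite -[X in _ <-> X z]iC.
have iCn n z : C (shiftz n%:Z z) <-> C z.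
  elim: n z => [|n IH] z.
    by rewrite (_ : shiftz 0 z = z)//; apply/funext => t; rewrite /shiftz addr0.
  have -> : shiftz n.+1%:Z z = shiftz 1 (shiftz n%:Z z).
    by apply/funext => t; rewrite /shiftz; congr z; lia.
  exact: iff_trans (iC1 _) (IH z).
have iCk k z : C (shiftz k z) <-> C z.
  have [k0|k0] := leP 0 k.
    by have := iCn `|k|%N z; have -> : `|k|%N%:Z = k by lia.
  have := iCn `|k|%N (shiftz k z); rewrite (_ : shiftz _ (shiftz _ _) = z).
    by move=> ->.
  by apply/funext => t; rewrite /shiftz; congr z; lia.
have mC' : measurable (C : set W) by [].
have [D mD aD] := invariant_env_ae mC' iCk.
pose D' : set (pathT int F) := 
  [set x | forall N : nat, exists n : nat, (N <= n)%N /\ D (shiftz n%:Z x)].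
have mD' : measurable D'.
  apply: (@measurable_forall _ (pathT int F)) => N.
  apply: (@measurable_exists _ (pathT int F)) => n.
  have [Nn|Nn] := boolP (N <= n)%N.
    have := measurable_shift_set n%:Z mD; congr measurable.
    by apply/seteqP; split=> x // [].
  by rewrite (_ : [set x | _] = set0)//; apply/seteqP; split=> x // [].
have aD' : {ae P, forall w, C (Z w) <-> D' (proc_path X w)}.
  pose ZZ (t : int) (w : O) := (Y t w, X t w).
  have mZZ : measurable_process ZZ by move=> t; exact: measurable_fun_pair.
  pose S : set W := ~` Delta C D.
  have mS : measurable S by apply: measurableC; exact: (measurable_Delta mC' mD).
  have aS : {ae P, forall w, S (proc_path ZZ w)}.
    by apply: filterS aD => w h; rewrite /S /Delta /= => nh; exact: nh h.
  have aSn : {ae P, forall w, forall n : nat, S (shiftz n%:Z (proc_path ZZ w))}.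
    by apply: ae_foralln => n; exact: (ae_shift mZZ sZ n%:Z mS aS).
  apply: filterS aSn => w h.
  have CD n : C (Z w) <-> D (shiftz n%:Z (proc_path X w)).
    have /contrapT := h n; rewrite -(iCk n%:Z (Z w)); exact.
  split=> [Cw N|/(_ 0%N)[n [_ Dn]]]; last by apply/(CD n).
  by exists N; split=> //; apply/(CD N).
have iD' : (@path_shift F) @^-1` D' = D'.
  have sh n (x : int -> F) : shiftz n%:Z (path_shift x) = shiftz n.+1%:Z x.
    by apply/funext => t; rewrite /shiftz /path_shift; congr x; lia.
  apply/seteqP; split=> x /= h N.
    by have [n [Nn Dn]] := h N; exists n.+1; rewrite -sh; split=> //; lia.
  have [[|n] [Nn Dn]] := h N.+1; first by lia.
  by exists n; rewrite sh; split=> //; lia.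
have PC : P [set w | C (Z w)] = P0 [set w | D' (proc_path X0 w)].
  rewrite -(same_law_path mX mX0 X00 mD').
  have mCw := measurable_joint_set mY mX mC'.
  have mDw := measurable_proc_set mX mD'.
  rewrite (measure_Rintegral (probability_setT P) mCw).
  rewrite (measure_Rintegral (probability_setT P) mDw); congr EFin.
  apply: ae_eq_Rintegral; try by apply/ufun_bmf/ufun_indic.
  apply: filterS aD' => w CD; rewrite !indicE; congr ((nat_of_bool _)%:R).
  by apply/idP/idP => /set_mem h; apply/mem_set; apply/CD.
change (P [set w | C (Z w)] = 0%E \/ P [set w | C (Z w)] = 1%E).
rewrite PC; exact: erg mD' iD'.
Qed.

End ErgodicityTransfer.

(** * Coding by bits *)

Section PolishCode.
Context {R : realType} d (T : measurableType d).

Lemma polish_code : polish_borel R T ->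
  exists (enc : T -> nat -> bool) (dec : pathT nat bool -> T),
  [/\ forall k, measurable [set y | enc y k], measurable_fun setT dec &
      forall y, dec (enc y) = y].
Proof.
move=> [dist [d0 [dC [dtri [dcomp [[D [cD dense]] mT]]]]]].
pose r (k : nat) : R := k.+1%:R^-1.
have r0 k : 0 < r k by rewrite invr_gt0.
have half (e : R) : 0 < e -> 0 < e / 2 by move=> e0; lra.
have rsmall (e : R) : 0 < e -> exists k, r k < e.
  move=> e0; exists (Num.trunc e^-1).
  by rewrite /r -[X in _ < X]invrK ltf_pV2 ?posrE ?invr_gt0// truncnS_gt.
have /countable_injP[f finj] := cD.
pose dd j : T := get [set y | D y /\ f y = j].
have ddE z : D z -> dd (f z) = z.
  move=> Dz; have [Dg fg] : [set y | D y /\ f y = f z] (dd (f z)).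
    by apply: getPex; exists z.
  by apply: finj => //; exact/mem_set.
pose enc y n := if unpickle n is Some p then dist (dd p.1) y < r p.2 else false.
have encE y (j k : nat) : enc y (pickle (j, k)) = (dist (dd j) y < r k) by rewrite /enc pickleK.
pose ex (c : nat -> bool) (k : nat) := exists j : nat, c (pickle (j, k)).
pose J k (c : pathT nat bool) : nat :=
  if pselect (ex c k) is left h then ex_minn h else 0%N.
pose Q c := [set l | forall k, dist (dd (J k c)) l <= r k].
pose dec (c : pathT nat bool) : T := get (Q c).
have Quniq c l l' : Q c l -> Q c l' -> l = l'.
  move=> Ql Ql'; apply/d0/eqP; rewrite eq_le; apply/andP; split; last first.
    have := dtri l l' l; rewrite (dC l' l) (d0 l l).2//; lra.
  apply/ler_addgt0Pl => e e0; have [k rk] := rsmall (e / 2) (half _ e0).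
  have := Ql k; have := Ql' k; have := dtri l (dd (J k c)) l'; rewrite (dC l (dd _)).
  lra.
have dist_ge0 x y : 0 <= dist x y.
  by have := dtri x y x; rewrite (dC y x) (d0 x x).2//; lra.
have Jenc y k : dist (dd (J k (enc y))) y < r k.
  rewrite /J; case: pselect => [h|[]].
    by case: ex_minnP => j; rewrite encE.
  have [z Dz zy] := dense y (r k) (r0 k).
  by exists (f z); rewrite encE ddE// dC.
have decE y : dec (enc y) = y.
  apply: (Quniq (enc y)); last by move=> k; exact/ltW/Jenc.
  by apply: getPex; exists y => k; exact/ltW/Jenc.
have mopen U : metric_open dist U -> measurable U by rewrite mT; exact: sub_sigma_algebra.
exists enc, dec; split=> //.
  move=> n; rewrite /enc; case: unpickle => [[j k]|] /=; last first.
    by rewrite (_ : [set y | _] = set0)//; apply/seteqP; split.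
  apply: mopen => y /= yk; exists (r k - dist (dd j) y); first by rewrite subr_gt0.
  by move=> y' yy'; have := dtri (dd j) y y'; lra.
have mbit n : measurable [set c : pathT nat bool | c n].
  by have := measurable_coord (T := bool) n measurableT (Y := [set true]) I; rewrite setTI.
have mnbit n : measurable [set c : pathT nat bool | ~ c n].
  by have := measurableC (mbit n).
have mJ1 k j : measurable [set c | J k c = j].
  have -> : [set c | J k c = j] =
    [set c : pathT nat bool | c (pickle (j, k)) /\ forall i, (i < j)%N -> ~ c (pickle (i, k))] `|`
    ([set c : pathT nat bool | forall i : nat, ~ c (pickle (i, k))] `&` [set c | j = 0%N]).
    apply/seteqP; split=> c /=; rewrite /J; case: pselect => [h|h].
    - case: ex_minnP => i ci mi <-; left; split=> // i' i'i ci'.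
      by have := mi _ ci'; rewrite leqNgt i'i.
    - by move=> <-; right; split=> // i ci; apply: h; exists i.
    - case: ex_minnP => i ci mi [[cj jmin]|[nc _]]; last by have := nc i ci.
      have := mi _ cj; rewrite leq_eqVlt => /orP[/eqP //|ij]; by have := jmin _ ij ci.
    - by move=> [[cj _]|[_ ->]//]; exfalso; apply: h; exists j.
  apply: measurableU.
    apply: (measurableI _ _ (mbit _)).
    apply: (@measurable_forall _ (pathT nat bool) nat
      (fun i c => (i < j)%N -> ~ c (pickle (i, k)))) => i.
    by apply: measurable_imply; exact: mnbit.
  apply: measurableI.
    by apply: (@measurable_forall _ (pathT nat bool) nat (fun i c => ~ c (pickle (i, k)))) => i.
  have [->|j0] := eqVneq j 0%N.
    by rewrite (_ : [set c | _] = setT)//; apply/seteqP; split.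
  rewrite (_ : [set c | _] = set0)//; apply/seteqP; split=> c //= /eqP; by rewrite (negbTE j0).
have mJ k (A : nat -> Prop) : measurable [set c | A (J k c)].
  have -> : [set c | A (J k c)] = [set c | exists j, A j /\ J k c = j].
    by apply/seteqP; split=> c /=; [exists (J k c)|move=> [j [Aj ->]]].
  apply: (@measurable_exists _ (pathT nat bool)) => j.
  have [Aj|nAj] := pselect (A j).
    by have := mJ1 k j; congr measurable; apply/seteqP; split=> c //= [].
  by rewrite (_ : [set c | _] = set0)//; apply/seteqP; split=> c //= [].
pose Conv := [set c | forall k k', dist (dd (J k c)) (dd (J k' c)) <= r k + r k'].
have mConv : measurable Conv.
  apply: (@measurable_forall _ (pathT nat bool)) => k.
  apply: (@measurable_forall _ (pathT nat bool)) => k'.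
  have -> : [set c | dist (dd (J k c)) (dd (J k' c)) <= r k + r k'] =
    [set c | exists j, J k c = j /\ dist (dd j) (dd (J k' c)) <= r k + r k'].
    by apply/seteqP; split=> c /=; [exists (J k c)|move=> [j [->]]].
  apply: (@measurable_exists _ (pathT nat bool)) => j.
  apply: measurableI; first exact: mJ1.
  exact: (mJ k' (fun i => dist (dd j) (dd i) <= r k + r k')).
have ConvP c : Conv c <-> Q c !=set0.
  split=> [cc|[l Ql] k k']; last first.
    by have := dtri (dd (J k c)) l (dd (J k' c)); rewrite (dC l (dd _));
      have := Ql k; have := Ql k'; lra.
  have [e e0|l lP] := dcomp (fun k => dd (J k c)).
    have [k rk] := rsmall (e / 2) (half _ e0); exists k => m n km kn.
    have rr i : (k <= i)%N -> r i <= r k by move=> ki; rewrite lef_pV2 ?posrE// ler_nat.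
    by have := cc m n; have := rr m km; have := rr n kn; lra.
  exists l => k; apply/ler_addgt0Pl => e e0.
  have [N NP] := lP (e / 2) (half _ e0); have [k' rk'] := rsmall (e / 2) (half _ e0).
  pose n := maxn N k'.
  have := NP n (leq_maxl _ _); have := dtri (dd (J k c)) (dd (J n c)) l; have := cc k n.
  have : r n <= r k' by rewrite lef_pV2 ?posrE// ler_nat ltnS leq_maxr.
  lra.
have decQ c : Conv c -> Q c (dec c) by move=> /ConvP[l Ql]; apply: getPex; exists l.
have decN c : ~ Conv c -> dec c = point.
  by move=> nc; apply: getPN => l Ql; apply: nc; apply/ConvP; exists l.
apply: (@measurability _ _ (pathT nat bool) T setT dec (metric_open dist)) => //.
move=> _ [U oU <-]; rewrite setTI.
have -> : dec @^-1` U = (Conv `&` [set c | exists k, forall l, dist (dd (J k c)) l <= r k -> U l])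
   `|` (~` Conv `&` [set c | U point]).
  apply/seteqP; split=> c /=.
    have [cc Uc|nc] := pselect (Conv c); last by rewrite decN//; right.
    left; split=> //; have [e e0 eP] := oU _ Uc.
    have [k rk] := rsmall (e / 2) (half _ e0); exists k => l kl; apply: eP.
    have := dtri (dec c) (dd (J k c)) l; rewrite (dC (dec c) (dd _)); have := decQ c cc k; lra.
  by move=> [[cc [k kP]]|[nc Up]]; [apply: kP; exact: decQ|rewrite decN].
apply: measurableU; apply: measurableI => //.
- apply: (@measurable_exists _ (pathT nat bool)) => k.
  exact: (mJ k (fun j => forall l, dist (dd j) l <= r k -> U l)).
- exact: measurableC.
- have [Up|nUp] := pselect (U point).
    by rewrite (_ : [set c | _] = setT)//; apply/seteqP; split.
  by rewrite (_ : [set c | _] = set0)//; apply/seteqP; split.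
Qed.

End PolishCode.

Section UniformMeasure.
Context {R : realType}.

Definition unif01 : set (measurableTypeR R) -> \bar R :=
  mrestr (@lebesgue_measure R) (measurable_itv `[0%R, 1%R[).

HB.instance Definition _ := Measure.copy unif01
  (mrestr (@lebesgue_measure R) (measurable_itv `[0%R, 1%R[)).

Let unif01_setT : unif01 setT = 1%E.
Proof.
rewrite /unif01 /mrestr setTI lebesgue_measure_itv/= lte_fin ltr01.
by rewrite -EFinD subr0.
Qed.

HB.instance Definition _ := @Measure_isProbability.Build _ _ R unif01 unif01_setT.

Lemma unif01_itv (a c : R) : 0 <= a -> 0 <= c -> a + c <= 1 ->
  unif01 `[a, (a + c)[%classic = c%:E.
Proof.
move=> a0 c0 ac1; rewrite /unif01 /mrestr setIidl; last first.
  move=> x /=; rewrite !in_itv/= => /andP[ax xac]; apply/andP; split.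
    exact: le_trans ax.
  exact: lt_le_trans ac1.
rewrite lebesgue_measure_itv/= lte_fin; case: ifPn => [_|].
  by rewrite -EFinD addrC addKr.
rewrite -leNgt => h; congr EFin; apply/eqP; rewrite eq_le c0/=.
by move: h; rewrite gerDl.
Qed.

Lemma unif01_supp (A B : set (measurableTypeR R)) : measurable A -> measurable B ->
  (forall x, 0 <= x < 1 -> (A x <-> B x)) -> unif01 A = unif01 B.
Proof.
move=> mA mB AB; rewrite /unif01 /mrestr; congr (lebesgue_measure _).
apply/seteqP; split=> x /= [Ax]; rewrite in_itv/= => x01; split=> //;
  by apply/(AB _ x01).
Qed.

End UniformMeasure.

(* A point of [0, 1[ is coded by the nested intervals containing it, the
   interval attached to a word [s] having length [q s]. *)
Section Subdivision.
Context {R : realType}.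
Implicit Types (q : seq bool -> R) (s : seq bool) (u : R).

Definition lft q s : R :=
  \sum_(i < size s) (if nth false s i then q (rcons (take i s) false) else 0).

Fixpoint word q u (n : nat) : seq bool :=
  if n is m.+1 then
    let s := word q u m in rcons s (lft q s + q (rcons s false) <= u)
  else [::].

Definition bit q u (n : nat) : bool :=
  lft q (word q u n) + q (rcons (word q u n) false) <= u.

Lemma size_word q u n : size (word q u n) = n.
Proof. by elim: n => //= n IH; rewrite size_rcons IH. Qed.

Lemma wordE q u n : word q u n = mkseq (bit q u) n.
Proof.
elim: n => //= n IH; rewrite -/(bit q u n) IH.
by rewrite /mkseq -[in RHS]addn1 iotaD map_cat cats1.
Qed.

Lemma lft_rcons q s (c : bool) :
  lft q (rcons s c) = lft q s + (if c then q (rcons s false) else 0).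
Proof.
rewrite /lft size_rcons big_ord_recr/= nth_rcons ltnn eqxx -cats1 take_size_cat//.
congr (_ + _); apply: eq_bigr => i _.
by rewrite nth_cat ltn_ord takel_cat// ltnW.
Qed.

Variable q : seq bool -> R.
Hypotheses (q0 : forall s, 0 <= q s) (q1 : q [::] = 1)
  (qD : forall s, q s = q (rcons s false) + q (rcons s true)).

Lemma lft_bounds s : 0 <= lft q s /\ lft q s + q s <= 1.
Proof.
elim/last_ind: s => [|s c [IH0 IH1]]; first by rewrite /lft big_ord0 q1 add0r.
rewrite lft_rcons; have f0 := q0 (rcons s false); have t0 := q0 (rcons s true).
have D := qD s; case: c; split; lra.
Qed.

Lemma wordP u n s : 0 <= u < 1 -> size s = n ->
  (word q u n = s <-> lft q s <= u < lft q s + q s).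
Proof.
move=> u01; elim: n s => [|n IH] s.
  by move=> /size0nil ->; rewrite /lft big_ord0 q1 add0r u01.
elim/last_ind: s => [//|s c _]; rewrite size_rcons => -[sn].
rewrite /= lft_rcons; have f0 := q0 (rcons s false); have t0 := q0 (rcons s true).
have D := qD s; split.
  move=> /rcons_inj[ws]; rewrite ws; have := (IH s sn).1 ws => /andP[h1 h2] <-.
  case: (boolP (lft q s + q (rcons s false) <= u)) => h /=.
    by rewrite h/= -addrA -D.
  by rewrite addr0 h1/= ltNge.
move=> h; have ws : word q u n = s.
  by apply/IH => //; move: h; case: c => /= /andP[? ?]; apply/andP; split; lra.
rewrite ws; congr rcons; move: h; case: c => /= /andP[h1 h2]; first by rewrite h1.
by apply/negbTE; rewrite -ltNge; lra.
Qed.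

End Subdivision.

Section SubdivisionMeasurable.
Context {R : realType} d (O : measurableType d).
Variable q : O -> seq bool -> R.
Hypothesis mq : forall s, measurable_fun setT (q ^~ s).

Lemma measurable_lft s : measurable_fun setT (fun w => lft (q w) s).
Proof. by apply: measurable_sum => i; case: (nth _ _ _). Qed.

Lemma measurable_word n s : measurable [set p : O * measurableTypeR R | word (q p.1) p.2 n = s].
Proof.
elim: n s => [|n IH] s.
  have [<-|ns] := eqVneq [::] s.
    by rewrite (_ : [set p | _] = setT)//; apply/seteqP; split.
  rewrite (_ : [set p | _] = set0)//; apply/seteqP; split=> p //= /eqP.
  by rewrite (negbTE ns).
have mB s' : measurable
      [set p : O * measurableTypeR R | lft (q p.1) s' + q p.1 (rcons s' false) <= p.2].
  have mf : measurable_fun setT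
      (fun p : O * measurableTypeR R => p.2 - (lft (q p.1) s' + q p.1 (rcons s' false))).
    apply: measurable_funB; first exact: measurable_snd.
    apply: measurable_funD; first exact: (measurableT_comp (measurable_lft s') measurable_fst).
    exact: (measurableT_comp (mq (rcons s' false)) measurable_fst).
  have := measurable_ge 0 mf; congr measurable.
  by apply/seteqP; split=> p /=; rewrite subr_ge0.
elim/last_ind: s => [|s c _].
  rewrite (_ : [set p | _] = set0)//; apply/seteqP; split=> p //= /(congr1 size).
  by rewrite size_rcons.
have -> : [set p : O * measurableTypeR R | word (q p.1) p.2 n.+1 = rcons s c] =
    [set p | word (q p.1) p.2 n = s] `&`
    (if c then [set p | lft (q p.1) s + q p.1 (rcons s false) <= p.2]
     else ~` [set p | lft (q p.1) s + q p.1 (rcons s false) <= p.2]).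
  apply/seteqP; split=> p /=.
    by move=> /rcons_inj[ws]; rewrite ws => <-; split=> //; case: leP => //= h;
      apply/negP; rewrite -ltNge.
  move=> [ws]; rewrite ws; case: c => /=; first by move=> ->.
  by move=> /negP/negbTE ->.
by apply: measurableI => //; case: c => //; exact: measurableC.
Qed.

Lemma measurable_bit n : measurable_fun setT (fun p : O * measurableTypeR R => bit (q p.1) p.2 n).
Proof.
have mb : measurable [set p : O * measurableTypeR R | bit (q p.1) p.2 n].
  have -> : [set p : O * measurableTypeR R | bit (q p.1) p.2 n] =
     [set p | exists s, word (q p.1) p.2 n.+1 = rcons s true].
    apply/seteqP; split=> p /=; rewrite -/(bit _ _ _).
      by move=> ->; exists (word (q p.1) p.2 n).
    by move=> [s /rcons_inj[_ ->]].
  by apply: (@measurable_exists _ (O * measurableTypeR R)%type) => s; exact: measurable_word.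
apply: (measurable_fun_bool true).
by rewrite setTI; exact: mb.
Qed.

End SubdivisionMeasurable.

Lemma real_cauchy_cvg {R : realType} (u : nat -> R) :
  (forall e : R, 0 < e -> exists N, forall n n', (N <= n)%N -> (N <= n')%N -> `|u n - u n'| <= e) ->
  cvgn u.
Proof.
move=> uC; apply: cauchy_cvg; apply: cauchy_exP => e e0.
have e2 : 0 < e / 2 by lra.
have [N NP] := uC _ e2; exists (u N); exists N => // n /= Nn.
rewrite /ball/=; apply: le_lt_trans (NP N n (leqnn N) Nn) _; lra.
Qed.

Lemma pfunctional_eval {R : realType} d (T : measurableType d) (z : T) :
  pfunctional (fun H : T -> R => H z).
Proof. by split=> //. Qed.

Lemma bmf_affine {R : realType} d (T : measurableType d) (H : T -> R) : bmf H ->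
  exists (D C : R), 0 < D /\ ufun (fun z => D^-1 * (H z + C)).
Proof.
move=> [mH [C HC]].
have C0 : 0 <= C by apply: le_trans (HC point).
have D0 : 0 < C + C + 1 by lra.
exists (C + C + 1), C; split=> //; split.
  by apply: measurable_funM => //; exact: measurable_funD.
move=> z; have := HC z; rewrite ler_norml => /andP[? ?].
by rewrite mulrC ler_pdivrMr// divr_ge0/=; lra.
Qed.

(** * Existence *)

Section Limit.
Context {R : realType} dE (E : measurableType dE) dF (F : measurableType dF)
  (K : R.-pker (F * E) ~> E) (V : E -> R) (lam b : F -> R) (eta : R -> F -> R).
Notation W := (pathT int (E * F)%type).
Notation within m := (fun s : int => (- (m%:Z) <= s) && (s <= m%:Z)).

Hypotheses (HVm : measurable_fun setT V) (HVpos : forall y, 0 < V y)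
  (Hlamm : measurable_fun setT lam) (Hlam0 : forall x, 0 <= lam x)
  (Hbm : measurable_fun setT b) (Hb0 : forall x, 0 <= b x)
  (Hdrift : forall x y, (\int[K (x, y)]_z (V z)%:E <= (lam x * V y + b x)%:E)%E)
  (Hetam : measurable_fun ([set r : R | 0 < r] `*` [set: F]) (fun p : R * F => eta p.1 p.2))
  (Hminor : forall r : R, 0 < r -> exists nu : R.-pker F ~> E,
     forall x y A, V y <= r -> measurable A ->
       ((eta r x)%:E * nu x A <= K (x, y) A)%E).

Notation good := (good_env lam b eta).

Definition Tn n (H : W -> R) := Tback K n%:Z n.*2 H.

Lemma Tn_Tback m n (H : W -> R) : (m <= n)%N -> dep (within m) H ->
  Tn n H = Tback K m (n + m) H.
Proof.
move=> mn dH; rewrite /Tn; have -> : n.*2 = ((n + m) + (n - m))%N by rewrite -addnn; lia.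
rewrite Tback_add; have -> : n%:Z - (n - m)%N%:Z = m by lia.
congr Tback; apply: Tback_id => z s e sn.
by apply: (upd_dep z e dH); lia.
Qed.

Lemma Tn_pfunctional n z : pfunctional (fun H => Tn n H z).
Proof. exact: (pfunctional_Tback K n n.*2 (pfunctional_eval z)). Qed.

Lemma Tn_cauchy m (x : pathT int F) (e : R) : good x -> 0 < e ->
  exists N, forall n n', (N <= n)%N -> (N <= n')%N ->
  forall H : W -> R, ufun H -> dep (within m) H ->
  `|Tn n H (ienv E x) - Tn n' H (ienv E x)| <= e.
Proof.
move=> gx e0.
have [N NP] := Tback_forgets HVm HVpos Hlam0 Hb0 Hdrift Hminor m (z := ienv E x) (V point) gx e0.
exists (maxn N m) => n n' Nn Nn' H uH dH; rewrite !(@Tn_Tback m)//; try lia.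
by apply: NP => //; lia.
Qed.

(* Zero outside the good environments, where the limit may fail to exist. *)
Definition pl (H : W -> R) (x : pathT int F) : R :=
  limn (fun n => \1_good x * Tn n H (ienv E x)).

Lemma pl_cvg_ufun m (H : W -> R) x : good x -> ufun H -> dep (within m) H ->
  Tn n H (ienv E x) @[n --> \oo] --> pl H x.
Proof.
move=> gx uH dH; rewrite /pl indicE mem_set//=; under [X in limn X]eq_fun do rewrite mul1r.
apply: real_cauchy_cvg => e e0; have [N NP] := Tn_cauchy m gx e0.
by exists N => n n' Nn Nn'; apply: NP.
Qed.

Lemma pl_cvg m (H : W -> R) x : good x -> bmf H -> dep (within m) H ->
  Tn n H (ienv E x) @[n --> \oo] --> pl H x.
Proof.
move=> gx bH dH; have [D [C [D0 uG]]] := bmf_affine bH.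
pose G (z : W) := D^-1 * (H z + C); have {}uG : ufun G := uG.
have dG : dep (within m) G by move=> z z' e2 e1; rewrite /G (dH z z').
have c := pl_cvg_ufun gx uG dG.
have TE n : Tn n H (ienv E x) = D * Tn n G (ienv E x) - C.
  have PT := Tn_pfunctional n (ienv E x).
  have T1 : Tn n (fun=> 1) (ienv E x) = 1 by rewrite /Tn Tback_id.
  have bG := ufun_bmf uG.
  rewrite -[C]mulr1 -T1 -(pfun_cst PT) -(pfunZ PT D bG) -(pfunB PT); last exact: bmf_cst.
    congr (Tn n _ _); apply/funext => z; rewrite /G mulrA divff ?gt_eqF// mul1r.
    by rewrite addrK.
  exact: bmfZ.
rewrite /pl indicE mem_set//=; under [X in limn X]eq_fun do rewrite mul1r.
rewrite (funext TE); apply/cvg_ex; exists (D * pl G x - C).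
apply: cvgB; last exact: cvg_cst.
by apply: cvgM; [exact: cvg_cst|exact: c].
Qed.

Lemma pl_bad (H : W -> R) x : ~ good x -> pl H x = 0.
Proof.
move=> bx; rewrite /pl indicE memNset//=; under [X in limn X]eq_fun do rewrite mul0r.
exact: (cvg_lim _ (cvg_cst _)).
Qed.

Lemma pl_unif m x (e : R) : good x -> 0 < e -> exists N, forall n, (N <= n)%N ->
  forall H : W -> R, ufun H -> dep (within m) H -> `|Tn n H (ienv E x) - pl H x| <= e.
Proof.
move=> gx e0; have [N NP] := Tn_cauchy m gx e0; exists N => n Nn H uH dH.
have c := pl_cvg_ufun gx uH dH.
have c' : `|Tn n H (ienv E x) - Tn n' H (ienv E x)| @[n' --> \oo] -->
    `|Tn n H (ienv E x) - pl H x|.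
  by apply: cvg_norm; apply: cvgB; [exact: cvg_cst|exact: c].
rewrite -(cvg_lim _ c')//; apply: limr_le; first by apply/cvg_ex; eexists; exact: c'.
by exists N => // n' /= Nn'; exact: NP.
Qed.

Lemma measurable_good : measurable (good : set (pathT int F)).
Proof. exact: measurable_good_env. Qed.

Lemma pl_measurable m (H : W -> R) : bmf H -> dep (within m) H -> measurable_fun setT (pl H).
Proof.
move=> bH dH.
apply: (@measurable_fun_cvg _ _ _ _ (fun n x => \1_good x * Tn n H (ienv E x))).
- move=> n; apply: measurable_funM; first by apply: measurable_indic; exact: measurable_good.
  exact: (measurableT_comp (Tback_bmf K n n.*2 bH).1 (@measurable_ienv _ E _ F)).
- move=> x _; have [gx|bx] := pselect (good x).
    by rewrite indicE mem_set//=; under eq_fun do rewrite mul1r; exact: pl_cvg bH dH.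
  rewrite indicE memNset//= pl_bad//; under eq_fun do rewrite mul0r.
  exact: cvg_cst.
Qed.

Lemma pl_ufun m (H : W -> R) : ufun H -> dep (within m) H -> ufun (pl H).
Proof.
move=> uH dH; split; first exact: pl_measurable (ufun_bmf uH) dH.
move=> x; have [gx|bx] := pselect (good x); last by rewrite pl_bad// lexx ler01.
have c := pl_cvg_ufun gx uH dH; rewrite -(cvg_lim _ c)//.
have cc : cvgn (fun n => Tn n H (ienv E x)) by apply/cvg_ex; eexists; exact: c.
have T01 n : 0 <= Tn n H (ienv E x) <= 1 by exact: (Tback_ufun K n n.*2 uH).2.
apply/andP; split.
  by apply: limr_ge => //; apply: nearW => n; have /andP[] := T01 n.
by apply: limr_le => //; apply: nearW => n; have /andP[] := T01 n.
Qed.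

Lemma pl_env (H H' : W -> R) x : (forall z, env z = x -> H z = H' z) -> pl H x = pl H' x.
Proof.
move=> HH'; congr (limn _); apply/funext => n; congr (_ * _).
apply: Tback_env => z' zz'; apply: HH'.
by apply/funext => s; rewrite /env zz'.
Qed.

Lemma pl_window m x : good x ->
  pfunctional (fun H : W -> R => pl (fun z => H (keep (within m) z)) x).
Proof.
move=> gx; have mk := @measurable_keep _ E _ F (within m).
have dk (H : W -> R) : dep (within m) (fun z => H (keep (within m) z)) by exact: dep_keep.
apply: (@pfunctional_unif_limit _ _ _
  (fun n (H : W -> R) => Tn n (fun z => H (keep (within m) z)) (ienv E x))).
- move=> n; exact: (pfunctional_comp mk (Tn_pfunctional n (ienv E x))).
- move=> H [mH [C HC]]; apply: (@pl_cvg m) => //.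
  by split; [exact: measurableT_comp mH mk|exists C].
- move=> e e0; have [N NP] := pl_unif m gx e0.
  exists N => n Nn H [mH H01]; apply: NP => //.
  by split; [exact: measurableT_comp mH mk|move=> z; exact: H01].
Qed.

Lemma pl_one x : good x -> pl (fun=> 1) x = 1.
Proof.
move=> gx; rewrite /pl indicE mem_set//=.
rewrite (_ : (fun n => _) = fun=> 1); first exact: (cvg_lim _ (cvg_cst _)).
by apply/funext => n; rewrite mul1r /Tn Tback_id.
Qed.

Lemma pl_keep m (H : W -> R) : dep (within m) H ->
  pl H = pl (fun z => H (keep (within m) z)).
Proof.
by move=> dH; congr pl; apply/funext => z; rewrite keep_id.
Qed.

End Limit.

Section PrefixSets.
Notation B := (pathT nat bool).

Definition prefix_set : set (set B) :=
  [set S | exists N (h : seq bool -> bool), S = [set c : B | h (mkseq c N)]].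

Lemma prefix_setT : prefix_set setT.
Proof. by exists 0%N, (fun=> true); apply/seteqP; split. Qed.

Lemma take_mkseq (T : Type) (f : nat -> T) n m : (n <= m)%N -> take n (mkseq f m) = mkseq f n.
Proof. by move=> nm; rewrite /mkseq -map_take take_iota (minn_idPl nm). Qed.

Lemma prefix_setI : setI_closed prefix_set.
Proof.
move=> _ _ [N [h ->]] [N' [h' ->]].
exists (maxn N N'), (fun s => h (take N s) && h' (take N' s)).
apply/seteqP; split=> c /=; rewrite !take_mkseq ?leq_maxl ?leq_maxr//.
  by move=> [-> ->].
by move=> /andP.
Qed.

Lemma prefix_measurable S : prefix_set S -> measurable S.
Proof.
move=> [N [h ->]].
have -> : [set c : B | h (mkseq c N)] = [set c | exists s : seq bool, h s /\ mkseq c N = s].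
  by apply/seteqP; split=> c /=; [exists (mkseq c N)|move=> [s [hs ->]]].
apply: (@measurable_exists _ B) => s.
have mc i (v : bool) : measurable [set c : B | c i = v].
  by have := measurable_coord (T := bool) i measurableT (Y := [set v]) I; rewrite setTI.
have m2 : measurable [set c : B | mkseq c N = s].
  have [sN|sN] := eqVneq (size s) N; last first.
    rewrite (_ : [set c | _] = set0)//; apply/seteqP; split=> c //= cs.
    by move: sN; rewrite -cs size_mkseq eqxx.
  have -> : [set c : B | mkseq c N = s] =
      [set c : B | forall i : nat, (i < N)%N -> c i = nth false s i].
    apply/seteqP; split=> c /=.
      by move=> <- i iN; rewrite nth_mkseq.
    move=> h'; apply: (@eq_from_nth _ false); rewrite size_mkseq// => i iN.
    by rewrite nth_mkseq// h'.
  apply: (@measurable_forall _ B) => i; apply: measurable_imply; exact: mc.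
case hs : (h s); last by rewrite (_ : [set c | _] = set0)//; apply/seteqP; split=> c //= [].
by move: m2; congr measurable; apply/seteqP; split=> c //= [].
Qed.

Lemma prefix_gen : @measurable _ B = <<s prefix_set >>.
Proof.
apply/seteqP; split.
  apply: smallest_sub; first exact: smallest_sigma_algebra.
  move=> _ [t [A [mA ->]]]; apply: sub_sigma_algebra.
  exists t.+1, (fun s => `[< A (nth false s t) >]).
  by apply/seteqP; split=> c /=; rewrite nth_mkseq//; [move/asboolP|move=> ?; apply/asboolP].
apply: smallest_sub; first exact: sigma_algebra_measurable.
by move=> S /prefix_measurable.
Qed.

End PrefixSets.

Section Quenched.
Context {R : realType} dE (E : measurableType dE) dF (F : measurableType dF)
  (K : R.-pker (F * E) ~> E) (V : E -> R) (lam b : F -> R) (eta : R -> F -> R).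
Notation W := (pathT int (E * F)%type).
Notation B := (pathT nat bool).
Notation within m := (fun s : int => (- (m%:Z) <= s) && (s <= m%:Z)).

Hypotheses (HVm : measurable_fun setT V) (HVpos : forall y, 0 < V y)
  (Hlamm : measurable_fun setT lam) (Hlam0 : forall x, 0 <= lam x)
  (Hbm : measurable_fun setT b) (Hb0 : forall x, 0 <= b x)
  (Hdrift : forall x y, (\int[K (x, y)]_z (V z)%:E <= (lam x * V y + b x)%:E)%E)
  (Hetam : measurable_fun ([set r : R | 0 < r] `*` [set: F]) (fun p : R * F => eta p.1 p.2))
  (Hminor : forall r : R, 0 < r -> exists nu : R.-pker F ~> E,
     forall x y A, V y <= r -> measurable A ->
       ((eta r x)%:E * nu x A <= K (x, y) A)%E).

Variables (enc : E -> nat -> bool) (dec : B -> E).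
Hypotheses (menc : forall k, measurable [set y | enc y k]) (mdec : measurable_fun setT dec)
  (encK : forall y, dec (enc y) = y).

Notation good := (good_env lam b eta).
Notation lim_ := (pl K lam b eta).

(* The bits of all the [y_t], enumerated by the pairs (t, bit number). *)
Definition bits (z : W) : B := fun i =>
  if unpickle i is Some (t, k) then enc (z (t : int)).1 (k : nat) else false.

Definition unbits (x : pathT int F) (c : B) : W :=
  fun t => (dec (fun k => c (pickle (t, k))), x t).

Definition keep_bits (m : nat) (c : B) : B := fun i =>
  if unpickle i is Some (t, k) then
    if within m (t : int) then c i else enc point (k : nat)
  else c i.

Lemma bits_keep m z : bits (keep (within m) z) = keep_bits m (bits z).
Proof.
apply/funext => i; rewrite /bits /keep_bits; case: unpickle => [[t k]|]//.
by rewrite /keep; case: ifP.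
Qed.

Lemma unbits_keep m x c : unbits x (keep_bits m c) = keep (within m) (unbits x c).
Proof.
apply/funext => t; rewrite /unbits /keep_bits /keep.
case: ifPn => tm; congr pair.
  by congr dec; apply/funext => k; rewrite pickleK tm.
rewrite -[RHS]encK; congr dec; apply/funext => k.
by rewrite pickleK (negbTE tm).
Qed.

Lemma bitsK z : unbits (env z) (bits z) = z.
Proof.
apply/funext => t; rewrite /unbits /bits /env.
rewrite [X in dec X](_ : _ = enc (z t).1); first by rewrite encK; case: (z t).
by apply/funext => k; rewrite pickleK.
Qed.

Lemma measurable_bits : measurable_fun setT bits.
Proof.
apply: measurable_path => i; apply: (measurable_fun_bool true); rewrite setTI.
rewrite /bits; case: unpickle => [[t k]|] /=; last first.
  by rewrite (_ : _ @^-1` _ = set0)//; apply/seteqP; split.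
have := measurableT_comp measurable_fst (measurable_coord (T := (E * F)%type) t).
by move=> /(_ measurableT _ (menc k)); rewrite setTI.
Qed.

Lemma measurable_keep_bits m : measurable_fun setT (keep_bits m).
Proof.
apply: measurable_path => i; rewrite /keep_bits; case: unpickle => [[t k]|].
  by case: (within m t) => //; exact: measurable_coord.
exact: measurable_coord.
Qed.

Lemma measurable_unbits x : measurable_fun setT (unbits x).
Proof.
apply: measurable_path => t; apply: measurable_fun_pair => //.
apply: (measurableT_comp mdec); apply: measurable_path => k.
exact: measurable_coord.
Qed.

Definition window (N : nat) : nat :=
  \max_(i < N) (if (unpickle i : option (int * nat)) is Some p then `|p.1|%N else 0%N).

Lemma dep_prefix N : dep (within (window N)) (fun z => mkseq (bits z) N).
Proof.
move=> z z' e2 e1; apply/eq_in_map => i; rewrite mem_iota add0n => /andP[_ iN].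
rewrite /bits; case pi : (unpickle i) => [[t k]|//]; congr (enc _ k); apply: e1.
have := leq_bigmax (F := fun i : 'I_N =>
  if (unpickle i : option (int * nat)) is Some p then `|p.1|%N else 0%N) (Ordinal iN).
rewrite /= pi -/(window N) /=; lia.
Qed.

Definition cyl (s : seq bool) : set W := [set z | mkseq (bits z) (size s) == s].

Definition qlaw (x : pathT int F) (s : seq bool) : R := lim_ (\1_(cyl s)) x.

Lemma measurable_prefix N (h : seq bool -> bool) : measurable [set z : W | h (mkseq (bits z) N)].
Proof.
have mS : measurable [set c : B | h (mkseq c N)].
  by apply: prefix_measurable; exists N, h.
by have := measurable_bits measurableT mS; rewrite setTI.
Qed.

Lemma measurable_cyl s : measurable (cyl s).
Proof. exact: (measurable_prefix (size s) (fun r => r == s)). Qed.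

Lemma dep_indic_prefix m N (h : seq bool -> bool) : (window N <= m)%N ->
  dep (within m) (\1_[set z : W | h (mkseq (bits z) N)] : W -> R).
Proof.
move=> Nm z z' e2 e1.
have E1 : mkseq (bits z) N = mkseq (bits z') N.
  by apply: dep_prefix => // s hs; apply: e1; lia.
by rewrite !indicE; congr ((nat_of_bool _)%:R); apply/idP/idP => /set_mem /=;
  rewrite ?E1 => h'; apply/mem_set; rewrite /= ?E1.
Qed.

Lemma pl_sum m I (r : seq I) (f_ : I -> W -> R) x : good x ->
  (forall i, bmf (f_ i)) -> (forall i, dep (within m) (f_ i)) ->
  lim_ (fun z => \sum_(i <- r) f_ i z) x = \sum_(i <- r) lim_ (f_ i) x.
Proof.
move=> gx bf df; have PW := pl_window HVm HVpos Hlam0 Hb0 Hdrift Hminor m gx.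
under eq_bigr do rewrite (pl_keep K lam b eta (df _)).
rewrite -(pfun_sum PW)//; congr pl; apply/funext => z.
by apply: eq_bigr => i _; rewrite (keep_id _ (df i)).
Qed.

Lemma qlaw_ge0 x s : 0 <= qlaw x s.
Proof.
have uc := ufun_indic (R := R) (measurable_cyl s).
have dc : dep (within (window (size s))) (\1_(cyl s) : W -> R).
  exact: (@dep_indic_prefix _ (size s) (fun r => r == s)).
by have [_ /(_ x)/andP[]] := pl_ufun HVm HVpos Hlamm Hlam0 Hbm Hb0 Hdrift Hetam Hminor uc dc.
Qed.

Lemma measurable_qlaw s : measurable_fun setT (qlaw ^~ s).
Proof.
have uc := ufun_indic (R := R) (measurable_cyl s).
have dc : dep (within (window (size s))) (\1_(cyl s) : W -> R).
  exact: (@dep_indic_prefix _ (size s) (fun r => r == s)).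
exact: (pl_measurable HVm HVpos Hlamm Hlam0 Hbm Hb0 Hdrift Hetam Hminor (ufun_bmf uc) dc).
Qed.

Lemma qlaw_nil x : good x -> qlaw x [::] = 1.
Proof.
move=> gx; rewrite /qlaw (_ : \1_(cyl [::]) = fun=> 1); first exact: pl_one.
by apply/funext => z; rewrite indicE mem_set.
Qed.

Lemma qlaw_split x s : good x -> qlaw x s = qlaw x (rcons s false) + qlaw x (rcons s true).
Proof.
move=> gx.
pose f_ (c : bool) : W -> R := \1_(cyl (rcons s c)).
have bf c : bmf (f_ c) by apply/ufun_bmf/ufun_indic; exact: measurable_cyl.
have df c : dep (within (window (size s).+1)) (f_ c).
  apply: (@dep_indic_prefix _ (size (rcons s c)) (fun r => r == rcons s c)).
  by rewrite size_rcons.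
have := pl_sum [:: false; true] gx bf df; rewrite !big_cons !big_nil addr0 => <-.
congr (pl _ _ _ _ _ x); apply/funext => z; rewrite !big_cons !big_nil addr0 /f_ !indicE.
have E1 c : (z \in cyl (rcons s c)) = (mkseq (bits z) (size s) == s) && (bits z (size s) == c).
  transitivity (mkseq (bits z) (size s).+1 == rcons s c).
    by apply/idP/idP => [/set_mem|h]; [|apply/mem_set]; rewrite /cyl /= size_rcons.
  rewrite {1}/mkseq -[X in iota 0 X]addn1 iotaD map_cat cats1 add0n.
  by rewrite eqseq_rcons.
have E2 : (z \in cyl s) = (mkseq (bits z) (size s) == s).
  by apply/idP/idP => [/set_mem|h] //; apply/mem_set.
by rewrite !E1 E2; case: (_ == s); case: (bits z (size s)); rewrite /= ?addr0 ?add0r.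
Qed.

Lemma measurable_word_sec x N s : measurable [set u : measurableTypeR R | word (qlaw x) u N = s].
Proof.
have mx : measurable_fun setT (fun u : measurableTypeR R => (x, u)) by exact: measurable_fun_pair.
by have := mx measurableT _ (measurable_word measurable_qlaw N s); rewrite setTI.
Qed.

Lemma word_law x s : good x ->
  \int[unif01]_u \1_[set u | word (qlaw x) u (size s) = s] u = qlaw x s.
Proof.
move=> gx; have q0 := qlaw_ge0 x; have q1 := qlaw_nil gx; have qD s' := @qlaw_split x s' gx.
rewrite Rintegral_indic; last exact: measurable_word_sec.
have [l0 l1] := lft_bounds q0 q1 qD s.
suff EU : unif01 [set u : measurableTypeR R | word (qlaw x) u (size s) = s] = (qlaw x s)%:E.
  exact: (congr1 fine EU).
rewrite -(unif01_itv l0 (q0 s) l1); apply: unif01_supp.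
- exact: measurable_word_sec.
- exact: measurable_itv.
- by move=> u u01; rewrite /= in_itv/=; exact: (wordP q0 q1 qD).
Qed.

Lemma expand_word N (h : seq bool -> bool) (w : seq bool) : size w = N ->
  (h w)%:R = \sum_(s : N.-tuple bool) (h s)%:R * (w == s)%:R :> R.
Proof.
move=> sw; pose t : N.-tuple bool := Tuple (introT eqP sw).
rewrite (bigD1 t)//= eqxx mulr1 big1 ?addr0// => s st.
have [ws|] := eqVneq w s; last by rewrite mulr0.
by move: st; rewrite -val_eqE /= -ws eqxx.
Qed.

Lemma prefix_law x N (h : seq bool -> bool) : good x ->
  \int[unif01]_u (h (word (qlaw x) u N))%:R =
  lim_ (fun z => (h (mkseq (bits z) N))%:R) x.
Proof.
move=> gx.
have -> : (fun z : W => (h (mkseq (bits z) N))%:R : R) =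
    (fun z => \sum_(s <- index_enum (N.-tuple bool)) (h s)%:R * \1_(cyl s) z).
  apply/funext => z; rewrite (@expand_word N) ?size_mkseq//; apply: eq_bigr => s _.
  rewrite indicE; congr (_ * (nat_of_bool _)%:R); rewrite -{1}(size_tuple s).
  by apply/idP/idP => [h'|/set_mem//]; apply/mem_set.
have bc (s : N.-tuple bool) : bmf (\1_(cyl s) : W -> R).
  by apply/ufun_bmf/ufun_indic; exact: measurable_cyl.
have dc (s : N.-tuple bool) : dep (within (window N)) (\1_(cyl s) : W -> R).
  by apply: (@dep_indic_prefix _ (size s) (fun r => r == s)); rewrite size_tuple.
rewrite (@pl_sum (window N))//; last 2 first.
- by move=> s; exact: bmfZ.
- by move=> s z z' e2 e1; rewrite (dc s z z').
pose g (s : N.-tuple bool) (u : measurableTypeR R) : R :=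
  (h s)%:R * \1_[set u | word (qlaw x) u N = s] u.
have bg s : bmf (g s).
  by apply/bmfZ/ufun_bmf/ufun_indic; exact: measurable_word_sec.
have PU := pfunctional_int (probability_setT (@unif01 R)).
transitivity (\int[unif01]_u (\sum_(s <- index_enum (N.-tuple bool)) g s u)).
  congr Rintegral; apply/funext => u; rewrite (@expand_word N) ?size_word//.
  apply: eq_bigr => s _; rewrite /g indicE; congr (_ * (nat_of_bool _)%:R).
  by apply/eqP/idP => [h'|/set_mem//]; apply/mem_set.
rewrite (pfun_sum PU)//; apply: eq_bigr => s _; rewrite /g.
have PW := pl_window HVm HVpos Hlam0 Hb0 Hdrift Hminor (window N) gx.
have bi : bmf (\1_[set u : measurableTypeR R | word (qlaw x) u N = s] : _ -> R).
  by apply/ufun_bmf/ufun_indic; exact: measurable_word_sec.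
transitivity ((h s)%:R * \int[unif01]_u \1_[set u : measurableTypeR R | word (qlaw x) u N = s] u).
  exact: (pfunZ PU).
have := word_law s gx; rewrite size_tuple => ->; rewrite /qlaw.
rewrite (pl_keep K lam b eta (dc s)) -(pfunZ PW)//.
congr (pl _ _ _ _ _ x); apply/funext => z.
by rewrite (keep_id _ (dc s)).
Qed.

Lemma measurable_bits_sec x : measurable_fun setT
  (fun u : measurableTypeR R => bit (qlaw x) u : B).
Proof.
apply: measurable_path => n.
have mx : measurable_fun setT (fun u : measurableTypeR R => (x, u)) by exact: measurable_fun_pair.
exact: (measurableT_comp (measurable_bit measurable_qlaw n) mx).
Qed.

Lemma quenched_law m x (H : W -> R) : good x -> bmf H ->
  \int[unif01]_u H (keep (within m) (unbits x (bit (qlaw x) u))) =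
  lim_ (fun z => H (keep (within m) z)) x.
Proof.
move=> gx bH.
have PU := pfunctional_int (probability_setT (@unif01 R)).
have mu1 : measurable_fun setT (fun u : measurableTypeR R => keep_bits m (bit (qlaw x) u) : B).
  exact: (measurableT_comp (measurable_keep_bits m) (measurable_bits_sec x)).
have PW := pl_window HVm HVpos Hlam0 Hb0 Hdrift Hminor m gx.
have P1 := pfunctional_comp mu1 PU; have P2 := pfunctional_comp measurable_bits PW.
have bHu : bmf (fun c : B => H (unbits x c)).
  have [mH [C HC]] := bH; split; last by exists C.
  exact: (measurableT_comp mH (measurable_unbits x)).
have agree S : prefix_set S -> \int[unif01]_u \1_S (keep_bits m (bit (qlaw x) u)) =
    lim_ (fun z => \1_S (bits (keep (within m) z))) x.
  move=> [N [h ->]].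
  pose g (s : seq bool) : seq bool := mkseq (fun i =>
    if (unpickle i : option (int * nat)) is Some p then
      if within m p.1 then nth false s i else enc point p.2
    else nth false s i) N.
  have gE (c : B) : mkseq (keep_bits m c) N = g (mkseq c N).
    apply/eq_in_map => i; rewrite mem_iota add0n => /andP[_ iN].
    by rewrite /keep_bits nth_mkseq//; case: unpickle => // -[].
  have iE (c : B) : \1_[set c : B | h (mkseq c N)] (keep_bits m c) = (h (g (mkseq c N)))%:R :> R.
    rewrite indicE; congr ((nat_of_bool _)%:R); rewrite -gE.
    by apply/idP/idP => [/set_mem//|h']; apply/mem_set.
  transitivity (\int[unif01]_u (h (g (word (qlaw x) u N)))%:R).
    by congr Rintegral; apply/funext => u; rewrite iE wordE.
  rewrite (prefix_law N (fun s => h (g s)) gx); congr (pl _ _ _ _ _ x).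
  by apply/funext => z; rewrite bits_keep iE.
have := pfun_ext P1 P2 prefix_gen prefix_setI prefix_setT agree bHu.
under eq_Rintegral do rewrite unbits_keep.
move=> ->; apply: pl_env => z zx.
by rewrite bits_keep unbits_keep -zx bitsK.
Qed.

End Quenched.

Lemma Rintegral_fubini {R : realType} d1 (T1 : measurableType d1) d2 (T2 : measurableType d2)
    (P1 : probability T1 R) (P2 : probability T2 R) (f : T1 * T2 -> R) : ufun f ->
  ufun (fun x => \int[P2]_y f (x, y)) /\
  \int[(P1 \x P2)%E]_z f z = \int[P1]_x \int[P2]_y f (x, y).
Proof.
move=> [mf f01].
have mEf : measurable_fun setT (EFin \o f) by exact/measurable_EFinP.
have Ef0 z : (0 <= (EFin \o f) z)%E by rewrite lee_fin; have /andP[] := f01 z.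
have us x : ufun (fun y => f (x, y)).
  by split; [exact: measurable_fun_pair2 mf|move=> y; exact: f01].
have u : ufun (fun x => \int[P2]_y f (x, y)).
  split; last by move=> x; apply: (Rintegral_ufun (probability_setT P2)).
  apply: measurableT_comp => //.
  exact: (measurable_fun_fubini_tonelli_F (m2 := P2) (EFin \o f)).
split=> //; rewrite {1}/Rintegral (fubini_tonelli1 (EFin \o f))//; congr fine.
apply: eq_integral => x _; rewrite /fubini_F /Rintegral fineK//.
apply: (integrable_fin_num measurableT).
exact: (bmf_integrable (probability_setT P2) (ufun_bmf (us x))).
Qed.

Section Existence.
Context {R : realType} dE (E : measurableType dE) dF (F : measurableType dF)
  (K : R.-pker (F * E) ~> E) (V : E -> R) (lam b : F -> R) (eta : R -> F -> R).
Notation W := (pathT int (E * F)%type).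
Notation B := (pathT nat bool).
Notation within m := (fun s : int => (- (m%:Z) <= s) && (s <= m%:Z)).
Notation upto t := (fun s : int => s <= t).

Hypotheses (HVm : measurable_fun setT V) (HVpos : forall y, 0 < V y)
  (Hlamm : measurable_fun setT lam) (Hlam0 : forall x, 0 <= lam x)
  (Hbm : measurable_fun setT b) (Hb0 : forall x, 0 <= b x)
  (Hdrift : forall x y, (\int[K (x, y)]_z (V z)%:E <= (lam x * V y + b x)%:E)%E)
  (Hetam : measurable_fun ([set r : R | 0 < r] `*` [set: F]) (fun p : R * F => eta p.1 p.2))
  (Hminor : forall r : R, 0 < r -> exists nu : R.-pker F ~> E,
     forall x y A, V y <= r -> measurable A ->
       ((eta r x)%:E * nu x A <= K (x, y) A)%E).

Variables (enc : E -> nat -> bool) (dec : B -> E).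
Hypotheses (menc : forall k, measurable [set y | enc y k]) (mdec : measurable_fun setT dec)
  (encK : forall y, dec (enc y) = y).

Context d (O : measurableType d) (P : probability O R) (X : int -> O -> F).
Hypotheses (mX : measurable_process X) (sX : stationary P X)
  (gX : {ae P, forall w, good_env lam b eta (proc_path X w)}).

Notation lim_ := (pl K lam b eta).
Notation q := (qlaw K lam b eta enc).
Notation O' := (O * measurableTypeR R)%type.
Notation P' := (P \x (@unif01 R))%E.

Definition Xlift (t : int) (p : O') : F := X t p.1.

Definition Ylift (t : int) (p : O') : E :=
  dec (fun k => bit (q (proc_path X p.1)) p.2 (pickle (t, k))).

Notation Z := (joint Ylift Xlift).

Let mX' : measurable_process Xlift.
Proof. by move=> t; exact: (measurableT_comp (mX t) measurable_fst). Qed.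

Let mq s : measurable_fun setT (q ^~ s).
Proof. exact: (measurable_qlaw HVm HVpos Hlamm Hlam0 Hbm Hb0 Hdrift Hetam Hminor menc). Qed.

Let mY' : measurable_process Ylift.
Proof.
move=> t; apply: (measurableT_comp mdec); apply: measurable_path => k.
have mp : measurable_fun setT (fun p : O' => (proc_path X p.1, p.2)).
  apply: measurable_fun_pair; last exact: measurable_snd.
  exact: (measurableT_comp (measurable_proc_path mX) measurable_fst).
exact: (measurableT_comp (measurable_bit mq (pickle (t, k))) mp).
Qed.

Let mZ : measurable_fun setT (Z : O' -> W) := measurable_joint mY' mX'.

Lemma annealed_law m (H : W -> R) : ufun H -> dep (within m) H ->
  \int[P']_p H (Z p) = \int[P]_w lim_ H (proc_path X w).
Proof.
move=> uH dH.
have uHZ : ufun (fun p => H (Z p)).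
  by split; [exact: measurableT_comp uH.1 mZ|move=> p; exact: uH.2].
have [u1 ->] := Rintegral_fubini P (@unif01 R) uHZ.
have ul := pl_ufun HVm HVpos Hlamm Hlam0 Hbm Hb0 Hdrift Hetam Hminor uH dH.
apply: ae_eq_Rintegral.
- exact: ufun_bmf.
- have [ml l01] := ul; apply: ufun_bmf; split; last by move=> w; exact: l01.
  exact: (measurableT_comp ml (measurable_proc_path mX)).
apply: filterS gX => w gw.
have := quenched_law HVm HVpos Hlamm Hlam0 Hbm Hb0 Hdrift Hetam Hminor menc mdec encK m gw
  (ufun_bmf uH).
rewrite -(pl_keep K lam b eta dH) => <-; congr Rintegral; apply/funext => u.
by rewrite keep_id.
Qed.

Lemma annealed_limit m (H : W -> R) : ufun H -> dep (within m) H ->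
  \int[P]_w Tn K n H (ienv E (proc_path X w)) @[n --> \oo] --> \int[P']_p H (Z p).
Proof.
move=> uH dH; rewrite (annealed_law uH dH).
have ul := pl_ufun HVm HVpos Hlamm Hlam0 Hbm Hb0 Hdrift Hetam Hminor uH dH.
have mp := measurable_proc_path mX.
apply: Rintegral_ae_cvg.
- exact: probability_setT.
- move=> n; split; last by move=> w; exact: (Tback_ufun K n n.*2 uH).2.
  apply: (measurableT_comp (Tback_ufun K n n.*2 uH).1).
  exact: (measurableT_comp (@measurable_ienv _ E _ F) mp).
- by split; [exact: measurableT_comp ul.1 mp|move=> w; exact: ul.2].
- apply: filterS gX => w gw.
  exact: (pl_cvg HVm HVpos Hlam0 Hb0 Hdrift Hminor gw (ufun_bmf uH) dH).
Qed.

Lemma Tn_Tstep n t (H : W -> R) : (`|t| < n)%N -> dep (upto (t + 1)) H ->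
  Tn K n (Tstep K t H) = Tn K n H.
Proof.
move=> tn dH; pose c := `|(n%:Z - (t + 1))%R|%N.
have cE : n%:Z - c%:Z = t + 1 by rewrite /c; lia.
have cE' : n%:Z - c.+1%:Z = t by lia.
have -> : Tn K n = fun H => Tback K n%:Z ((n.*2 - c.+1) + c.+1) H.
  by apply/funext => H'; rewrite /Tn subnK//; rewrite -addnn /c; lia.
rewrite !Tback_add cE'; congr Tback.
rewrite [LHS]Tback_id; last first.
  move=> z s e; rewrite cE' => st; apply: (@upd_dep _ _ _ _ (upto t)); last by lia.
  by apply: Tstep_dep dH => [|r]; lia.
rewrite /= cE' Tback_id//.
by move=> z s e; rewrite cE => st; apply: (@upd_dep _ _ _ _ (upto (t + 1))) => //; lia.
Qed.

Lemma window_solves m t (H : W -> R) : ufun H -> dep (within m) H -> dep (upto (t + 1)) H ->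
  \int[P']_p H (Z p) = \int[P']_p Tstep K t H (Z p).
Proof.
move=> uH dH dH'; pose m' := (m + `|t|)%N.
have dT : dep (within m') (Tstep K t H).
  by apply: Tstep_dep dH => [|s]; rewrite /m'; lia.
have c1 := annealed_limit uH dH; have c2 := annealed_limit (Tstep_ufun K t uH) dT.
apply: (cvg_unique (@Rhausdorff R) c1); apply: cvg_trans c2.
apply: near_eq_cvg; exists `|t|.+1%N => // n /= tn.
by rewrite Tn_Tstep.
Qed.

Lemma lift_markov : markov_in_env K P' Ylift Xlift.
Proof.
move=> t A mA C.
have tE : t = (t - 1) + 1 by rewrite subrK.
rewrite {1}tE => /cond_sigma_keep[S mS ->].
set t1 := t - 1.
have mB := measurable_keep_joint mY' mX' (upto t1) mS.
have mYA : measurable [set p | A (Ylift t p)].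
  by have := mY' t measurableT mA; rewrite setTI.
have mkj : measurable_fun setT (fun p => keep (upto t1) (Z p) : W).
  exact: (measurableT_comp (@measurable_keep _ E _ F (upto t1)) mZ).
have PP := pfunctional_int (probability_setT P').
pose a p : R := \1_A (Ylift t p).
pose k p : R := fine (K (Xlift t1 p, Ylift t1 p) A).
have ua : ufun a.
  by split; [exact: measurableT_comp (ufun_indic mA).1 (mY' t)|move=> p; exact: (ufun_indic mA).2].
have uk : ufun k by exact: measurable_K_joint.
have P1 := pfunctional_comp mkj (pfunctional_weight ua PP).
have P2 := pfunctional_comp mkj (pfunctional_weight uk PP).
have EQ : \int[P']_p (a p * \1_S (keep (upto t1) (Z p))) =
  \int[P']_p (k p * \1_S (keep (upto t1) (Z p))).
  apply: (pfun_ext (G := @rect_cyl _ E _ F) P1 P2); last exact/ufun_bmf/ufun_indic.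
  - exact: rect_cyl_gen.
  - exact: rect_cylI.
  - exact: rect_cylT.
  move=> S' rS; have mS' := rect_cyl_measurable rS.
  case: rS mS' => l [A1 [B1 [mA1 mB1 ->]]] mS'.
  set S1 := [set z : W | _] in mS' *.
  pose H (z : W) : R := \1_A (z t).1 * \1_S1 (keep (upto t1) z).
  pose m := (\max_(r <- l) `|r| + `|t|)%N.
  have mzt : measurable_fun setT (fun z : W => (z t).1).
    exact: (measurableT_comp measurable_fst (measurable_coord (T := (E * F)%type) t)).
  have uH : ufun H.
    apply: ufunM.
      by split; [exact: measurableT_comp (ufun_indic mA).1 mzt|move=> z; exact: (ufun_indic mA).2].
    split; last by move=> z; exact: (ufun_indic mS').2.
    exact: (measurableT_comp (ufun_indic mS').1 (@measurable_keep _ E _ F (upto t1))).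
  have dH : dep (within m) H.
    move=> z z' e2 e1; rewrite /H e1; last by rewrite /m; lia.
    congr (_ * _); rewrite !indicE; congr ((nat_of_bool _)%:R).
    have zz' r : r \in l -> keep (upto t1) z r = keep (upto t1) z' r.
      move=> rl; have /e1 : within m r.
        have := leq_bigmax_seq (P := xpredT) (F := fun r : int => `|r|%N) r rl isT.
        rewrite /m; set M := (\max_(r <- l) _)%N; lia.
      have := e2 r; rewrite /keep; case: (z r) => a1 a2; case: (z' r) => b1 b2 /= -> ->.
      by [].
    by apply/idP/idP => /set_mem h; apply/mem_set => r rl; [rewrite -zz'//|rewrite zz'//]; exact: h.
  have dH' : dep (upto (t1 + 1)) H.
    move=> z z' e2 e1; rewrite /H e1; last by rewrite /t1; lia.
    congr (_ * \1_S1 _); apply/funext => r; rewrite /keep; case: ifP => rt; last by rewrite e2.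
    have := e1 r; have := e2 r; case: (z r) => a1 a2; case: (z' r) => b1 b2 /= -> -> //; lia.
  have TH z : Tstep K t1 H z = fine (K ((z t1).2, (z t1).1) A) * \1_S1 (keep (upto t1) z).
    have kz : kcoord K t1 z setT = 1%E by exact: prob_kernel.
    rewrite /Tstep -(Rintegral_indic (kcoord K t1 z) mA) mulrC.
    rewrite -(pfunZ (pfunctional_int kz)); last exact/ufun_bmf/ufun_indic.
    congr Rintegral; apply/funext => e; rewrite /H mulrC; congr (\1_S1 _ * _).
      apply/funext => s; rewrite /keep /upd; case: eqVneq => [->|//].
      by have -> : (t1 + 1 <= t1) = false by lia.
    by rewrite /upd -tE eqxx.
  have := window_solves uH dH dH'; rewrite (funext TH); exact.
rewrite integral_setK// (measure_Rintegral (probability_setT P')); last exact: measurableI.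
congr EFin; apply: etrans (etrans EQ _).
  congr Rintegral; apply/funext => p; rewrite !indicE in_setI mulrC -natrM mulnb.
  by [].
by congr Rintegral; apply/funext => p; rewrite mulrC.
Qed.

Lemma lift_shift k m (H : W -> R) : ufun H -> dep (within m) H ->
  \int[P']_p H (shiftz k%:Z (Z p)) = \int[P']_p H (Z p).
Proof.
move=> uH dH; pose H' (z : W) := H (shiftz k%:Z z).
have uH' : ufun H'.
  split; last by move=> z; exact: uH.2.
  exact: (measurableT_comp uH.1 (@measurable_shiftz _ E _ F k)).
have dH' : dep (within (m + k)) H'.
  move=> z z' e2 e1; apply: dH => s; rewrite /shiftz; first exact: e2.
  by move=> h; apply: e1; lia.
have c1 := annealed_limit uH' dH'; have c2 := annealed_limit uH dH.
apply: (cvg_unique (@Rhausdorff R) c1).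
have c3 : \int[P]_w Tn K (n + k) H (ienv E (proc_path X w)) @[n --> \oo] --> \int[P']_p H (Z p).
  by move: c2; rewrite -(cvg_shiftn k (fun n => \int[P]_w Tn K n H (ienv E (proc_path X w)))).
apply: cvg_trans c3; apply: near_eq_cvg; exists (m + k)%N => // n /= mkn.
have E1 : Tn K n H' = fun z => Tn K (n + k) H (shiftz k%:Z z).
  apply/funext => z; rewrite (@Tn_Tback _ _ _ _ _ _ m (n + k))//; last by lia.
  rewrite /Tn Tback_shift.
  have -> : n.*2 = ((n + k + m) + (n - k - m))%N by rewrite -addnn; lia.
  rewrite Tback_add; have -> : n%:Z - k%:Z - (n - k - m)%N%:Z = m%:Z by lia.
  rewrite [Tback K _ (n - k - m) H]Tback_id// => z' s e sn.
  by apply: (upd_dep z' e dH); lia.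
rewrite E1.
have mXk : measurable_process (fun t => X (t + k%:Z)) by move=> t; exact: mX.
have bT : bmf (fun x : pathT int F => Tn K (n + k) H (ienv E x)).
  have [mT [C TC]] := Tback_bmf K (n + k)%N (n + k).*2 (ufun_bmf uH).
  by split; [exact: (measurableT_comp mT (@measurable_ienv _ E _ F))|exists C => x; exact: TC].
exact/esym/(same_law_int mXk mX (sX k%:Z) bT).
Qed.

Lemma lift_stationary : stationary P' (fun t p => (Ylift t p, Xlift t p)).
Proof.
move=> s n ts As mAs.
pose S : set W := [set z | forall i, As i (z (ts i))].
have mS : measurable S.
  apply: (@measurable_forall _ W 'I_n) => i.
  by have := measurable_coord (ts i) measurableT (mAs i); rewrite setTI.
pose m := (\max_(i < n) `|ts i|)%N.
have tsm i : (`|ts i| <= m)%N by exact: (leq_bigmax (F := fun i => `|ts i|%N) i).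
pose H (r : int) (z : W) : R := \1_S (shiftz r z).
have uH r : ufun (H r).
  split; last by move=> z; exact: (ufun_indic mS).2.
  exact: (measurableT_comp (ufun_indic mS).1 (@measurable_shiftz _ E _ F r)).
have dH r : dep (within (m + `|r|)) (H r).
  move=> z z' e2 e1; rewrite /H !indicE; congr ((nat_of_bool _)%:R).
  have zz' i : shiftz r z (ts i) = shiftz r z' (ts i).
    have /e1 : within (m + `|r|)%N (ts i + r) by have := tsm i; lia.
    have := e2 (ts i + r); rewrite /shiftz.
    by case: (z (ts i + r)) => a1 a2; case: (z' (ts i + r)) => b1 b2 /= -> ->.
  by apply/idP/idP => /set_mem h; apply/mem_set => i; [rewrite -zz'|rewrite zz']; exact: h.
have shH r k p : H r (shiftz k%:Z (Z p)) = H (r + k%:Z) (Z p).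
  by rewrite /H; congr (\1_S _); apply/funext => t; rewrite /shiftz; congr (Z p _); lia.
have key : \int[P']_p H s (Z p) = \int[P']_p H 0 (Z p).
  have [s0|s0] := leP 0 s.
    have sE : s = 0 + `|s|%N%:Z by lia.
    by rewrite {1}sE -(lift_shift `|s|%N (uH 0) (dH 0));
      congr Rintegral; apply/funext => p; rewrite shH.
  have sE : 0 = s + `|s|%N%:Z by lia.
  rewrite -(lift_shift `|s|%N (uH s) (dH s)); congr Rintegral; apply/funext => p.
  by rewrite shH -sE.
have mSr r : measurable [set p | S (shiftz r (Z p))].
  have := measurable_joint_set mY' mX' (S := [set z | S (shiftz r z)]); apply.
  by have := @measurable_shiftz _ E _ F r measurableT S mS; rewrite setTI.
change (P' [set p | S (shiftz s (Z p))] = P' [set p | S (Z p)]).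
have -> : [set p | S (Z p)] = [set p | S (shiftz 0 (Z p))].
  by apply/seteqP; split=> p /=; rewrite (_ : shiftz 0 (Z p) = Z p)//;
    apply/funext => t; rewrite /shiftz addr0.
rewrite (measure_Rintegral (probability_setT P') (mSr s)).
by rewrite (measure_Rintegral (probability_setT P') (mSr 0)); congr EFin; exact: key.
Qed.

Lemma lift_law : same_law P' Xlift P X.
Proof.
move=> n ts As mAs.
have mS : measurable [set w | forall i, As i (X (ts i) w)].
  apply: (@measurable_forall _ O 'I_n) => i.
  by have := mX (ts i) measurableT (mAs i); rewrite setTI.
have -> : [set p : O' | forall i, As i (Xlift (ts i) p)] =
    [set w | forall i, As i (X (ts i) w)] `*` setT.
  by apply/seteqP; split=> p /=; [|case].
apply: etrans (product_measure1E P (@unif01 R) mS measurableT) _.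
by rewrite [X in (_ * X)%E](_ : _ = 1%E) ?mule1//; exact: (probability_setT (@unif01 R)).
Qed.

Lemma markov_exists :
  exists (dO' : measure_display) (Omega' : measurableType dO') (Q : probability Omega' R)
          (Y' : int -> Omega' -> E) (X' : int -> Omega' -> F),
     [/\ measurable_process Y', measurable_process X',
         same_law Q X' P X,
         stationary Q (fun t w => (Y' t w, X' t w)) &
         markov_in_env K Q Y' X'].
Proof.
exists _, O', P', Ylift, Xlift; split.
- exact: mY'.
- exact: mX'.
- exact: lift_law.
- exact: lift_stationary.
- exact: lift_markov.
Qed.

End Existence.

Theorem theorem1 (R : realType)
  (dE : measure_display) (E : measurableType dE)
  (dF : measure_display) (F : measurableType dF)
  (HE : polish_borel R E) (HF : polish_borel R F)
  (* P_x(y, A) = K (x, y) A, jointly measurable in (x, y) *)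
  (K : R.-pker (F * E) ~> E)
  (dO : measure_display) (Omega : measurableType dO) (P : probability Omega R)
  (X : int -> Omega -> F) (HXm : measurable_process X)
  (* (A1) *)
  (HA1 : stationary P X)
  (* (A2) *)
  (V : E -> R) (lam b : F -> R)
  (HVm : measurable_fun setT V) (HVpos : forall y, 0 < V y)
  (Hlamm : measurable_fun setT lam) (Hlam0 : forall x, 0 <= lam x)
  (Hbm : measurable_fun setT b) (Hb0 : forall x, 0 <= b x)
  (Hlamint : (\int[P]_w (logp (lam (X 0 w)))%:E < +oo)%E)
  (Hbint : (\int[P]_w (logp (b (X 0 w)))%:E < +oo)%E)
  (Hdrift : forall x y, (\int[K (x, y)]_z (V z)%:E <= (lam x * V y + b x)%:E)%E)
  (Hcontr : {ae P, forall w,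
     (limn_esup (fun n : nat =>
        (powR (\prod_(1 <= i < n.+1) lam (X (- (i%:Z)) w)) (n%:R^-1))%:E) < 1%:E)%E})
  (* (A3) *)
  (eta : R -> F -> R)
  (Hetam : measurable_fun ([set r : R | 0 < r] `*` [set: F]) (fun p : R * F => eta p.1 p.2))
  (Heta01 : forall r x, 0 < r -> 0 < eta r x < 1)
  (Hminor : forall r : R, 0 < r -> exists nu : R.-pker F ~> E,
     forall x y A, V y <= r -> measurable A ->
       ((eta r x)%:E * nu x A <= K (x, y) A)%E) :
  (* existence *)
  (exists (dO' : measure_display) (Omega' : measurableType dO') (P' : probability Omega' R)
          (Y' : int -> Omega' -> E) (X' : int -> Omega' -> F),
     [/\ measurable_process Y', measurable_process X',
         same_law P' X' P X,
         stationary P' (fun t w => (Y' t w, X' t w)) &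
         markov_in_env K P' Y' X'])
  /\
  (* uniqueness of the distribution, and ergodicity *)
  (forall (d1 : measure_display) (O1 : measurableType d1) (P1 : probability O1 R)
          (Y1 : int -> O1 -> E) (X1 : int -> O1 -> F)
          (d2 : measure_display) (O2 : measurableType d2) (P2 : probability O2 R)
          (Y2 : int -> O2 -> E) (X2 : int -> O2 -> F),
     measurable_process Y1 -> measurable_process X1 ->
     same_law P1 X1 P X -> stationary P1 (fun t w => (Y1 t w, X1 t w)) ->
     markov_in_env K P1 Y1 X1 ->
     measurable_process Y2 -> measurable_process X2 ->
     same_law P2 X2 P X -> stationary P2 (fun t w => (Y2 t w, X2 t w)) ->
     markov_in_env K P2 Y2 X2 ->
     same_law P1 (fun t w => (Y1 t w, X1 t w)) P2 (fun t w => (Y2 t w, X2 t w)))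
  /\
  (ergodic P X ->
   forall (d1 : measure_display) (O1 : measurableType d1) (P1 : probability O1 R)
          (Y1 : int -> O1 -> E) (X1 : int -> O1 -> F),
     measurable_process Y1 -> measurable_process X1 ->
     same_law P1 X1 P X -> stationary P1 (fun t w => (Y1 t w, X1 t w)) ->
     markov_in_env K P1 Y1 X1 ->
     ergodic P1 (fun t w => (Y1 t w, X1 t w))).
Proof.
have goodX : {ae P, forall w, good_env lam b eta (proc_path X w)}.
  exact: (good_env_ae Hlamm Hlam0 Hbm Hb0 Hetam Heta01 HXm HA1 Hbint Hcontr).
have mgood : measurable (good_env lam b eta : set (pathT int F)).
  exact: measurable_good_env.
have good1 d (O : measurableType d) (Q : probability O R) (X1 : int -> O -> F) :
    measurable_process X1 -> same_law Q X1 P X ->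
    {ae Q, forall w, good_env lam b eta (proc_path X1 w)}.
  by move=> mX1 X1X; exact: (same_law_ae mX1 HXm X1X mgood goodX).
split; last split.
- have [enc [dec [menc mdec encK]]] := polish_code HE.
  exact: (markov_exists HVm HVpos Hlamm Hlam0 Hbm Hb0 Hdrift Hetam Hminor
    menc mdec encK HXm HA1 goodX).
- move=> d1 O1 P1 Y1 X1 d2 O2 P2 Y2 X2 mY1 mX1 X1X sZ1 K1 mY2 mX2 X2X sZ2 K2.
  apply: (markov_unique HVm HVpos Hlam0 Hb0 Hdrift Hminor mY1 mX1 sZ1 K1
    (good1 _ _ _ _ mX1 X1X) mY2 mX2 sZ2 K2 (good1 _ _ _ _ mX2 X2X)).
  by move=> n ts As mAs; rewrite X1X// X2X.
- move=> ergX d1 O1 P1 Y1 X1 mY1 mX1 X1X sZ1 K1.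
  exact: (markov_ergodic HVm HVpos Hlam0 Hb0 Hdrift Hminor mY1 mX1 sZ1
    (good1 _ _ _ _ mX1 X1X) (markov_solves mY1 mX1 K1) HXm X1X ergX).
Qed.
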